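(* Let $\Gamma$ be a finite connected core graph all of whose vertices have valency at least $3$. For any immersion $f:\Gamma\to\Gamma$ there is a computable integer $L(f)$ such that $f$ has no invariant loop with degree $d\ge 2$ if and only if $\hat\Gamma_{L(f)}$ is empty.
   Context: A finite graph is a finite 1-dimensional CW-complex; a core graph is a finite graph with no valence-1 vertices. An immersion $f:\Gamma\to\Gamma$ is a (continuous) locally injective map; under the valency assumption it maps vertices to vertices. ''Computable'' means that there is an algorithm which, given as input the finite combinatorial description of $\Gamma$ and $f$ (images of vertices, and the edge-paths that are images of edges), outputs $L(f)$. An invariant loop of degree $d$ for $f$ (where $d\ge1$ is an integer) is a nontrivial (not null-homotopic) loop $\sigma$ in $\Gamma$ such that for some integer $k\ge1$, $f^k(\sigma)$ is freely homotopic to $\sigma^d$. For $i\ge 0$ let $\Gamma_i=\{(x,y)\in\Gamma\times\Gamma: f^i(x)=f^i(y)\}$, so $\Gamma_0$ is the diagonal; put $\Gamma_{-1}=\emptyset$. Each $\Gamma_i$ is a finite graph and $\Gamma_{i-1}$ is a union of components of $\Gamma_i$. $\hat\Gamma_i$ denotes the maximal core subgraph of $\Gamma_i-\Gamma_{i-1}$; isolated points do not count, so contractible components contribute nothing and $\hat\Gamma_i=\emptyset$ exactly when every component of $\Gamma_i-\Gamma_{i-1}$ is contractible. *)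

(* Defs.v *)
From HB Require Import structures.
From mathcomp Require Import all_boot all_order all_algebra.
From mathcomp Require Import all_classical all_reals all_analysis.

Set Implicit Arguments.
Unset Strict Implicit.
Unset Printing Implicit Defensive.

Import Order.TTheory GRing.Theory Num.Theory.
Import numFieldNormedType.Exports.

Local Open Scope classical_set_scope.
Local Open Scope ring_scope.

(** * Finite graphs and their realizations *)

(* Every edge carries an arbitrary orientation; loops and multiple edges are
   allowed. *)
Record graph := Graph {
  nvert : nat;
  nedge : nat;
  src : 'I_nedge -> 'I_nvert;
  tgt : 'I_nedge -> 'I_nvert }.

(* The number of half-edges at v: a loop counts twice. *)
Definition valency (G : graph) (v : 'I_(nvert G)) : nat :=
  (#|[set e | src e == v]%SET| + #|[set e | tgt e == v]%SET|)%N.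

Definition core_graph (G : graph) : Prop :=
  forall v : 'I_(nvert G), valency v <> 1%N.

(* The points of the 1-dimensional CW-complex with 0-cells the vertices and
   1-cells the edges: [Inner e t] is the point of parameter t on the open
   1-cell e. *)
Inductive gspace (R : realType) (G : graph) : Type :=
| Vertex of 'I_(nvert G)
| Inner (e : 'I_(nedge G)) (t : R) of 0 < t < 1.

Arguments Vertex R {G}.

(* The characteristic map [0,1] -> G of the 1-cell e, extended to R by
   constants, i.e. precomposed with the retraction of R onto [0,1]. *)
Definition edge_pt (R : realType) (G : graph) (e : 'I_(nedge G)) (t : R) :
    gspace R G :=
  if @idP (0 < t < 1) is ReflectT t01 then Inner e t01
  else if t <= 0 then Vertex R (src e) else Vertex R (tgt e).

(* The CW topology: a set is open iff its preimages under all the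
   characteristic maps are (since R retracts onto [0,1], it does not matter
   whether openness is tested in R or in [0,1]). *)
Definition gspace_open (R : realType) (G : graph) : set (set (gspace R G)) :=
  [set U | forall e, open (edge_pt e @^-1` U : set R)].

Lemma gspace_openT (R : realType) (G : graph) :
  @gspace_open R G [set: gspace R G].
Proof. by move=> e; rewrite preimage_setT; exact: openT. Qed.

Lemma gspace_openI (R : realType) (G : graph) : setI_closed (@gspace_open R G).
Proof. by move=> U V oU oV e; rewrite preimage_setI; exact: openI. Qed.

Lemma gspace_open_bigU (R : realType) (G : graph) (I : Type)
    (U : I -> set (gspace R G)) :
  (forall i, gspace_open (U i)) -> gspace_open (\bigcup_i U i).
Proof.
by move=> oU e; rewrite preimage_bigcup; apply: bigcup_open => i _; exact: oU.
Qed.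

HB.instance Definition _ (R : realType) (G : graph) := gen_eqMixin (gspace R G).
HB.instance Definition _ (R : realType) (G : graph) :=
  gen_choiceMixin (gspace R G).
HB.instance Definition _ (R : realType) (G : graph) :=
  isOpenTopological.Build (gspace R G)
    (@gspace_openT R G) (@gspace_openI R G) (@gspace_open_bigU R G).

Definition immersion (R : realType) (G : graph) (f : gspace R G -> gspace R G)
    : Prop :=
  continuous f /\
  forall x : gspace R G, exists2 U, nbhs x U & {in U &, injective f}.

(** * Loops, free homotopy, invariant loops *)

(* The circle is R/Z: loops are continuous 1-periodic maps on R. *)
Definition is_loop (R : realType) (X : topologicalType) (s : R -> X) : Prop :=
  continuous s /\ forall t, s (t + 1) = s t.

(* The homotopy parameter ranges over R instead of [0,1]; a homotopy over
   [0,1] extends to R by constants. *)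
Definition freely_homotopic (R : realType) (X : topologicalType)
    (s s' : R -> X) : Prop :=
  exists H : R * R -> X,
    [/\ continuous H,
        forall u t, H (u, t + 1) = H (u, t),
        forall t, H (0, t) = s t
      & forall t, H (1, t) = s' t].

Definition null_homotopic (R : realType) (X : topologicalType) (s : R -> X)
    : Prop :=
  exists x : X, freely_homotopic s (cst x).

Definition loop_power (R : realType) (X : topologicalType) (s : R -> X)
    (d : nat) : R -> X :=
  fun t => s (d%:R * t).

Definition invariant_loop (R : realType) (G : graph)
    (f : gspace R G -> gspace R G) (d : nat) (s : R -> gspace R G) : Prop :=
  [/\ (1 <= d)%N, is_loop s, ~ null_homotopic s
    & exists2 k : nat, (1 <= k)%N
      & freely_homotopic (iter k f \o s) (loop_power s d)].

(** * The graphs Gamma_i and their cores *)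

Definition Gamma (R : realType) (G : graph) (f : gspace R G -> gspace R G)
    (i : nat) : set (gspace R G * gspace R G) :=
  [set xy | iter i f xy.1 = iter i f xy.2].

(* Gamma_{i-1}, with the convention that Gamma_{-1} is empty. *)
Definition Gamma_pred (R : realType) (G : graph)
    (f : gspace R G -> gspace R G) (i : nat) : set (gspace R G * gspace R G) :=
  if i is j.+1 then Gamma f j else set0.

(* A is homeomorphic to a finite graph all of whose vertices have valency at
   least 2, that is, to a core graph without isolated points. *)
Definition is_core_subspace (R : realType) (X : topologicalType) (A : set X)
    : Prop :=
  exists H : graph,
    (forall v : 'I_(nvert H), (2 <= valency v)%N) /\
    exists (h : gspace R H -> X) (g : X -> gspace R H),
      [/\ continuous h, range h = A, {within A, continuous g} & cancel h g].

(* In a finite graph X, a subset homeomorphic to a graph all of whose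
   valencies are at least 2 contains every open edge it meets, hence is a
   subgraph; the union of all of them is the maximal core subgraph of X. *)
Definition max_core (R : realType) (X : topologicalType) (B : set X) : set X :=
  \bigcup_(A in [set A | A `<=` B /\ is_core_subspace R A]) A.

Definition hatGamma (R : realType) (G : graph) (f : gspace R G -> gspace R G)
    (i : nat) : set (gspace R G * gspace R G) :=
  max_core R (Gamma f i `\` Gamma_pred f i).

(** * Finite combinatorial descriptions of graph maps *)

(* (e, false) is e with its chosen orientation, (e, true) its reverse. *)
Definition dart (G : graph) : Type := ('I_(nedge G) * bool)%type.

Definition dart_pt (R : realType) (G : graph) (a : dart G) (t : R) :
    gspace R G :=
  edge_pt a.1 (if a.2 then 1 - t else t).

Record description (G : graph) := Description {
  vimage : 'I_(nvert G) -> 'I_(nvert G);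
  eimage : 'I_(nedge G) -> seq (dart G) }.

(* f maps every edge e onto the edge-path [eimage D e], up to an increasing
   reparametrization phi of [0,1] onto [0, number of edges of the path]. *)
Definition describes (R : realType) (G : graph) (D : description G)
    (f : gspace R G -> gspace R G) : Prop :=
  (forall v, f (Vertex R v) = Vertex R (vimage D v)) /\
  forall e, let p := eimage D e in
    exists phi : R -> R,
      [/\ {within `[0, 1], continuous phi},
          {in `[0, 1] &, {mono phi : s t / s < t}},
          phi 0 = 0, phi 1 = (size p)%:R
        & forall (j : nat) (t : R), (j < size p)%N -> t \in `[0, 1] ->
            j%:R <= phi t <= j.+1%:R ->
            f (edge_pt e t) = dart_pt (nth (e, false) p j) (phi t - j%:R)].

(* Goedel numbers, by means of the explicit bijection [CodeSeq.code] from
   [seq nat] to [nat]. *)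
Definition dart_code (G : graph) (a : dart G) : nat := ((a.1 : nat).*2 + a.2)%N.

Definition description_code (G : graph) (D : description G) : nat :=
  CodeSeq.code
    [:: nvert G;
        nedge G;
        CodeSeq.code [seq src e : nat | e <- enum 'I_(nedge G)];
        CodeSeq.code [seq tgt e : nat | e <- enum 'I_(nedge G)];
        CodeSeq.code [seq vimage D v : nat | v <- enum 'I_(nvert G)];
        CodeSeq.code [seq CodeSeq.code [seq dart_code a | a <- eimage D e]
                     | e <- enum 'I_(nedge G)]].

(** * Partial recursive functions *)

Inductive recfun : Type :=
| RZero
| RSucc
| RProj of nat
| RComp of recfun & seq recfun
| RPrec of recfun & recfun
| RMin of recfun.

(* [reval p xs y]: the algorithm p halts on the arguments xs and returns y. *)
Inductive reval : recfun -> seq nat -> nat -> Prop :=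
| reval_zero xs : reval RZero xs 0
| reval_succ x : reval RSucc [:: x] x.+1
| reval_proj i xs : (i < size xs)%N -> reval (RProj i) xs (nth 0%N xs i)
| reval_comp p qs xs ys z :
    revals qs xs ys -> reval p ys z -> reval (RComp p qs) xs z
| reval_prec0 p q xs y : reval p xs y -> reval (RPrec p q) (0%N :: xs) y
| reval_precS p q n xs y z :
    reval (RPrec p q) (n :: xs) y -> reval q [:: n, y & xs] z ->
    reval (RPrec p q) (n.+1 :: xs) z
| reval_min p xs n :
    reval p (n :: xs) 0 ->
    (forall m, (m < n)%N -> exists y, reval p (m :: xs) y.+1) ->
    reval (RMin p) xs n
with revals : seq recfun -> seq nat -> seq nat -> Prop :=
| revals_nil xs : revals [::] xs [::]
| revals_cons p ps xs y ys :
    reval p xs y -> revals ps xs ys -> revals (p :: ps) xs (y :: ys).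

(* Main.v *)
(* Up to reparametrization, a locally injective loop is a periodic reduced
   bi-infinite edge path, and two paths with the same image under a local
   injection coincide as soon as they meet.

   Let s be an invariant loop of degree d >= 2. Tightening s gives a periodic
   path a of minimal period n with f^k (a x) = a (phi x), where
   phi (x + n) = phi x + d n. The path psi = phi^-1 (phi + n) satisfies
   x < psi x < x + n, so that a and a \o psi have the same image under f^k but
   differ at every time. Precomposing both with phi^-N and applying a
   suitable iterate of f yields a locally injective loop in
   Gamma_N - Gamma_(N-1); it contains an embedded circle.

   Conversely, a core of Gamma_N - Gamma_(N-1) carries a pair of locally
   injective loops al, be such that f^N al = f^N be, whereas f^j al and f^j be
   differ at every time if j < N. If V is the number of vertices,
   f^(N - V^2) al and f^(N - V^2) be are never at vertices simultaneously: V^2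
   further steps would bring them together too early. Inside an edge a path
   cannot turn, so the word of f^N al is produced by a deterministic automaton
   whose number of states is bounded in terms of the combinatorics of f. Its
   period, and therefore the periods of the words of all f^j al and f^j be, are
   bounded. If N is large, the same two words occur at two levels i < j. Then
   f^(j - i) maps the word of f^i al to a power of itself; if the degree is 1,
   f^i al = f^i be, a contradiction. So the degree is at least 2.

   L(f) is the resulting lower bound for N, which is a primitive recursive
   function of the description of f. *)

From mathcomp Require Import all_boot all_order all_algebra.
From mathcomp Require Import all_classical all_reals all_analysis.
From mathcomp Require Import ring lra zify.
Require Import Defs.

Set Implicit Arguments.
Unset Strict Implicit.
Unset Printing Implicit Defensive.

Import Order.TTheory GRing.Theory Num.Theory.
Import numFieldNormedType.Exports.

(** * Topology of a finite graph *)

Section Darts.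
Variable G : graph.

(** The hypothesis on a loop is a free homotopy, whereas the argument compares locally injective
    paths pointwise. The bridge is that a free homotopy class contains only one tight loop up to
    rotation and reparametrization, so that a homotopy from [f^k(s)] to [s^d] becomes an equality of
    lines. This comes from lifting homotopies to the universal cover, which is never built as a
    space: its points are encoded by reduced words.

    Since [f] is only continuous, reparametrizations have to be carried along. What controls them is
    a rigidity: a homeomorphism of the line relating two edge lines with the same values is an
    integer translation ([line_eq_shift]). A translation by the period, pulled back through a
    reparametrization of degree 1, is still the translation by the period, which gives the final
    contradiction. In degree at least 2 it pulls back to less than a period, which is where [psi]
    comes from.

    No code is ever decoded: the bound is monotone in the numbers of vertices and edges and in the
    total length of the image paths, all at most the code of the description, so it is evaluated at
    the code itself. *)

Definition drev (a : dart G) : dart G := (a.1, ~~ a.2).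
Definition dsrc (a : dart G) : 'I_(nvert G) := if a.2 then tgt a.1 else src a.1.
Definition dtgt (a : dart G) : 'I_(nvert G) := if a.2 then src a.1 else tgt a.1.

Lemma drevK : involutive drev.
Proof. by case=> e b; rewrite /drev /= negbK. Qed.

Lemma drev_neq a : drev a != a.
Proof. by case: a => e b; rewrite /drev -pair_eqE /= /pair_eq /= negb_and; case: b; rewrite orbT. Qed.

Lemma dsrc_rev a : dsrc (drev a) = dtgt a.
Proof. by case: a => e []. Qed.

Lemma dtgt_rev a : dtgt (drev a) = dsrc a.
Proof. by case: a => e []. Qed.
End Darts.

Section GraphSpace.
Local Open Scope classical_set_scope.
Local Open Scope ring_scope.
Variables (R : realType) (G : graph).
Implicit Types (p q : gspace R G) (e : 'I_(nedge G)) (a b : dart G) (t u : R).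

Definition is_vert (p : gspace R G) : bool := if p is Vertex _ then true else false.

(** [edge_pt] matches on a [reflect] proof and uses its content. Stating the reduction for an
    arbitrary [r] lets [case] generalize the index; the hypothesis on [x] expresses proof
    irrelevance. *)
Lemma reflect_matchT (A : Type) (P : Prop) (b : bool) (r : reflect P b) (x : P -> A) y h :
  (forall h h', x h = x h') -> (if r is ReflectT h' then x h' else y) = x h.
Proof. by case: r. Qed.

Lemma reflect_matchF (A : Type) (P : Prop) (b : bool) (r : reflect P b) (x : P -> A) y :
  ~ P -> (if r is ReflectT h' then x h' else y) = y.
Proof. by case: r. Qed.

Lemma edge_ptE e t (t01 : 0 < t < 1) : edge_pt e t = Inner e t01.
Proof.
apply: (@reflect_matchT _ _ _ _ (fun h => Inner e h)) => h h'.
by congr Inner; exact: bool_irrelevance.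
Qed.

Lemma edge_pt_le0 e t : t <= 0 -> edge_pt e t = Vertex R (src e).
Proof.
move=> t0; rewrite /edge_pt.
rewrite (@reflect_matchF _ _ _ _ (fun h => Inner e h)) ?t0 //.
by move=> /andP[]; rewrite ltNge t0.
Qed.

Lemma edge_pt_ge1 e t : 1 <= t -> edge_pt e t = Vertex R (tgt e).
Proof.
move=> t1; rewrite /edge_pt.
rewrite (@reflect_matchF _ _ _ _ (fun h => Inner e h)).
  by rewrite leNgt (lt_le_trans ltr01 t1).
by move=> /andP[_]; rewrite ltNge t1.
Qed.

Variant gspace_spec : gspace R G -> bool -> Type :=
| GspaceVertex v : gspace_spec (Vertex R v) true
| GspaceInner e t of 0 < t < 1 : gspace_spec (edge_pt e t) false.

Lemma gspaceP p : gspace_spec p (is_vert p).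
Proof.
case: p => [v|e t t01]; first exact: GspaceVertex.
by have := GspaceInner e t01; rewrite (edge_ptE e t01).
Qed.

Lemma edge_pt_inj e e' t t' : 0 < t < 1 -> edge_pt e t = edge_pt e' t' ->
  e = e' /\ t = t'.
Proof.
move=> t01; rewrite (edge_ptE e t01).
case: (leP t' 0) => t'0; first by rewrite edge_pt_le0.
case: (leP 1 t') => t'1; first by rewrite edge_pt_ge1.
have t'01 : 0 < t' < 1 by rewrite t'0.
by rewrite (edge_ptE e' t'01) => -[].
Qed.

Lemma dart_pt_rev a t : dart_pt (drev a) t = dart_pt a (1 - t) :> gspace R G.
Proof. by case: a => e []; rewrite /dart_pt /= ?subKr. Qed.

Lemma dart_pt_le0 a t : t <= 0 -> dart_pt a t = Vertex R (dsrc a).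
Proof.
case: a => e [] t0; rewrite /dart_pt /dsrc /=; last exact: edge_pt_le0.
by apply: edge_pt_ge1; lra.
Qed.

Lemma dart_pt_ge1 a t : 1 <= t -> dart_pt a t = Vertex R (dtgt a).
Proof.
case: a => e [] t0; rewrite /dart_pt /dtgt /=; last exact: edge_pt_ge1.
by apply: edge_pt_le0; lra.
Qed.

Lemma is_vert_dart a t : is_vert (dart_pt a t : gspace R G) = ~~ (0 < t < 1).
Proof.
case: (leP t 0) => t0; first by rewrite dart_pt_le0.
case: (leP 1 t) => t1; first by rewrite dart_pt_ge1.
case: a => e [].
  have t01 : 0 < 1 - t < 1 by lra.
  by rewrite /dart_pt /= (edge_ptE e t01).
have t01 : 0 < t < 1 by lra.
by rewrite /dart_pt /= (edge_ptE e t01).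
Qed.

Lemma dart_pt_inj a b t u : 0 < t < 1 -> dart_pt a t = dart_pt b u :> gspace R G ->
  (a = b /\ t = u) \/ (b = drev a /\ u = 1 - t).
Proof.
case: a b => e x [e' x'] t01 /edge_pt_inj[|/= <-]; first by case: x => /=; lra.
by case: x; case: x' => h; [left|right|right|left]; split => //; move: h => /=; lra.
Qed.

(** The reversed dart would put the point beyond 1/2. So a point near a vertex knows the dart along
    which it leaves; this is how directions at a vertex are told apart. *)
Lemma dart_pt_inj_half a b t u : 0 < t < 1/2 -> u < 1/2 ->
  dart_pt a t = dart_pt b u :> gspace R G -> a = b /\ t = u.
Proof. by move=> t1 u1 /dart_pt_inj[|//|[_ ?]]; lra. Qed.

Lemma dart_pt_vertex a t v : dart_pt a t = Vertex R v ->
  (t <= 0 /\ v = dsrc a) \/ (1 <= t /\ v = dtgt a).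
Proof.
case: (leP t 0) => t0; first by rewrite dart_pt_le0 // => -[->]; left.
case: (leP 1 t) => t1; first by rewrite dart_pt_ge1 // => -[->]; right.
by move=> h; have := is_vert_dart a t; rewrite h /= t0 t1.
Qed.

Lemma gspace_openP (U : set (gspace R G)) :
  open U <-> forall e, open (edge_pt e @^-1` U : set R).
Proof. by split. Qed.

Lemma dart_pt_inner a t v : 0 < t < 1 -> dart_pt a t <> Vertex R v.
Proof. by move=> t01 h; have := is_vert_dart a t; rewrite t01 h. Qed.

Lemma edge_pt_cont e : continuous (edge_pt e : R -> gspace R G).
Proof. by apply/continuousP => A oA; exact: oA. Qed.

Lemma dart_pt_cont a : continuous (dart_pt a : R -> gspace R G).
Proof.
case: a => e [] x; rewrite /dart_pt /=; last exact: edge_pt_cont.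
apply: (@continuous_comp _ _ _ (fun t => 1 - t) (edge_pt e)); last exact: edge_pt_cont.
by apply: continuousB; [exact: cst_continuous|].
Qed.

Lemma gspace_cont (Y : topologicalType) (f : gspace R G -> Y) :
  (forall e, continuous (f \o edge_pt e)) -> continuous f.
Proof.
move=> fc; apply/continuousP => A oA; apply/gspace_openP => e.
by have /continuousP := fc e; exact.
Qed.

Lemma edge_ptP p : ~~ is_vert p -> exists e t, 0 < t < 1 /\ p = edge_pt e t.
Proof. by case: gspaceP => // e t t01 _; exists e, t. Qed.

(** The arms are indexed by darts, so that a loop at [v] contributes two of them. *)
Definition star (v : 'I_(nvert G)) (eps : R) : set (gspace R G) :=
  [set p | p = Vertex R v \/
     exists a t, [/\ dsrc a = v, 0 < t < eps & p = dart_pt a t]].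

Lemma star_dart a t eps : 0 < eps -> t < eps -> star (dsrc a) eps (dart_pt a t).
Proof.
move=> e0 te; case: (leP t 0) => t0; first by rewrite dart_pt_le0 //; left.
by right; exists a, t; rewrite t0.
Qed.

Lemma star_open v eps : 0 < eps <= 1 -> open (star v eps).
Proof.
move=> /andP[e0 e1]; apply/gspace_openP => e.
have -> : edge_pt e @^-1` star v eps =
    [set t | src e = v /\ t < eps] `|` [set t | tgt e = v /\ 1 - eps < t].
  apply/seteqP; split=> t /=.
    case=> [|[a [u [av ue]]]].
      move=> /(@dart_pt_vertex (e, false))[[t0 ->]|[t1 ->]]; [left|right]; split => //; lra.
    move=> h; have [| |[aE ut]|[eE tE]] := @dart_pt_inj a (e, false) u t; first by lra.
    - by rewrite -h.
    - by left; split; [rewrite -av aE|lra].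
    - by right; split; [rewrite -av -dtgt_rev -eE|lra].
  case=> -[ve te].
    by have := @star_dart (e, false) t eps e0 te; rewrite /dsrc /= ve.
  have := @star_dart (e, true) (1 - t) eps e0; rewrite /dsrc /= ve /dart_pt /= subKr.
  by apply; lra.
apply: openU.
  have [<-|ve] := eqVneq (src e) v.
    by rewrite (_ : [set _ | _] = [set t | t < eps]) ?open_lt//; apply/seteqP; split=> t //= -[].
  by rewrite (_ : [set _ | _] = set0); [exact: open0|]; apply/seteqP; split=> t //= -[] /eqP; rewrite (negbTE ve).
have [<-|ve] := eqVneq (tgt e) v.
  rewrite (_ : [set _ | _] = [set t | 1 - eps < t]) ?open_gt//.
  by apply/seteqP; split=> t //= -[].
by rewrite (_ : [set _ | _] = set0); [exact: open0|]; apply/seteqP; split=> t //= -[] /eqP; rewrite (negbTE ve).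
Qed.

Lemma nbhs_star v eps : 0 < eps -> nbhs (Vertex R v) (star v eps).
Proof.
move=> e0; have s1 : star v (Num.min eps 1) `<=` star v eps.
  move=> p [->|[a [t [av te ->]]]]; first by left.
  by right; exists a, t; split=> //; move: te; rewrite lt_min; lra.
apply: (filterS s1); apply: open_nbhs_nbhs; split; last by left.
by apply: star_open; rewrite lt_min e0 ltr01 ge_min lexx orbT.
Qed.

(** One radius serves all arms because only finitely many darts leave [v]; hence the stars form a
    neighborhood basis. *)
Lemma nbhs_vertexP v (O : set (gspace R G)) : nbhs (Vertex R v) O ->
  exists2 eps, 0 < eps <= 1/2 & star v eps `<=` O.
Proof.
move=> nO.
have : \forall t \near 0^'+, forall a, dsrc a = v -> forall u, 0 < u < t -> O (dart_pt a u).
  apply: filter_forall => a.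
  have [av|av] := eqVneq (dsrc a) v; last by near=> t => av'; move/eqP: av.
  have : \forall u \near (0 : R), O (dart_pt a u).
    by apply: dart_pt_cont; rewrite dart_pt_le0 ?av.
  move=> /nbhs_ballP[r /= r0 br]; near=> t => _ u ut; apply: br.
  rewrite /ball /= sub0r normrN ger0_norm; last by lra.
  have : t < r by near: t; exact: nbhs_right_lt.
  by lra.
move=> [r /= r0 hr].
exists (Num.min (r / 2) (1/2)).
  by rewrite lt_min ge_min lexx orbT andbT; apply/andP; split; lra.
move=> p [->|[a [t [av te ->]]]]; first exact: nbhs_singleton nO.
apply: (hr (r / 2) _ _ _ av).
- by rewrite /ball /= sub0r normrN ger0_norm; lra.
- by lra.
- by move: te; rewrite lt_min; lra.
Unshelve. all: by end_near.
Qed.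

(** An interval of one open edge is open in the CW topology, since its preimage under every other
    characteristic map is empty. *)
Lemma nbhs_edge e t (O : set (gspace R G)) : 0 < t < 1 ->
  (\forall u \near t, O (edge_pt e u)) -> nbhs (edge_pt e t) O.
Proof.
move=> t01 nO.
pose U : set R := [set u | O (edge_pt e u)]° `&` [set u | 0 < u] `&` [set u | u < 1].
have oU : open U.
  by apply: openI; [apply: openI; [exact: open_interior|exact: open_gt]|exact: open_lt].
apply: (@filterS _ _ _ (edge_pt e @` U)).
  by move=> _ [u [[/interior_subset uO _] _] <-].
apply: open_nbhs_nbhs; split; last first.
  by exists t => //; split; [split|]; [exact: nO| |]; rewrite /=; lra.
apply/gspace_openP => e'; have [<-|ee] := eqVneq e e'.
  rewrite (_ : _ @^-1` _ = U) //; apply/seteqP; split=> u /=; last by exists u.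
  by case=> w [[w1 w2] w3] /edge_pt_inj[|_ <-]//=; move: w2 w3 => /=; lra.
rewrite (_ : _ @^-1` _ = set0); first exact: open0.
apply/seteqP; split=> u //= [w [[w1 w2] w3]].
case/edge_pt_inj; first by move: w2 w3 => /=; lra.
by move/eqP; rewrite (negbTE ee).
Qed.

Lemma gspace_hausdorff : hausdorff_space (gspace R G).
Proof.
have VV v w : cluster (nbhs (Vertex R v)) (Vertex R w : gspace R G) -> v = w.
  move=> /(_ _ _ (@nbhs_star v (1/2) ltac:(lra)) (@nbhs_star w (1/2) ltac:(lra))).
  move=> [p [[->|[a [t [av te ->]]]] [pE|[b [u [bw ue pE]]]]]].
  - by case: pE.
  - by case: (@dart_pt_inner b u v); [lra|].
  - by case: (@dart_pt_inner a t w); [lra|].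
  - by move: pE => /dart_pt_inj_half[| |ab _]; [lra|lra|rewrite -av -bw ab].
have VI v e t : 0 < t < 1 -> ~ cluster (nbhs (Vertex R v)) (edge_pt e t : gspace R G).
  move=> t01; pose s := Num.min t (1 - t) / 2.
  have [s1 s2] : s < t /\ t < 1 - s.
    by move/andP: t01 => [? ?]; rewrite /s; case: (leP t (1 - t)) => h; split; lra.
  have s0 : 0 < s by move/andP: t01 => [? ?]; rewrite /s; case: (leP t (1 - t)) => h; lra.
  have nI : nbhs (edge_pt e t : gspace R G) [set q | exists2 u, s < u < 1 - s & q = edge_pt e u].
    apply: nbhs_edge => //; near=> u; exists u => //; apply/andP; split.
      by near: u; exact: lt_nbhsr.
    by near: u; exact: lt_nbhsl.
  move=> /(_ _ _ (@nbhs_star v s s0) nI)[p [[->|[a [u [av ue ->]]]] [w w01]]].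
    by move=> h; case: (@dart_pt_inner (e, false) w v); [lra|rewrite h].
  by move=> /(@dart_pt_inj a (e, false))[|[_ ?]|[_ ?]]; lra.
move=> p q; case: (gspaceP p) => [v|e t t01]; case: (gspaceP q) => [w|e' t' t'01].
- by move=> /VV ->.
- by move=> /VI; case.
- move=> c; exfalso; apply: (@VI w e t) => // A B nA nB.
  by rewrite setIC; apply: c.
- move=> c; have [|ne] := pselect ((e = e') /\ t = t'); first by case=> -> ->.
  pose r := if e == e' then `|t - t'| / 2 else 1.
  have r0 : 0 < r.
    rewrite /r; case: eqP => // ee; rewrite divr_gt0 // normr_gt0 subr_eq0.
    by apply/eqP => tt; exact: ne.
  pose B x (yy : R) := [set q | exists2 u, `|yy - u| < r & (0 < u < 1) /\ q = edge_pt x u] : set (gspace R G).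
  have nB x y : 0 < y < 1 -> nbhs (edge_pt x y : gspace R G) (B x y).
    move=> y01; apply: nbhs_edge => //; near=> u; exists u; last first.
      split=> //; apply/andP; split; first by near: u; apply: lt_nbhsr; lra.
      by near: u; apply: lt_nbhsl; lra.
    by near: u; apply/nbhs_ballP; exists r.
  have [x [[u h1 [u01 ->]] [u' h2 [u'01 /edge_pt_inj[//|ee uu]]]]] := c _ _ (nB e t t01) (nB e' t' t'01).
  move: h1 h2; rewrite -uu /r ee eqxx => h1 h2.
  by exfalso; have := ler_distD u t t'; rewrite (distrC u t'); lra.
Unshelve. all: by end_near.
Qed.

End GraphSpace.

(** * Locally injective maps and homeomorphisms of the line *)

Section LocalToGlobal.
Local Open Scope classical_set_scope.

(** [P] is locally constant along [C], hence relatively open and closed there. The continuation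
    arguments below, among them the uniqueness of lifts, are instances. *)
Lemma connected_ind (T : topologicalType) (C : set T) (P : T -> Prop) t0 :
  connected C -> C t0 -> P t0 ->
  (forall t, C t -> \forall s \near t, C s -> (P s <-> P t)) ->
  forall t, C t -> P t.
Proof.
move=> cC C0 P0 loc.
have CE : C `&` P = C.
  apply: cC; first by exists t0.
  - exists ([set s | C s -> P s]°); first exact: open_interior.
    apply/seteqP; split=> t [Ct Pt]; split=> //.
      by have := loc t Ct; apply: filterS => s h /h[_]; apply.
    by have /= := interior_subset Pt; apply.
  - exists (~` ([set s | C s -> ~ P s]°)); first exact/open_closedC/open_interior.
    apply/seteqP; split=> t [Ct Pt]; split=> //.
      by move=> /interior_subset /= /(_ Ct).
    apply: contrapT => nPt; apply: Pt.
    by have := loc t Ct; apply: filterS => s h /h[h' _] /h'.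
by move=> t; rewrite -{1}CE => -[].
Qed.

Lemma connectedT_ind (T : topologicalType) (P : T -> Prop) t0 :
  connected [set: T] -> P t0 ->
  (forall t, \forall s \near t, P s <-> P t) -> forall t, P t.
Proof.
move=> cT P0 loc t; apply: (connected_ind cT _ P0) => //.
by move=> s _; have := loc s; apply: filterS.
Qed.

Lemma connectedR (R : realType) : connected [set: R].
Proof. by apply/connected_intervalP. Qed.

Definition locinj (T U : topologicalType) (f : T -> U) :=
  forall x : T, exists2 A, nbhs x A & {in A &, injective f}.

Lemma near_neq (T U : topologicalType) (f g : T -> U) t : hausdorff_space U ->
  {for t, continuous f} -> {for t, continuous g} -> f t <> g t ->
  \forall s \near t, f s <> g s.
Proof.
rewrite open_hausdorff => hU cf cg /eqP /hU[[A B] [/= /set_mem At /set_mem Bt]].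
move=> [oA oB /eqP AB].
have nA : \forall s \near t, A (f s) by apply: cf; apply: open_nbhs_nbhs.
have nB : \forall s \near t, B (g s) by apply: cg; apply: open_nbhs_nbhs.
near=> s => fg.
have : (A `&` B) (f s) by split; [near: s|rewrite fg; near: s].
by rewrite AB.
Unshelve. all: by end_near. Qed.

Lemma locinj_near (T U V : topologicalType) (phi : U -> V) (f g : T -> U) t :
  locinj phi -> {for t, continuous f} -> {for t, continuous g} -> f t = g t ->
  \forall s \near t, phi (f s) = phi (g s) -> f s = g s.
Proof.
move=> lphi cf cg fg; have [A nA iA] := lphi (f t).
have nAf : \forall s \near t, A (f s) by apply: cf.
have nAg : \forall s \near t, A (g s) by apply: cg; rewrite -fg.
near=> s => h; apply: iA => //; apply/mem_set; first by near: s.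
by near: s.
Unshelve. all: by end_near. Qed.

(** The set where [f] and [g] agree is open by local injectivity of [phi] and closed because [U] is
    Hausdorff. *)
Lemma lift_unique (T U V : topologicalType) (phi : U -> V) (f g : T -> U)
    (C : set T) t0 : hausdorff_space U -> locinj phi -> connected C ->
  (forall t, C t -> {for t, continuous f}) ->
  (forall t, C t -> {for t, continuous g}) ->
  (forall t, C t -> phi (f t) = phi (g t)) ->
  C t0 -> f t0 = g t0 -> forall t, C t -> f t = g t.
Proof.
move=> hU lphi cC cf cg pfg C0 fg0; apply: (connected_ind cC C0 fg0) => t Ct.
have [fgt|nfgt] := pselect (f t = g t).
  have := locinj_near lphi (cf t Ct) (cg t Ct) fgt.
  by apply: filterS => s h Cs; split=> // _; apply/h/pfg.
have := near_neq hU (cf t Ct) (cg t Ct) nfgt.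
by apply: filterS => s h _; split.
Qed.

Lemma locinj_comp (T U V : topologicalType) (f : T -> U) (g : U -> V) :
  continuous f -> locinj f -> locinj g -> locinj (g \o f).
Proof.
move=> cf lf lg x; have [A nA iA] := lf x; have [B nB iB] := lg (f x).
exists (A `&` f @^-1` B); first by apply: filterI => //; exact: cf.
move=> y z /set_mem[Ay By] /set_mem[Az Bz] /= h.
by apply: iA; [exact: mem_set|exact: mem_set|apply: iB; [exact: mem_set|exact: mem_set|]].
Qed.

Lemma locinj_iter (T : topologicalType) (f : T -> T) n :
  continuous f -> locinj f -> continuous (iter n f) /\ locinj (iter n f).
Proof.
move=> cf lf; elim: n => [|n [cn ln]] /=.
  split; first by move=> x; exact: cvg_id.
  by move=> x; exists setT; [exact: filterT|].
split; last exact: locinj_comp.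
by move=> x; apply: continuous_comp; [exact: cn|exact: cf].
Qed.

End LocalToGlobal.

Section HomeoR.
Local Open Scope classical_set_scope.
Local Open Scope ring_scope.
Variable R : realType.
Implicit Types (th : R -> R) (x y : R).

(** An increasing surjection of the line is a homeomorphism; its continuity is derived in
    [homeoR_cont]. *)
Definition homeoR th := {mono th : x y / x < y} /\ (forall y, exists x, th x = y).

Lemma homeoR_le th : homeoR th -> {mono th : x y / x <= y}.
Proof. by move=> [m _] x y; rewrite !leNgt m. Qed.

Lemma homeoR_inj th : homeoR th -> injective th.
Proof.
move=> h x y e; apply/eqP; rewrite eq_le.
by rewrite -(homeoR_le h x) -(homeoR_le h y) e lexx.
Qed.

Lemma homeoR_cont th : homeoR th -> continuous th.
Proof.
move=> [m s] x; apply/cvgrPdist_lt => e e0.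
have [y1 h1] := s (th x - e); have [y2 h2] := s (th x + e).
have l1 : y1 < x by rewrite -m; lra.
have l2 : x < y2 by rewrite -m; lra.
near=> z.
have z1 : y1 < z by near: z; exact: lt_nbhsr.
have z2 : z < y2 by near: z; exact: lt_nbhsl.
by move: z1 z2; rewrite -m -(m z) ltr_norml => *; lra.
Unshelve. all: by end_near. Qed.

Lemma homeoR_inv th : homeoR th ->
  exists th', [/\ homeoR th', cancel th th' & cancel th' th].
Proof.
move=> h; have [m s] := h; pose th' y := projT1 (cid (s y)).
have K' : cancel th' th by move=> y; rewrite /th'; case: cid.
have K : cancel th th' by move=> x; apply: (homeoR_inj h); rewrite K'.
exists th'; split=> //; split; last by move=> y; exists (th y).
by move=> x y; rewrite -m !K'.
Qed.

Lemma homeoR_comp th th' : homeoR th -> homeoR th' -> homeoR (th \o th').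
Proof.
move=> [m s] [m' s']; split; first by move=> x y /=; rewrite m m'.
by move=> y; have [z <-] := s y; have [w <-] := s' z; exists w.
Qed.

Lemma homeoR_shift c : homeoR (fun x => x + c).
Proof.
split; first by move=> x y; rewrite ltrD2r.
by move=> y; exists (y - c); rewrite subrK.
Qed.

Lemma homeoR_scale c : 0 < c -> homeoR (fun x => c * x).
Proof.
move=> c0; split; first by move=> x y; rewrite ltr_pM2l.
by move=> y; exists (c^-1 * y); rewrite mulVKf // gt_eqF.
Qed.

Lemma homeoR_id : homeoR id.
Proof. by split=> // y; exists y. Qed.

Lemma homeoR_iter n th : homeoR th -> homeoR (iter n th).
Proof.
move=> h; elim: n => [|n IH]; first exact: homeoR_id.
exact: (@homeoR_comp th (iter n th)).
Qed.

Definition isZ x := exists i : int, x = i%:~R.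

(** Such a map cannot skip an integer: the integer following [th i] has an integer preimage, which
    comes after [i]. *)
Lemma homeoR_int th : homeoR th -> (forall x, isZ (th x) <-> isZ x) ->
  exists p : int, forall i : int, th i%:~R = (i + p)%:~R.
Proof.
move=> h hZ; have [p hp] : isZ (th 0) by apply/hZ; exists 0.
have up (i : int) : th i%:~R = (i + p)%:~R -> th (i + 1)%:~R = (i + 1 + p)%:~R.
  move=> hi; have [j hj] : isZ (th (i + 1)%:~R) by apply/hZ; exists (i + 1).
  have ij : i + p < j by rewrite -(ltr_int R) -hj -hi h.1 ltr_int ltrDl.
  have [y hy] := h.2 (i + p + 1)%:~R.
  have [k hk] : isZ y by apply/hZ; rewrite hy; exists (i + p + 1).
  have ik : i < k by rewrite -(ltr_int R) -hk -h.1 hi hy ltr_int ltrDl.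
  have kj : i + 1 <= k by rewrite lezD1.
  have e1 : j <= i + p + 1.
    by rewrite -(ler_int R) -hj -hy (homeoR_le h) hk ler_int.
  have e2 : i + p + 1 <= j by rewrite lezD1.
  have -> : i + 1 + p = i + p + 1 by rewrite addrAC.
  by rewrite hj; congr _%:~R; apply/eqP; rewrite eq_le e1 e2.
have down (i : int) : th (i + 1)%:~R = (i + 1 + p)%:~R -> th i%:~R = (i + p)%:~R.
  move=> hi; have [y hy] := h.2 (i + p)%:~R.
  have [k hk] : isZ y by apply/hZ; rewrite hy; exists (i + p).
  have ki : k < i + 1 by rewrite -(ltr_int R) -hk -h.1 hi hy ltr_int addrAC ltrDl.
  have [j hj] : isZ (th i%:~R) by apply/hZ; exists i.
  have ji : j < i + 1 + p by rewrite -(ltr_int R) -hj -hi h.1 ltr_int ltrDl.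
  have e1 : j <= i + p by rewrite -ltzD1 addrAC.
  have e2 : i + p <= j.
    by rewrite -(ler_int R) -hj -hy (homeoR_le h) hk ler_int -ltzD1.
  by rewrite hj; congr _%:~R; apply/eqP; rewrite eq_le e1 e2.
exists p; elim/int_rec => [|n|n]; first by rewrite hp add0r.
  by move/up; rewrite (_ : n.+1%:Z = n%:Z + 1) // -addn1 PoszD.
by move=> hn; apply: down; rewrite (_ : - n.+1%:Z + 1 = - n%:Z) // -addn1 PoszD opprD addrNK.
Qed.

End HomeoR.

(** * Bi-infinite edge paths *)

Section Lines.
Local Open Scope classical_set_scope.
Local Open Scope ring_scope.

Lemma cont_paste (T U : topologicalType) (f g h : T -> U) t :
  {for t, continuous g} -> {for t, continuous h} -> g t = f t -> h t = f t ->
  (\forall s \near t, f s = g s \/ f s = h s) -> {for t, continuous f}.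
Proof.
move=> cg ch gt ht fs A nA.
have h1 : \forall s \near t, A (g s) by apply: cg; rewrite gt.
have h2 : \forall s \near t, A (h s) by apply: ch; rewrite ht.
by have : \forall s \near t, A (f s); first by near=> s; have [->|->] : f s = g s \/ f s = h s; near: s.
Unshelve. all: by end_near. Qed.

Lemma cont_near (T U : topologicalType) (f g : T -> U) t :
  {for t, continuous g} -> (\forall s \near t, f s = g s) -> {for t, continuous f}.
Proof.
move=> cg fg; apply: (cont_paste cg cg); rewrite ?(nbhs_singleton fg) //.
by apply: filterS fg => s ->; left.
Qed.

Variables (R : realType) (G : graph).
Implicit Types (a b : int -> dart G) (x y : R) (i p : int).

Definition line a x : gspace R G :=
  dart_pt (a (Num.floor x)) (x - (Num.floor x)%:~R).

Definition walk a := forall i, dtgt (a i) = dsrc (a (i + 1)).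
Definition reducedw a := forall i, a (i + 1) <> drev (a i).
Definition per a p := forall i, a (i + p) = a i.

Lemma line_itv a i x : i%:~R <= x < i%:~R + 1 -> line a x = dart_pt (a i) (x - i%:~R).
Proof.
by move=> h; rewrite /line (@floor_def _ x i) // intrD.
Qed.

Lemma line_int a i : line a i%:~R = Vertex R (dsrc (a i)).
Proof. by rewrite (@line_itv a i) ?subrr ?dart_pt_le0 //; apply/andP; split; lra. Qed.

Lemma floorP x : exists i, i%:~R <= x < i%:~R + 1.
Proof. by exists (Num.floor x); have := floor_itv x; rewrite intrD. Qed.

Lemma isZ_floor i x : i%:~R <= x < i%:~R + 1 -> isZ x -> x = i%:~R.
Proof.
move=> /andP[h1 h2] [j hj]; rewrite hj; congr _%:~R; apply/eqP.
move: h1 h2; rewrite hj -(intrD _ i 1) ler_int ltr_int ltzD1 => h1 h2.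
by rewrite eq_le h1 h2.
Qed.

Lemma is_vert_line a x : is_vert (line a x) <-> isZ x.
Proof.
split; last by move=> [i ->]; rewrite line_int.
have [i hi] := floorP x; rewrite (line_itv _ hi) is_vert_dart => h.
by exists i; apply/eqP; apply: contraR h => /eqP ?; lra.
Qed.

Lemma line_itvc a i x : walk a -> i%:~R <= x <= i%:~R + 1 ->
  line a x = dart_pt (a i) (x - i%:~R).
Proof.
move=> wa /andP[h1 h2]; have [xi|xi] := ltP x (i%:~R + 1).
  by rewrite (@line_itv _ i) // h1.
have -> : x = (i + 1)%:~R by rewrite intrD; lra.
by rewrite line_int dart_pt_ge1 ?wa // intrD; lra.
Qed.

Lemma line_cont a : walk a -> continuous (line a).
Proof.
move=> wa x; have [i /andP[h1 h2]] := floorP x.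
have cd c (j : int) : continuous (fun x : R => dart_pt c (x - j%:~R) : gspace R G).
  move=> z; apply: (@continuous_comp _ _ _ (fun u : R => u - j%:~R) (dart_pt c)).
    by apply: continuousB; [|exact: cst_continuous].
  exact: dart_pt_cont.
have [xi|xi] := eqVneq x i%:~R.
  apply: (@cont_paste _ _ _ (fun x => dart_pt (a (i - 1)) (x - (i - 1)%:~R))
            (fun x => dart_pt (a i) (x - i%:~R))).
  - exact: cd.
  - exact: cd.
  - by rewrite xi line_int dart_pt_ge1 ?wa ?subrK // intrB; lra.
  - by rewrite xi line_int dart_pt_le0 // subrr.
  - near=> s.
    have s1 : i%:~R - 1 < s by near: s; apply: lt_nbhsr; lra.
    have s2 : s < i%:~R + 1 by near: s; apply: lt_nbhsl; lra.
    have [si|si] := ltP s i%:~R; last by right; apply: line_itv; rewrite si.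
    by left; apply: line_itv; rewrite intrB; lra.
apply: (cont_near (cd (a i) i x)); near=> s.
apply: line_itv; apply/andP; split; last by near: s; apply: lt_nbhsl; lra.
by apply: ltW; near: s; apply: lt_nbhsr; rewrite lt_neqAle eq_sym xi.
Unshelve. all: by end_near. Qed.

(** At an integer [i] the two sides of the line leave the vertex along [drev (a (i - 1))] and [a i].
    Reducedness makes these darts distinct, and [dart_pt_inj_half] separates them. *)
Lemma line_locinj a : walk a -> reducedw a -> locinj (line a).
Proof.
move=> wa ra x; have [i /andP[h1 h2]] := floorP x.
have [xi|xi] := eqVneq x i%:~R; last first.
  exists [set s | i%:~R < s < i%:~R + 1].
    near=> s; apply/andP; split; last by near: s; apply: lt_nbhsl; lra.
    by near: s; apply: lt_nbhsr; rewrite lt_neqAle eq_sym xi.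
  move=> y z /set_mem /= yi /set_mem /= zi.
  rewrite !(@line_itv a i); [|lra|lra].
  case/dart_pt_inj => [||[/esym/eqP]]; first by lra.
    by move=> [_ /addIr].
  by rewrite (negbTE (drev_neq _)).
exists [set s | i%:~R - 1/2 < s < i%:~R + 1/2].
  near=> s; apply/andP; split; first by near: s; apply: lt_nbhsr; lra.
  by near: s; apply: lt_nbhsl; lra.
have lneg (s : R) : i%:~R - 1/2 < s < i%:~R -> line a s = dart_pt (drev (a (i - 1))) (i%:~R - s).
  move=> si; rewrite (@line_itv a (i - 1)) ?dart_pt_rev intrB; last by lra.
  by congr dart_pt; lra.
have ne : drev (a (i - 1)) <> a i by move=> h; apply: (ra (i - 1)); rewrite subrK.
move=> y z /set_mem /= yi /set_mem /= zi yz.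
have vv : isZ y <-> isZ z by rewrite -!(is_vert_line a) yz.
have iZ (s : R) : i%:~R - 1/2 < s < i%:~R + 1/2 -> isZ s -> s = i%:~R.
  move=> si sZ; have [si'|si'] := ltP s i%:~R; last by apply: isZ_floor => //; lra.
  have := @isZ_floor (i - 1) s; rewrite intrB => /(_ _ sZ) h.
  by exfalso; have := h ltac:(lra); lra.
have [ye|yne] := eqVneq y i%:~R.
  by rewrite ye; symmetry; apply: iZ => //; apply/vv; exists i.
have [ze|zne] := eqVneq z i%:~R.
  by rewrite ze; apply: iZ => //; apply/vv; exists i.
move: yz; case: (ltgtP y i%:~R) yne => // y1 _; case: (ltgtP z i%:~R) zne => // z1 _.
- rewrite !lneg; [|lra|lra].
  by move=> /dart_pt_inj_half[||_ ?]; lra.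
- rewrite lneg; last by lra. 
  rewrite (@line_itv a i z); last by lra.
  by move=> /dart_pt_inj_half[||/ne]; lra.
- rewrite (lneg z); last by lra. 
  rewrite (@line_itv a i y); last by lra.
  by move=> /dart_pt_inj_half[||/esym/ne]; lra.
- rewrite !(@line_itv a i); [|lra|lra].
  by move=> /dart_pt_inj_half[||_ ?]; lra.
Unshelve. all: by end_near. Qed.

Lemma line_walk a : continuous (line a) -> walk a.
Proof.
move=> ca i; have [//|ne] := pselect (dtgt (a i) = dsrc (a (i + 1))).
have cd : {for (i + 1)%:~R, continuous (fun x : R => dart_pt (a i) (x - i%:~R) : gspace R G)}.
  apply: (@continuous_comp _ _ _ (fun u : R => u - i%:~R) (dart_pt (a i))).
    by apply: continuousB; [|exact: cst_continuous].
  exact: dart_pt_cont.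
have := near_neq (@gspace_hausdorff R G) cd (ca _).
rewrite line_int dart_pt_ge1 ?intrD; last by lra.
have neq : Vertex R (dtgt (a i)) <> Vertex R (dsrc (a (i + 1))) by case.
move=> /(_ neq) /nbhs_ballP[e /= e0]; pose s : R := i%:~R + 1 - Num.min (e / 2) (1/2).
have [m1 m2] : 0 < Num.min (e / 2) (1/2) <= 1/2 /\ Num.min (e / 2) (1/2) < e.
  by case: (leP (e / 2) (1/2)) => h; split; lra.
move=> /(_ s); rewrite /ball /= /s => /(_ _) []; first by rewrite opprB addrC addrNK ger0_norm; lra.
by rewrite (@line_itv a i) //; lra.
Qed.

(** A backtrack folds the line about the integer [i + 1]: the points at distance [m] on either side
    have the same image. *)
Lemma line_reduced a : walk a -> locinj (line a) -> reducedw a.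
Proof.
move=> wa la i ai; have [A /nbhs_ballP[e /= e0 bA] iA] := la (i + 1)%:~R.
have [m1 m2] : 0 < Num.min (e / 2) (1/2) <= 1/2 /\ Num.min (e / 2) (1/2) < e.
  by case: (leP (e / 2) (1/2)) => h; split; lra.
move: (Num.min _ _) m1 m2 => m m1 m2.
suff : (i + 1)%:~R - m = (i + 1)%:~R + m by lra.
apply: iA.
- by apply/mem_set/bA; rewrite /ball /= opprB addrC addrNK ger0_norm; lra.
- by apply/mem_set/bA; rewrite /ball /= opprD addNKr normrN ger0_norm; lra.
rewrite (@line_itv a i) ?intrD; last by lra.
rewrite (@line_itv a (i + 1)) ?intrD; last by lra.
by rewrite ai dart_pt_rev; congr dart_pt; lra.
Qed.

Lemma line_shift a p x : line a (x + p%:~R) = line (fun i => a (i + p)) x.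
Proof.
have [i hi] := floorP x; rewrite (line_itv _ hi) (@line_itv a (i + p)) intrD; last by lra.
by congr dart_pt; lra.
Qed.

Lemma line_per a p x : per a p -> line a (x + p%:~R) = line a x.
Proof. by move=> ap; rewrite line_shift; congr line; apply/funext => i; exact: ap. Qed.

(** [psi] matches vertices with vertices, so it is a translation on the integers. Inside an edge it
    is then either that translation or a flip of the edge, and a flip is decreasing. *)
Lemma line_eq_shift a b psi : homeoR psi -> (forall x, line a (psi x) = line b x) ->
  exists p, (forall x, psi x = x + p%:~R) /\ (forall i, b i = a (i + p)).
Proof.
move=> hpsi ab.
have [p hp] : exists p, forall i, psi i%:~R = (i + p)%:~R.
  by apply: homeoR_int => // x; rewrite -(is_vert_line a) ab is_vert_line.
have mid i x : i%:~R < x < i%:~R + 1 ->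
    (b i = a (i + p) /\ psi x = x + p%:~R) \/
    (b i = drev (a (i + p)) /\ psi x = 1 + 2 * i%:~R + p%:~R - x).
  move=> xi; have := ab x; rewrite (@line_itv b i); last by lra.
  have : (i + p)%:~R < psi x < (i + p)%:~R + 1.
    rewrite -(intrD _ _ 1) addrAC -!hp !hpsi.1 intrD; lra.
  move=> pxi; rewrite (@line_itv a (i + p)); last by lra.
  rewrite !intrD in pxi *.
  by case/dart_pt_inj => [|[-> h]|[-> h]]; [lra|left|right]; split=> //; lra.
(* If both sample points were flipped, [psi] would reverse their order. *)
have bE i : b i = a (i + p).
  have [|[//]|[b1 p1]] := mid i (i%:~R + 1/3); first by lra.
  have [|[//]|[b2 p2]] := mid i (i%:~R + 2/3); first by lra.
  have : psi (i%:~R + 1/3) < psi (i%:~R + 2/3) by rewrite hpsi.1; lra.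
  by clear b1 b2; move=> ?; exfalso; lra.
exists p; split=> // x; have [i hi] := floorP x.
have [->|xi] := eqVneq x i%:~R; first by rewrite hp intrD.
have [|[_ //]|[b1 _]] := mid i x; first by move: hi xi => /andP[h1 h2] xi; rewrite lt_neqAle eq_sym xi h1.
by move/eqP: b1; rewrite bE eq_sym (negbTE (drev_neq _)).
Qed.

Lemma per_mul a p q : per a p -> per a (p * q).
Proof.
move=> ap; elim/int_rec: q => [|n IH|n IH] i; first by rewrite mulr0 addr0.
  by rewrite intS mulrDr mulr1 addrA IH ap.
rewrite (_ : i + p * - n.+1%:Z = i + p * - n%:Z - p); last by lia.
by rewrite -[LHS]ap subrK IH.
Qed.

Lemma per_add a p q : per a p -> per a q -> per a (p + q).
Proof. by move=> ap aq i; rewrite addrA aq ap. Qed.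

Lemma min_period a (n : nat) : (0 < n)%N -> per a n ->
  exists n0 : nat, [/\ (0 < n0)%N, per a n0 & forall q, per a q -> (n0 %| q)%Z].
Proof.
move=> n0 an.
have ex : exists m : nat, (0 < m)%N && `[< per a m >].
  by exists n; rewrite n0; apply/asboolP.
case: (ex_minnP ex) => m /andP[m0 /asboolP am] mmin.
exists m; split=> // q aq; apply/dvdz_mod0P.
have ar : per a (q %% m)%Z.
  by rewrite /modz; apply: per_add => //; rewrite -mulNr mulrC; apply: per_mul.
have := ltz_pmod q (d := m%:Z) ltac:(lia); have := modz_ge0 q (d:=m%:Z) ltac:(lia).
case: (q %% m)%Z ar => // -[//|r] ar _ rm.
by have := mmin r.+1; rewrite (asboolT ar) /= => /(_ isT); lia.
Qed.

End Lines.

(** * Locally injective paths *)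

Section RealLine.
Local Open Scope classical_set_scope.
Local Open Scope ring_scope.
Variable R : realType.

(** Real induction: the infimum of the counterexamples satisfies [P] by the left-hand step, and then
    the right-hand step keeps counterexamples away from it. It replaces a subdivision of [[A, B]] by
    compactness. *)
Lemma real_ind (A B : R) (P : R -> Prop) : P A ->
  (forall t, A <= t < B -> P t -> exists2 e, 0 < e & forall s, t < s < t + e -> s <= B -> P s) ->
  (forall t, A < t <= B -> (forall s, A <= s < t -> P s) -> P t) ->
  forall t, A <= t <= B -> P t.
Proof.
move=> PA Pr Pl t /andP[At tB]; apply: contrapT => nPt.
pose S := [set s | A <= s <= B /\ ~ P s].
have S0 : S !=set0 by exists t; rewrite /S /= At tB.
have lS : has_lbound S by exists A => s -[/andP[]].
have hS : has_inf S by split.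
have Am : A <= inf S by apply: lb_le_inf => // s -[/andP[]].
have mB : inf S <= B by apply: (le_trans _ tB); apply: ge_inf => //; rewrite /S /= At tB.
have Pm : P (inf S).
  have [<-//|Am'] := eqVneq A (inf S).
  apply: Pl => [|s /andP[As sm]]; first by rewrite lt_neqAle Am' Am.
  apply: contrapT => nPs; suff : inf S <= s by rewrite leNgt sm.
  by apply: (ge_inf lS); split=> //; rewrite As (le_trans (ltW sm)).
have mB' : inf S < B.
  rewrite lt_neqAle mB andbT; apply/eqP => mE; apply: (nPt).
  suff -> : t = inf S by [].
  apply/eqP; rewrite eq_le {1}mE tB /=.
  by apply: ge_inf => //; rewrite /S /= At tB.
have [e e0 he] := Pr (inf S) ltac:(by rewrite Am mB') Pm.
have [s [/andP[As sB] nPs] sm] := inf_adherent e0 hS.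
apply: (nPs); have [->//|ns] := eqVneq s (inf S).
apply: he => //; rewrite sm andbT lt_neqAle eq_sym ns /=.
by apply: (ge_inf lS); split=> //; rewrite As sB.
Qed.

(** Near an interior extremum a continuous injective function would have to be strictly monotone,
    which is absurd. Hence on an interval whose ends have equal values there is no room for the
    extrema. *)
Lemma locinj_mono (r : R -> R) (s s' : R) :
  (forall t, s < t < s' -> {for t, continuous r}) ->
  (forall t, s < t < s' -> exists2 A, nbhs t A & {in A &, injective r}) ->
  unstable.strict_monotonic `]s, s'[ r.
Proof.
have nomax (q : R -> R) : (forall t, s < t < s' -> {for t, continuous q}) ->
  (forall t, s < t < s' -> exists2 A, nbhs t A & {in A &, injective q}) ->
  forall x y c, s < x -> x < c < y -> y < s' -> exists2 t, x <= t <= y & q c < q t.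
  move=> cq lq x y c sx xcy ys; apply: contrapT => nex.
  have cmax t : x <= t <= y -> q t <= q c.
    by move=> xty; rewrite leNgt; apply/negP => h; apply: nex; exists t.
  have [A /nbhs_ballP[e /= e0 bA] iA] := lq c ltac:(lra).
  have [m [m0 m1 m2 m3]] : exists m : R, [/\ 0 < m, m < e, x <= c - m & c + m <= y].
    pose m : R := Num.min (e / 2) (Num.min (c - x) (y - c)).
    exists m; have : m <= e / 2 /\ m <= c - x /\ m <= y - c /\ 0 < m.
      rewrite /m; case: (leP (c - x) (y - c)) => h; 
        [case: (leP (e / 2) (c - x)) | case: (leP (e / 2) (y - c))] => h'; lra.
    by move=> [h1 [h2 [h3 h4]]]; split; lra.
  have hA (w : R) : c - m <= w <= c + m -> A w.
    by move=> /andP[w1 w2]; apply: bA; rewrite /ball /= ltr_norml; lra.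
  have iI : {in `[(c - m), (c + m)] &, injective q}.
    move=> u v; rewrite !in_itv /= => hu hv; exact: (iA u v (mem_set (hA u hu)) (mem_set (hA v hv))).
  have cA (w : R) : c - m <= w <= c + m -> {for w, continuous q}.
    by move=> /andP[w1 w2]; apply: cq; lra.
  have cI : {within `[(c - m), (c + m)], continuous q}.
    by apply: continuous_in_subspaceT => u; rewrite inE /= in_itv /= => /cA.
  have [h|h] := itv_continuous_inj_mono cI iI.
    have := h c (c + m); rewrite !in_itv /= => /(_ ltac:(lra) ltac:(lra) ltac:(lra)).
    by rewrite ltNge cmax //; lra.
  have := h c (c - m); rewrite !in_itv /= => /(_ ltac:(lra) ltac:(lra) ltac:(lra)).
  by rewrite ltNge cmax //; lra.
move=> cr lr.
have cN : forall t, s < t < s' -> {for t, continuous (fun t => - r t)}.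
  by move=> t st; apply: continuousN; exact: cr.
have lN : forall t, s < t < s' -> exists2 A, nbhs t A & {in A &, injective (fun t => - r t)}.
  by move=> t st; have [A nA iA] := lr t st; exists A => // x y Ax Ay /oppr_inj; exact: iA.
apply: itv_continuous_inj_mono.
  by apply: continuous_in_subspaceT => u; rewrite inE /= in_itv /=; exact: cr.
suff main x y : s < x -> x < y -> y < s' -> r x <> r y.
  move=> x y; rewrite !in_itv /= => /andP[sx xs] /andP[sy ys] rxy.
  by case: (ltgtP x y) => // xy; exfalso; [apply: (main x y)|apply: (main y x)].
move=> sx xy ys rxy.
have cA (w : R) : x <= w <= y -> {for w, continuous r}.
  by move=> /andP[w1 w2]; apply: cr; lra.
have cI : {within `[x, y], continuous r}.
  by apply: continuous_in_subspaceT => u; rewrite inE /= in_itv /= => /cA.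
have [c] := EVT_max (ltW xy) cI; have [d] := EVT_min (ltW xy) cI.
rewrite !in_itv /= => dxy dmin cxy cmax.
have nc : ~ (x < c < y).
  move=> h; have [t txy] := nomax r cr lr x y c sx h ys.
  by rewrite ltNge cmax // in_itv /=.
have nd : ~ (x < d < y).
  move=> h; have [t txy] := nomax _ cN lN x y d sx h ys.
  by rewrite ltrN2 ltNge dmin // in_itv /=.
have cE : r c = r x.
  have [->//|cx] := eqVneq c x; have [->//|cy] := eqVneq c y.
  case: nc; move: cxy; rewrite !lt_neqAle; rewrite (eq_sym x) cx cy //.
have dE : r d = r x.
  have [->//|cx] := eqVneq d x; have [->//|cy] := eqVneq d y.
  case: nd; move: dxy; rewrite !lt_neqAle; rewrite (eq_sym x) cx cy //.
(* Both extrema are attained with the value of the ends, so [r] is constant on [[x, y]] and the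
   midpoint is an interior maximum. *)
have [t txy] := nomax r cr lr x y ((x + y) / 2) sx ltac:(lra) ys.
apply/negP; rewrite -leNgt; apply: (@le_trans _ _ (r x)).
  by rewrite -cE; apply: cmax; rewrite in_itv.
by rewrite -dE; apply: dmin; rewrite in_itv /=; lra.
Qed.

End RealLine.

Section Paths.
Local Open Scope classical_set_scope.
Local Open Scope ring_scope.
Variables (R : realType) (G : graph).
Implicit Types (al : R -> gspace R G) (e : 'I_(nedge G)) (a : dart G) (x y s t u : R).

(** The value 0 at vertices is a placeholder; continuity is claimed at inner points. *)
Definition coord (p : gspace R G) : R := if p is Inner _ t _ then t else 0.

Lemma coord_edge e t : 0 < t < 1 -> coord (edge_pt e t) = t.
Proof. by move=> t01; rewrite (edge_ptE e t01). Qed.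

Lemma coord_cont e t : 0 < t < 1 -> {for edge_pt e t, continuous coord}.
Proof.
move=> t01 O; rewrite coord_edge // => nO; apply: nbhs_edge => //.
have t0 : \forall u \near t, 0 < u by apply: lt_nbhsr; lra.
have t1 : \forall u \near t, u < 1 by apply: lt_nbhsl; lra.
near=> u; rewrite /= coord_edge; first by near: u.
by apply/andP; split; near: u.
Unshelve. all: by end_near. Qed.

Lemma inner_edge (T : topologicalType) (C : set T) (al : T -> gspace R G) (t0 : T) :
  connected C -> C t0 -> (forall t : T, C t -> {for t, continuous al}) ->
  (forall t : T, C t -> ~~ is_vert (al t)) ->
  exists e, forall t : T, C t -> 0 < coord (al t) < 1 /\ al t = edge_pt e (coord (al t)).
Proof.
move=> cC C0 ca nv; have [e [u0 [u01 e0]]] := edge_ptP (nv _ C0).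
suff main (t : T) : C t -> exists2 u, 0 < u < 1 & al t = edge_pt e u.
  by exists e => t /main[u u1 ->]; rewrite coord_edge.
move: t; apply: (connected_ind cC C0); first by exists u0.
move=> t Ct; have [e' [u' [u'01 e'0]]] := edge_ptP (nv _ Ct).
have : \forall s \near t, exists2 u, 0 < u < 1 & al s = edge_pt e' u.
  apply: (ca t Ct [set p | exists2 u, 0 < u < 1 & p = edge_pt e' u]).
  rewrite e'0; apply: nbhs_edge => //.
  have t0' : \forall u \near u', 0 < u by apply: lt_nbhsr; lra.
  have t1' : \forall u \near u', u < 1 by apply: lt_nbhsl; lra.
  by near=> u; exists u => //; apply/andP; split; near: u.
apply: filterS => s [u u01' su] Cs; rewrite su e'0.
split=> -[w w01 /edge_pt_inj[//|<- _]]; first by exists u'.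
by exists u.
Unshelve. all: by end_near. Qed.

(** The relative form serves paths such as [f \o edge_pt e], which are constant outside [[0, 1]] and
    so not locally injective on the line. *)
Definition locinj_on al (A B : R) := forall x, A <= x <= B ->
  exists2 U, nbhs x U & forall y z, U y -> U z -> A <= y <= B -> A <= z <= B ->
    al y = al z -> y = z.

(** The coordinate in the edge is strictly monotone by [locinj_mono]; the decreasing case is
    absorbed by reversing the dart. *)
Lemma inner_dart al s s' : s < s' -> continuous al -> locinj_on al s s' ->
  (forall t, s < t < s' -> ~~ is_vert (al t)) ->
  exists a r, [/\ forall t, s < t < s' -> 0 < r t < 1 /\ al t = dart_pt a (r t),
    forall t, s < t < s' -> {for t, continuous r} &
    forall x y, s < x -> x < y -> y < s' -> r x < r y].
Proof.
move=> ss ca la nv.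
have cI : connected [set` `]s, s'[] by apply/connected_intervalP; exact: interval_is_interval.
have [||||e he] := @inner_edge _ [set` `]s, s'[] al ((s + s') / 2).
- exact: cI.
- by rewrite /= in_itv /=; lra.
- by move=> t _; exact: ca.
- by move=> t; rewrite /= in_itv /=; exact: nv.
pose q t := coord (al t).
have qc t : s < t < s' -> {for t, continuous q}.
  move=> st; have [t01 aE] := he t ltac:(by rewrite /= in_itv).
  by apply: (continuous_comp (ca t)); rewrite aE; exact: coord_cont.
have ql t : s < t < s' -> exists2 A, nbhs t A & {in A &, injective q}.
  move=> st; have [A nA iA] := la t ltac:(lra).
  exists (A `&` [set u | s < u < s']).
    apply: filterI => //.
    have t0 : \forall u \near t, s < u by apply: lt_nbhsr; lra.
    have t1 : \forall u \near t, u < s' by apply: lt_nbhsl; lra.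
    by near=> u; apply/andP; split; near: u.
  move=> x y /set_mem[Ax /= xs] /set_mem[Ay /= ys] qxy.
  apply: iA => //; [lra|lra|].
  have [_ ->] := he x ltac:(by rewrite /= in_itv).
  have [_ ->] := he y ltac:(by rewrite /= in_itv).
  by move: qxy; rewrite /q => ->.
have [h|h] := locinj_mono qc ql.
  exists (e, false), q; split=> [|//|]; [by move=> t st; have [] := he t ltac:(by rewrite /= in_itv)|] => x y sx xy ys.
  by have := h x y; rewrite !in_itv /=; apply; lra.
exists (e, true), (fun t => 1 - q t); split=> [t st|t st|x y sx xy ys].
- have [t01 aE] := he t ltac:(by rewrite /= in_itv).
  by rewrite /dart_pt /= subKr; split; [rewrite /q; lra|].
- by apply: continuousB; [exact: cst_continuous|exact: qc].
- by rewrite ltrD2l ltrN2; have := h y x; rewrite !in_itv /=; apply; lra.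
Unshelve. all: by end_near. Qed.

(** Making [phi] constant on both sides of [[A, B]] turns concatenation of paths into addition of
    their parameters ([pathform_cat]). *)
Definition pathform al (A B : R) (p : seq (dart G)) (phi : R -> R) :=
  [/\ continuous phi, forall t, t <= A -> phi t = 0,
      forall t, B <= t -> phi t = (size p)%:R,
      forall x y, A <= x -> x < y -> y <= B -> phi x < phi y &
      forall d t j, A <= t <= B -> (j < size p)%N -> j%:R <= phi t <= j.+1%:R ->
        al t = dart_pt (nth d p j) (phi t - j%:R)].

Lemma near_left_ex (s : R) (P : set R) : (\forall t \near s, P t) -> exists2 t, t < s & P t.
Proof.
move=> /nbhs_ballP[e /= e0 h]; exists (s - e / 2); first by lra.
by apply: h; rewrite /ball /= subKr ger0_norm; lra.
Qed.

Lemma near_right_ex (s : R) (P : set R) : (\forall t \near s, P t) -> exists2 t, s < t & P t.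
Proof.
move=> /nbhs_ballP[e /= e0 h]; exists (s + e / 2); first by lra.
by apply: h; rewrite /ball /= opprD addNKr normrN ger0_norm; lra.
Qed.

Lemma pathform_edge al s s' : s < s' -> continuous al -> locinj_on al s s' ->
  (forall t, s < t < s' -> ~~ is_vert (al t)) -> is_vert (al s) -> is_vert (al s') ->
  exists a phi, pathform al s s' [:: a] phi.
Proof.
move=> ss ca la nv vs vs'; have [a [r [hr rc rm]]] := inner_dart ss ca la nv.
pose m := (s + s') / 2.
have m1 : s < m by rewrite /m; lra.
have m2 : m < s' by rewrite /m; lra.
have [m01 _] := hr m ltac:(by rewrite m1 m2).
have stars t v eps : al t = Vertex R v -> 0 < eps -> \forall u \near t, star v eps (al u).
  by move=> tv e0; apply: (ca t); rewrite tv; exact: nbhs_star.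
have star_r t v eps : s < t < s' -> eps < 1 -> star v eps (al t) ->
    (r t < eps /\ v = dsrc a) \/ (1 - eps < r t /\ v = dtgt a).
  move=> st e1; have [r01 ->] := hr t st.
  case=> [/dart_pt_inner|[b [w [bv we]]]]; first by move=> /(_ r01).
  case/dart_pt_inj => [//|[ab rw]|[bE wE]].
    by left; split; [clear -we rw; lra|rewrite -bv ab].
  by right; split; [clear -we wE; lra|rewrite -bv bE dsrc_rev].
have dE eps (u : R) : 0 < eps -> 0 < u -> exists d : R, [/\ 0 < d, d <= eps & d < u].
  move=> e0 u0; exists (Num.min eps (u / 2)).
  by case: (leP eps (u / 2)) => h; split; lra.
(* Near [s'] the path is in a small star, so [r] is close to 0 or to 1. It increases and has already
   passed [r m], which exceeds the radius [d]; only 1 is left. *)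
have endr eps : 0 < eps -> eps < 1/2 ->
    \forall t \near s', t < s' -> 1 - eps < r t /\ al s' = Vertex R (dtgt a).
  move=> e0 e1; move: vs'; case E: (al s') => [v|//] _.
  have [d [d0 d1 d2]] := dE eps (r m) e0 ltac:(lra).
  have h1 : \forall t \near s', m < t by apply: lt_nbhsr.
  have h2 := stars _ _ _ E d0.
  near=> t => ts'.
  have mt : m < t by near: t.
  have st : s < t < s' by rewrite ts' (lt_trans m1 mt).
  have sv : star v d (al t) by near: t.
  have rmt := rm m t m1 mt ts'; have d1' : d < 1 by clear -d1 e1; lra.
  case: (star_r _ _ _ st d1' sv) => -[rt vE].
    by exfalso; clear vE sv E; lra.
  by rewrite vE; split=> //; clear vE sv E; lra.
have endl eps : 0 < eps -> eps < 1/2 ->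
    \forall t \near s, s < t -> r t < eps /\ al s = Vertex R (dsrc a).
  move=> e0 e1; move: vs; case E: (al s) => [v|//] _.
  have [d [d0 d1 d2]] := dE eps (1 - r m) e0 ltac:(lra).
  have h1 : \forall t \near s, t < m by apply: lt_nbhsl.
  have h2 := stars _ _ _ E d0.
  near=> t => ts.
  have mt : t < m by near: t.
  have st : s < t < s' by rewrite ts (lt_trans mt m2).
  have sv : star v d (al t) by near: t.
  have rmt := rm t m ts mt m2; have d1' : d < 1 by clear -d1 e1; lra.
  case: (star_r _ _ _ st d1' sv) => -[rt vE]; last first.
    by exfalso; clear vE sv E; lra.
  by rewrite vE; split=> //; clear vE sv E; lra.
have alr : al s' = Vertex R (dtgt a).
  by have [t ts /(_ ts)[]] := near_left_ex (endr (1/4) ltac:(lra) ltac:(lra)).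
have all : al s = Vertex R (dsrc a).
  by have [t ts /(_ ts)[]] := near_right_ex (endl (1/4) ltac:(lra) ltac:(lra)).
pose phi t := if t <= s then 0 else if t < s' then r t else 1.
have phi1 t : t <= s -> phi t = 0 by rewrite /phi => ->.
have phi2 t : s' <= t -> phi t = 1.
  by move=> st; rewrite /phi leNgt (lt_le_trans ss st) /= ltNge st.
have phi3 t : s < t < s' -> phi t = r t.
  by move=> /andP[st ts]; rewrite /phi leNgt st ts.
have hr01 t : s < t -> t < s' -> 0 < r t < 1.
  by move=> st ts; have [|] := hr t => //; rewrite st ts.
exists a, phi; split.
- move=> t; case: (ltgtP t s) => [ts|st|->].
  + apply: (@cont_near _ _ _ (fun=> 0)); first exact: cst_continuous.
    by near=> u; apply: phi1; apply: ltW; near: u; exact: lt_nbhsl.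
  + case: (ltgtP t s') => [ts'|st'|->].
    * apply: (@cont_near _ _ _ r); first by apply: rc; rewrite st ts'.
      near=> u; apply: phi3; apply/andP; split; near: u; first exact: lt_nbhsr.
      exact: lt_nbhsl.
    * apply: (@cont_near _ _ _ (fun=> 1 : R)); first exact: cst_continuous.
      by near=> u; apply: phi2; apply: ltW; near: u; exact: lt_nbhsr.
    * apply/cvgrPdist_lt => eps e0; rewrite phi2 //.
      have [d [d0 d1 d2]] := dE eps (1/2) e0 ltac:(lra).
      have h := endr d d0 d2.
      have h' : \forall u \near s', s < u by exact: lt_nbhsr.
      near=> u; have [us|us] := leP s' u; first by rewrite phi2 // subrr normr0.
      have su : s < u by near: u.
      rewrite phi3 ?su //; have r01 := hr01 u su us.
      have [ru _] : 1 - d < r u /\ al s' = Vertex R (dtgt a) by move: us; near: u.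
      by rewrite ltr_norml; lra.
  + apply/cvgrPdist_lt => eps e0; rewrite phi1 //.
    have [d [d0 d1 d2]] := dE eps (1/2) e0 ltac:(lra).
    have h := endl d d0 d2.
    have h' : \forall u \near s, u < s' by exact: lt_nbhsl.
    near=> u; have [us|us] := leP u s; first by rewrite phi1 // subrr normr0.
    have su : u < s' by near: u.
    rewrite phi3 ?us //; have r01 := hr01 u us su.
    have [ru _] : r u < d /\ al s = Vertex R (dsrc a) by move: us; near: u.
    by rewrite ltr_norml; lra.
- exact: phi1.
- exact: phi2.
- move=> x y sx xy ys.
  have [->|x1] := eqVneq x s.
    rewrite phi1 //; have [->|y1] := eqVneq y s'; first by rewrite phi2.
    have sy : s < y by exact: le_lt_trans xy.
    have ys' : y < s' by rewrite lt_neqAle y1.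
    by rewrite phi3 ?sy //; have /andP[] := hr01 y sy ys'.
  have sx' : s < x by rewrite lt_neqAle eq_sym x1.
  rewrite (phi3 x) ?sx' ?(lt_le_trans xy) //.
  have [->|y1] := eqVneq y s'.
    by rewrite phi2 //; have /andP[] := hr01 x sx' ltac:(by apply: lt_le_trans xy _).
  have ys' : y < s' by rewrite lt_neqAle y1.
  by rewrite phi3 ?ys' ?(lt_trans sx') //; exact: rm.
- move=> d t [|//] st _ _; rewrite /= subr0.
  case/andP: st; rewrite !le_eqVlt => /orP[/eqP <-|st]; first by rewrite phi1 // dart_pt_le0.
  case/orP => [/eqP ->|ts]; first by rewrite phi2 // dart_pt_ge1.
  by rewrite phi3 ?st //; have [] := hr t ltac:(by rewrite st ts).
Unshelve. all: by end_near. Qed.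

Lemma pathform_cat al A B C p q phi psi : A <= B -> B <= C ->
  pathform al A B p phi -> pathform al B C q psi ->
  pathform al A C (p ++ q) (fun t => phi t + psi t).
Proof.
move=> AB BC [c1 z1 e1 m1 f1] [c2 z2 e2 m2 f2]; split.
- by move=> t; apply: continuousD; [exact: c1|exact: c2].
- by move=> t tA; rewrite z1 // z2 ?addr0 // (le_trans tA).
- by move=> t tC; rewrite e2 // e1 ?(le_trans BC) // size_cat natrD.
- move=> x y Ax xy yC; have [yB|By] := leP y B.
    by rewrite !z2 ?(le_trans (ltW xy)) // !addr0; exact: m1.
  have [Bx|xB] := leP B x.
    by rewrite !e1 ?(le_trans Bx (ltW xy)) // ltrD2l; exact: m2.
  rewrite (z2 x) ?(ltW xB) // (e1 y) ?(ltW By) // -(e1 B) //.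
  by apply: ltrD; [exact: m1|rewrite -(z2 B) //; exact: m2].
move=> d t j /andP[At tC]; rewrite size_cat nth_cat => jpq.
have [tB|Bt] := leP t B.
  rewrite z2 // addr0; case: ltnP => jp h; first by apply: f1; rewrite ?At.
  have ptB : t = B.
    apply/eqP; rewrite eq_le tB /= leNgt; apply/negP => tB'.
    have := m1 t B At tB' (lexx _); rewrite (e1 B) // => h'.
    by move: h => /andP[h _]; move: h; apply/negP; rewrite -ltNge (lt_le_trans h') // ler_nat.
  rewrite ptB e1 //; rewrite ptB e1 // ler_nat in h.
  have jE : j = size p by apply/eqP; rewrite eqn_leq jp andbT; case/andP: h.
  rewrite jE subnn subrr; have := f2 d B 0%N; rewrite z2 // subrr; apply.
  - by rewrite lexx BC.
  - by move: jpq; rewrite jE -{1}(addn0 (size p)) ltn_add2l.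
  - by rewrite lexx ler01.
rewrite e1 ?(ltW Bt) // => h.
have p0 : 0 < psi t by rewrite -(z2 B) //; apply: m2.
case: ltnP => jp.
  exfalso; case/andP: h => _; apply/negP; rewrite -ltNge.
  by apply: (@le_lt_trans _ _ (size p)%:R); [rewrite ler_nat|rewrite ltrDl].
rewrite (f2 d t (j - size p)%N).
- by rewrite natrB //; congr dart_pt; lra.
- by rewrite (ltW Bt).
- by rewrite ltn_subLR.
- by rewrite -subSn // !natrB ?(leq_trans jp) //; lra.
Qed.

(** Local injectivity makes the times at vertices isolated ([isol]), so real induction adds one edge
    at a time. *)
Lemma pathform_exists al A B : A < B -> continuous al -> locinj_on al A B ->
  is_vert (al A) -> is_vert (al B) -> exists p phi, pathform al A B p phi.
Proof.
move=> AB ca la vA vB.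
have isol t : A <= t <= B -> exists2 e, 0 < e &
    forall s, A <= s <= B -> t - e < s < t + e -> is_vert (al s) -> s = t.
  move=> tAB; have [U nU iU] := la t tAB.
  suff : \forall s \near t, A <= s <= B -> is_vert (al s) -> s = t.
    move=> /nbhs_ballP[e /= e0 he]; exists e => // s sAB se; apply: he => //.
    by rewrite /ball /= ltr_norml; lra.
  case E: (al t) => [v|e u u01].
    have h : \forall s \near t, star v (1/2) (al s).
      by apply: (ca t); rewrite E; apply: nbhs_star; lra.
    near=> s => sAB vs; apply: iU => //; [by near: s|exact: nbhs_singleton|].
    rewrite E; have : star v (1/2) (al s) by near: s.
    case=> [//|[b [w [_ w1 aE]]]]; move: vs; rewrite aE is_vert_dart.
    by move/negP; case; lra.
  have h : \forall s \near t, ~~ is_vert (al s).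
    apply: (ca t [set p | ~~ is_vert p]); rewrite E -edge_ptE.
    apply: nbhs_edge => //.
    have t0' : \forall u' \near u, 0 < u' by apply: lt_nbhsr; lra.
    have t1' : \forall u' \near u, u' < 1 by apply: lt_nbhsl; lra.
    near=> w; have w01 : 0 < w < 1 by apply/andP; split; near: w.
    by rewrite /= (edge_ptE _ w01).
  by near=> s => _ vs; exfalso; move: vs; apply/negP; near: s.
pose E t := is_vert (al t) -> A < t -> exists p phi, pathform al A t p phi.
(* The second clause keeps the last vertex time [t0], from which the edge in progress starts. *)
pose P t := (forall t', A <= t' <= t -> E t') /\
  exists t0, [/\ A <= t0 <= t, is_vert (al t0) & forall s, t0 < s <= t -> ~~ is_vert (al s)].
suff [h _] : P B by apply: h => //; rewrite lexx ltW.
apply: (@real_ind R A B P); last by rewrite lexx ltW.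
- split; first by move=> t' tA _ At; exfalso; lra.
  exists A; rewrite lexx; split=> // s; move=> sA; exfalso; lra.
- move=> t tAB [h1 [t0 [t0A vt0 nv0]]]; have [e e0 he] := isol t ltac:(lra).
  exists e => // s ts sB.
  have nvs u : t < u <= s -> ~~ is_vert (al u).
    move=> tu; apply/negP => vu; have := he u ltac:(lra) ltac:(lra) vu.
    by clear vu; lra.
  split; last first.
    exists t0; split=> //; first by lra.
    move=> u ut; have [u1|u1] := leP u t; first by apply: nv0; lra.
    by apply: nvs; lra.
  move=> t' t'A; have [u1|u1] := leP t' t; first by apply: h1; lra.
  by move=> vt'; have := nvs t' ltac:(lra); rewrite vt'.
- move=> t tAB hs; have [e e0 he] := isol t ltac:(lra).
  pose s := Num.max (t - e / 2) ((t + A) / 2).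
  have [s1 s2 s3] : [/\ A <= s, t - e < s & s < t].
    by rewrite /s; case: (leP (t - e / 2) ((t + A) / 2)) => h; split; lra.
  have [h1 [t0 [t0A vt0 nv0]]] := hs s ltac:(lra).
  have nvs u : t0 < u < t -> ~~ is_vert (al u).
    move=> tu; have [u1|u1] := leP u s; first by apply: nv0; lra.
    apply/negP => vu; have := he u ltac:(lra) ltac:(lra) vu.
    by clear vu; lra.
  have Et : E t.
    move=> vt At.
    have l0 : locinj_on al t0 t.
      move=> x xt; have [U nU iU] := la x ltac:(lra).
      by exists U => // y z Uy Uz yt zt; apply: iU => //; lra.
    have [a [phi pf]] := pathform_edge (s := t0) (s' := t) ltac:(lra) ca l0 nvs vt0 vt.
    have [At0|At0] := ltP A t0; last first.
      have -> : A = t0 by lra.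
      by exists [:: a], phi.
    have [q [psi pf']] := h1 t0 ltac:(lra) vt0 At0.
    by exists (q ++ [:: a]); eexists; apply: (pathform_cat _ _ pf' pf); lra.
  split.
    move=> t' t'A; have [->//|tt] := eqVneq t' t.
    have t't : t' < t by rewrite lt_neqAle tt; lra.
    have [h2 _] := hs t' ltac:(lra); apply: h2; lra.
  case vt : (is_vert (al t)).
    by exists t; rewrite vt; split=> //; [lra|move=> u ut; exfalso; clear vt; lra].
  exists t0; split=> //; first by lra.
  move=> u ut; have [->|tt] := eqVneq u t; first by rewrite vt.
  have ut' : u < t by rewrite lt_neqAle tt; lra.
  by apply: nvs; lra.
Unshelve. all: by end_near. Qed.

End Paths.

(** * Immersed loops and vertices *)

Section LoopLine.
Local Open Scope classical_set_scope.
Local Open Scope ring_scope.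
Variables (R : realType) (G : graph).
Implicit Types (al : R -> gspace R G) (x y s t u : R).

Lemma homo_homeoR (th : R -> R) : (forall x y, x < y -> th x < th y) ->
  (forall y, exists x, th x = y) -> homeoR th.
Proof. by move=> h s; split=> //; apply: leW_mono; apply: le_mono. Qed.

Lemma locinj_locinj_on al A B : locinj al -> locinj_on al A B.
Proof.
move=> la x _; have [U nU iU] := la x; exists U => // y z Uy Uz _ _.
by apply: iU; apply/mem_set.
Qed.

(** A path without vertices stays in one edge with a strictly monotone coordinate, and so cannot be
    periodic. *)
Lemma loop_vertex al : continuous al -> locinj al -> (forall t, al (t + 1) = al t) ->
  exists t, is_vert (al t).
Proof.
move=> ca la pa; apply: contrapT => nex.
have nv t : ~~ is_vert (al t) by apply/negP => vt; apply: nex; exists t.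
have [|a [r [hr _ rm]]] := @inner_dart R G al (-1) 2 ltac:(lra) ca (locinj_locinj_on la).
  by move=> t _; exact: nv.
have [r0 a0] := hr 0 ltac:(lra); have [r1 a1] := hr 1 ltac:(lra).
have := pa 0; rewrite add0r a0 a1 => /dart_pt_inj[//|[_ e]|[/esym/eqP]].
  by have := rm 0 1 ltac:(lra) ltac:(lra) ltac:(lra); rewrite e ltxx.
by rewrite (negbTE (drev_neq _)).
Qed.

Lemma loop_int al (i : int) t : (forall t, al (t + 1) = al t) -> al (t + i%:~R) = al t.
Proof.
move=> pa; elim/int_rec: i t => [|n IH|n IH] t; first by rewrite addr0.
  by rewrite intS intrD addrA IH pa.
by rewrite -[in LHS]pa -(IH t); congr al; rewrite intS opprD intrD intrN; lra.
Qed.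

(** Cut at a vertex time, the loop is a finite edge path. [a] and [th] extend this path and its
    parameter equivariantly from one period to the line. *)
Lemma loop_line al : continuous al -> locinj al -> (forall t, al (t + 1) = al t) ->
  exists a (n : nat) th, [/\ (0 < n)%N, per a n, homeoR th,
    forall t, th (t + 1) = th t + n%:R & forall t, al t = line a (th t)].
Proof.
move=> ca la pa; have [t0 v0] := loop_vertex ca la pa.
have v1 : is_vert (al (t0 + 1)) by rewrite pa.
have [|p [phi [cphi phi0 phi1 mphi fphi]]] := pathform_exists _ ca (locinj_locinj_on la) v0 v1.
  by rewrite ltrDl.
set n := size p in phi1 *.
have n0 : (0 < n)%N.
  by rewrite -(ltr0n R) -(phi1 (t0 + 1)) // -(phi0 t0) //; apply: mphi => //; lra.
have n0' : 0 < n%:R :> R by rewrite ltr0n.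
have phi01 u : 0 <= u < 1 -> 0 <= phi (t0 + u) < n%:R.
  move=> u01; rewrite -(phi1 (t0 + 1)) // mphi; [|lra|lra|lra].
  rewrite andbT; have [->|ne] := eqVneq u 0; first by rewrite addr0 phi0.
  by rewrite -{1}(phi0 t0) //; apply/ltW/mphi; [|rewrite ltrDl lt_neqAle eq_sym ne; lra|lra].
have [d _] : exists d : dart G, True by move: n0; rewrite /n; case: (p) => // d; exists d.
pose a (i : int) := nth d p `|(i %% n)%Z|%N.
pose th t := let k : int := Num.floor (t - t0) in phi (t - k%:~R) + n%:R * k%:~R.
have thE (k : int) u : 0 <= u < 1 -> th (t0 + u + k%:~R) = phi (t0 + u) + n%:R * k%:~R.
  move=> u01; rewrite /th (_ : t0 + u + k%:~R - t0 = u + k%:~R); last by lra.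
  by rewrite (@floor_def _ _ k) ?addrK // intrD; lra.
have split_t t : exists (k : int) u, 0 <= u < 1 /\ t = t0 + u + k%:~R.
  have [k hk] := floorP (t - t0); exists k, (t - t0 - k%:~R); lra.
have hom : homeoR th.
  apply: homo_homeoR => [x y|y].
    have [k [u [u01 ->]]] := split_t x; have [l [w [w01 ->]]] := split_t y.
    rewrite !thE // => xy.
    have kl : k < l + 1 by rewrite -(ltr_int R) intrD; lra.
    have [kE|kne] := eqVneq k l.
      rewrite kE ltrD2r; apply: mphi; [lra| |lra].
      by move: xy; rewrite kE ltrD2r.
    have kl' : k + 1 <= l by lia.
    have hkl : k%:~R + 1 <= l%:~R :> R by rewrite -(intrD _ k 1) ler_int.
    have := phi01 u u01; have := phi01 w w01.
    have := ler_wpM2l (ltW n0') hkl; rewrite mulrDr mulr1; lra.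
  have [k hk] := floorP (y / n%:R).
  have hk' : n%:R * k%:~R <= y < n%:R * k%:~R + n%:R.
    by move: hk; rewrite ler_pdivlMr // ltr_pdivrMr // mulrDl mul1r (mulrC k%:~R).
  have c01 : {within `[t0, t0 + 1], continuous phi} by exact: continuous_subspaceT.
  have [||c] := @IVT R phi t0 (t0 + 1) (y - n%:R * k%:~R) _ c01; first by lra.
    rewrite phi0 // phi1 // min_l; last exact: ltW.
    rewrite max_r; last exact: ltW.
    lra.
  rewrite in_itv /= => ctt phic.
  have c1 : c != t0 + 1.
    by apply/eqP => cE; move: phic; rewrite cE phi1 //; lra.
  have c2 : c < t0 + 1 by rewrite lt_neqAle c1; lra.
  exists (t0 + (c - t0) + k%:~R); rewrite thE; last by lra.
  by rewrite (addrC t0) subrK phic subrK.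
exists a, n, th; split=> //.
- by move=> i; rewrite /a modzDr.
- move=> t; have [k [u [u01 ->]]] := split_t t.
  rewrite (_ : t0 + u + k%:~R + 1 = t0 + u + (k + 1)%:~R); last by rewrite intrD; lra.
  by rewrite !thE // intrD mulrDr mulr1 addrA.
move=> t; have [k [u [u01 ->]]] := split_t t.
rewrite loop_int // thE //; have pu := phi01 u u01.
have [j hj] := floorP (phi (t0 + u)).
have j0 : 0 <= j by rewrite -ltzD1 -(ltr_int R) intrD; lra.
have jn : j < n by rewrite -(ltr_int R) -pmulrn; lra.
case: j hj j0 jn => // j hj _ jn.
rewrite (@line_itv R G a (n%:Z * k + j)); last first.
  by rewrite intrD intrM -!pmulrn in hj *; lra.
rewrite /a (mulrC n%:Z) modzMDl modz_small ?jn //=.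
rewrite (fphi d (t0 + u) j) //; first last.
- by rewrite -addn1 natrD -!pmulrn in hj *; lra.
- by lra.
by congr dart_pt; rewrite intrD intrM -!pmulrn; lra.
Qed.

Lemma loop_line_period al (P : R) : 0 < P -> continuous al -> locinj al ->
  (forall t, al (t + P) = al t) ->
  exists a (n : nat) th, [/\ (0 < n)%N, per a n, homeoR th,
    forall t, th (t + P) = th t + n%:R & forall t, al t = line a (th t)].
Proof.
move=> P0 ca la pa.
have sc : homeoR (fun t : R => P * t) by exact: homeoR_scale.
have [| | |a [n [th [n0 an hth thp alE]]]] := @loop_line (fun t => al (P * t)).
- move=> t; apply: (@continuous_comp _ _ _ (fun t : R => P * t) al); last exact: ca.
  exact: homeoR_cont.
- apply: (@locinj_comp _ _ _ (fun t : R => P * t) al) => //; first exact: homeoR_cont.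
  by move=> x; exists setT; [exact: filterT|move=> u w _ _; exact: homeoR_inj].
- by move=> t; rewrite mulrDr mulr1.
exists a, n, (fun t => th (P^-1 * t)); split=> //.
- apply: (@homeoR_comp _ th (fun t => P^-1 * t)) => //.
  by apply: homeoR_scale; rewrite invr_gt0.
- by move=> t; rewrite mulrDr mulVf ?gt_eqF.
- by move=> t; rewrite -alE mulVKf // gt_eqF.
Qed.

Lemma line_homeo_walk al a th : continuous al -> locinj al -> homeoR th ->
  (forall t, al t = line a (th t)) -> walk a /\ reducedw a.
Proof.
move=> ca la hth alE; have [th' [hth' K K']] := homeoR_inv hth.
have lE x : line a x = al (th' x) by rewrite alE K'.
have cl : continuous (line a : R -> gspace R G).
  move=> x; apply: (@cont_near _ _ _ (al \o th')); last by near=> z; exact: lE.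
  by apply: continuous_comp; [exact: homeoR_cont|exact: ca].
have wa := line_walk cl; split=> //; apply: (@line_reduced R) => //.
have -> : line a = al \o th' by apply/funext => x; exact: lE.
apply: locinj_comp => //; first exact: homeoR_cont.
by move=> x; exists setT; [exact: filterT|move=> u w _ _; exact: homeoR_inj].
Unshelve. all: by end_near. Qed.

End LoopLine.

Section Vertices.
Local Open Scope classical_set_scope.
Local Open Scope ring_scope.
Variables (R : realType) (G : graph).

Lemma card_darts (v : 'I_(nvert G)) : #|[set a : dart G | dsrc a == v]%SET| = valency v.
Proof.
have -> : [set a : dart G | dsrc a == v]%SET =
    ([set (e, false) | e in [set e | src e == v]%SET] :|:
     [set (e, true) | e in [set e | tgt e == v]%SET])%SET.
  apply/setP => -[e b]; rewrite !inE /dsrc /=; case: b; apply/idP/orP.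
  - by move=> h; right; apply/imsetP; exists e; rewrite ?inE.
  - by case=> /imsetP[e']; rewrite inE => h // [->].
  - by move=> h; left; apply/imsetP; exists e; rewrite ?inE.
  - by case=> /imsetP[e']; rewrite inE => h // [->].
rewrite cardsU (_ : (_ :&: _)%SET = finset.set0) ?cards0 ?subn0.
  by rewrite !card_imset // => x y [].
apply/setP => x; rewrite !inE; apply/negP => /andP[/imsetP[e _ ->] /imsetP[e' _]].
by [].
Qed.

(** At an inner point there are only two directions, whereas a local injection must send the
    directions at [v], at least three, to distinct ones. *)
Lemma immersion_vertex (f : gspace R G -> gspace R G) (v : 'I_(nvert G)) :
  continuous f -> locinj f -> (3 <= valency v)%N -> is_vert (f (Vertex R v)).
Proof.
move=> cf lf v3; case E: (f (Vertex R v)) => [//|e t0 t01]; exfalso.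
have [A nA iA] := lf (Vertex R v).
have nI : nbhs (Vertex R v) [set p | ~~ is_vert (f p) /\ exists u, f p = edge_pt e u].
  apply: (cf (Vertex R v) [set p | ~~ is_vert p /\ exists u, p = edge_pt e u]).
  rewrite E -edge_ptE; apply: nbhs_edge => //.
  have t0' : \forall u' \near t0, 0 < u' by apply: lt_nbhsr; lra.
  have t1' : \forall u' \near t0, u' < 1 by apply: lt_nbhsl; lra.
  near=> w; have w01 : 0 < w < 1 by apply/andP; split; near: w.
  by split; [rewrite /= (edge_ptE _ w01)|exists w].
have [eps e12 sub] := nbhs_vertexP (filterI nA nI).
pose c := eps / 2.
have c0 : 0 < c by rewrite /c; lra.
have ce : c < eps by rewrite /c; lra.
pose r a (d : R) := coord (f (dart_pt a d)).
have rE a d : dsrc a = v -> d <= c -> 0 < r a d < 1 /\ f (dart_pt a d) = edge_pt e (r a d).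
  move=> av dc; have : star v eps (dart_pt a d) by rewrite -av; apply: star_dart; lra.
  move=> /sub[_ [nv [u fE]]]; rewrite /r fE.
  have u01 : 0 < u < 1.
    by have := @is_vert_dart R G (e, false) u; rewrite /dart_pt /= -fE (negbTE nv) => /esym/negbFE.
  by rewrite coord_edge.
have rc a d : dsrc a = v -> d <= c -> {for d, continuous (r a)}.
  move=> av dc; have [r01 fE] := rE a d av dc.
  apply: (@continuous_comp _ _ _ (fun d => f (dart_pt a d)) (@coord R G)).
    by apply: continuous_comp; [exact: dart_pt_cont|exact: cf].
  by rewrite fE; exact: coord_cont.
have rinj a b d d' : dsrc a = v -> dsrc b = v -> d <= c -> d' <= c -> r a d = r b d' ->
    dart_pt a d = dart_pt b d' :> gspace R G.
  move=> av bv dc d'c rr; apply: iA.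
  - by apply/mem_set; have := sub (dart_pt a d); rewrite -av; case=> //; apply: star_dart; lra.
  - by apply/mem_set; have := sub (dart_pt b d'); rewrite -bv; case=> //; apply: star_dart; lra.
  - by have [_ ->] := rE a d av dc; have [_ ->] := rE b d' bv d'c; rewrite rr.
have r0 a : dsrc a = v -> r a 0 = t0.
  by move=> av; rewrite /r dart_pt_le0 // av E.
have rne a : dsrc a = v -> r a c != t0.
  move=> av; apply/eqP; rewrite -(r0 a av) => /(rinj _ _ _ _ av av (lexx _) (ltW c0)).
  by rewrite (@dart_pt_le0 _ _ a 0) //; apply: dart_pt_inner; lra.
(* If two darts go to the same side of [t0], the one that reaches farther passes through the end
   point of the other, by the intermediate value theorem. *)
have key a b : dsrc a = v -> dsrc b = v -> `|r a c - t0| <= `|r b c - t0| ->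
    (t0 < r a c) = (t0 < r b c) -> a = b.
  move=> av bv hab side.
  have cI : {within `[0, c], continuous (r b)}.
    apply: continuous_in_subspaceT => u; rewrite inE /= in_itv /= => /andP[_ uc].
    exact: rc.
  have [||d] := @IVT R (r b) 0 c (r a c) _ cI; first exact: ltW.
    rewrite r0 //; move: hab (rne a av) (rne b bv) side.
    case: (ltgtP t0 (r a c)) => // h1; case: (ltgtP t0 (r b c)) => // h2 hab _ _ _.
      rewrite !ger0_norm in hab; [|lra|lra].
      by lra.
    rewrite !ler0_norm in hab; [|lra|lra].
    by lra.
  rewrite in_itv /= => /andP[d0 dc] /esym /(rinj _ _ _ _ av bv (lexx _) dc).
  by move=> /dart_pt_inj_half[||[]]//; lra.
have inj : {in [set a : dart G | dsrc a == v]%SET &, injective (fun a => t0 < r a c)}.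
  move=> a b; rewrite !inE => /eqP av /eqP bv side.
  case: (leP `|r a c - t0| `|r b c - t0|) => h; first exact: key.
  by apply/esym/key => //; exact: ltW.
have := max_card (mem [set (t0 < r a c) | a in [set a : dart G | dsrc a == v]%SET]%SET).
rewrite (card_in_imset inj) card_bool card_darts => h.
by have := leq_trans v3 h.
Unshelve. all: by end_near. Qed.

End Vertices.

(** * Existence of a combinatorial description *)

Section Descriptions.
Local Open Scope classical_set_scope.
Local Open Scope ring_scope.
Variables (R : realType) (G : graph) (f : gspace R G -> gspace R G).

Lemma describes_exists : continuous f -> locinj f ->
  (forall v, is_vert (f (Vertex R v))) -> exists D, describes D f.
Proof.
move=> cf lf fv.
have hv v : exists w, f (Vertex R v) = Vertex R w by case: (f _) (fv v) => // w _; exists w.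
have he e : exists p phi, pathform (f \o edge_pt e) 0 1 p phi.
  apply: pathform_exists => //=.
  - by move=> x; apply: continuous_comp; [exact: edge_pt_cont|exact: cf].
  - move=> x x01; have [A nA iA] := lf (edge_pt e x).
    (* The ball keeps the parameters 0 and 1 apart, which are the same point when [e] is a loop. *)
    exists ((edge_pt e : R -> gspace R G) @^-1` A `&` ball x (1/2)).
      apply: filterI; first exact: (@edge_pt_cont R G e x).
      by apply: nbhsx_ballx; lra.
    move=> y z [Ay]; rewrite /ball /= ltr_norml => yx [Az].
    rewrite /ball /= ltr_norml => zx y01 z01 /iA h.
    have {}h : edge_pt e y = edge_pt e z := h (mem_set Ay) (mem_set Az).
    have [y1|y1] := boolP (0 < y < 1); first by have [] := edge_pt_inj y1 h.
    have [z1|z1] := boolP (0 < z < 1); first by have [] := edge_pt_inj z1 (esym h).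
    by clear h; move: y1 z1; rewrite !negb_and -!leNgt => y1 z1; lra.
  - by rewrite edge_pt_le0.
  - by rewrite edge_pt_ge1.
have [vi hvi] := choice hv; have [ei hei] := choice he.
exists (Description vi ei); split=> // e /=.
have [phi [cphi phi0 phi1 mphi fphi]] := hei e; exists phi; split.
- exact: continuous_subspaceT.
- have hm : {in `[0, 1] &, {homo phi : s t / s < t}}.
    by move=> x y; rewrite !in_itv /= => x01 y01 xy; apply: mphi => //; lra.
  by apply: leW_mono_in; exact: le_mono_in.
- exact: phi0.
- exact: phi1.
by move=> j t jp; rewrite in_itv /= => t01 h; apply: fphi.
Qed.

End Descriptions.

(** * Combinatorial descriptions and preimages *)

Section DescriptionUnique.
Local Open Scope classical_set_scope.
Local Open Scope ring_scope.
Variables (R : realType) (G : graph) (f : gspace R G -> gspace R G).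

Definition describes_edge (e : 'I_(nedge G)) (p : seq (dart G)) (phi : R -> R) :=
  [/\ {within `[0, 1], continuous phi},
      {in `[0, 1] &, {mono phi : s t / s < t}},
      phi 0 = 0, phi 1 = (size p)%:R
    & forall (j : nat) (t : R), (j < size p)%N -> t \in `[0, 1] ->
        j%:R <= phi t <= j.+1%:R ->
        f (edge_pt e t) = dart_pt (nth (e, false) p j) (phi t - j%:R)].

Lemma describes_edge_bound e p phi : describes_edge e p phi ->
  forall t : R, 0 <= t <= 1 -> [/\ 0 <= phi t, phi t <= (size p)%:R,
    (0 < t -> 0 < phi t) & (t < 1 -> phi t < (size p)%:R)].
Proof.
move=> [_ mphi phi0 phi1 _] t t01; split.
- have [->|tn] := eqVneq t 0; first by rewrite phi0.
  rewrite -phi0 ltW // mphi ?in_itv /=; [|lra|lra].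
  by rewrite lt_neqAle eq_sym tn; lra.
- have [->|tn] := eqVneq t 1; first by rewrite phi1.
  rewrite -phi1 ltW // mphi ?in_itv /=; [|lra|lra].
  by rewrite lt_neqAle tn; lra.
- by move=> t0; rewrite -phi0 mphi ?in_itv //=; lra.
- by move=> t1; rewrite -phi1 mphi ?in_itv //=; lra.
Qed.

(** Together with the padding in [seqline], this makes a finite path a bi-infinite line, to which
    [line_eq_shift] applies. Neither extension has to be a walk. *)
Definition extend (phi : R -> R) (n : nat) (t : R) : R :=
  if t < 0 then t else if t <= 1 then phi t else n%:R + (t - 1).

Lemma extend_homeo e p phi : describes_edge e p phi -> homeoR (extend phi (size p)).
Proof.
move=> hd; have hb := describes_edge_bound hd.
case: hd => [cphi mphi phi0 phi1 _]; set n := size p in phi1 hb *.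
have n0 : 0 <= n%:R :> R by exact: ler0n.
apply: homo_homeoR => [x y xy|y]; last first.
  have [y0|y0] := ltP y 0; first by exists y; rewrite /extend y0.
  have [yn|yn] := leP y n%:R; last first.
    exists (1 + (y - n%:R)); rewrite /extend ltNge (_ : 0 <= _) /=; last by lra.
    by rewrite leNgt (_ : 1 < _) /=; lra.
  have [||t] := @IVT R phi 0 1 y _ cphi; first by [].
    by rewrite phi0 phi1 min_l // max_r // y0.
  rewrite in_itv /= => /andP[t0 t1] ty; exists t.
  by rewrite /extend ltNge t0 /= t1.
rewrite /extend; have [x0|x0] := ltP x 0.
  have [y0//|y0] := ltP y 0.
  have [y1|y1] := leP y 1; last by lra.
  by have [? _ _ _] := hb y ltac:(by rewrite y0); lra.
rewrite (ltNge y 0) (le_trans x0 (ltW xy)) /=.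
have [x1|x1] := leP x 1.
  have [y1|y1] := leP y 1; first by rewrite mphi // in_itv /=; lra.
  by have [_ ? _ _] := hb x ltac:(by rewrite x0); lra.
by rewrite (leNgt y 1) (lt_trans x1 xy) /=; lra.
Qed.

Definition seqline (d : dart G) (p : seq (dart G)) (i : int) : dart G :=
  if i is Posz j then nth d p j else d.

(** The right-hand side mentions neither [p] nor [phi], so two descriptions of the same edge give
    lines that differ by a homeomorphism of the parameter. That homeomorphism fixes 0, hence is the
    identity. *)
Lemma extend_line e p phi : describes_edge e p phi -> forall t : R,
  line (seqline (e, false) p) (extend phi (size p) t) =
  if 0 <= t < 1 then f (edge_pt e t)
  else dart_pt (e, false) (t - (Num.floor t)%:~R).
Proof.
move=> hd t; have hb := describes_edge_bound hd; case: hd => [_ _ phi0 phi1 fphi].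
have [i hi] := floorP t; have fi : Num.floor t = i by apply: floor_def; rewrite intrD.
rewrite fi /extend; have [t0|t0] := ltP t 0.
  rewrite (line_itv _ hi) /=.
  by case: i hi {fi} => // j /andP[h _]; exfalso; move: h; rewrite -pmulrn leNgt (lt_le_trans t0).
have [t1|t1] /= := leP t 1; last first.
  rewrite (ltNge t 1) (ltW t1) /= (@line_itv R G _ ((size p)%:Z + (i - 1))); last first.
    by rewrite intrD intrB; move: hi; rewrite -!pmulrn; lra.
  have i1 : 1 <= i by rewrite -(ltzD1) -(ltr_int R) intrD; lra.
  rewrite (_ : seqline _ _ _ = (e, false)).
    by congr dart_pt; rewrite intrD intrB -!pmulrn; lra.
  case: i i1 {hi fi} => // -[//|j] _; rewrite /= nth_default //.
  by rewrite subn1 leq_addr.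
have [p0 pn h0 h1] := hb t ltac:(by rewrite t0).
have [t1'|t1'] := ltP t 1.
  have {}h1 := h1 t1'; have [j hj] := floorP (phi t).
  have j0 : 0 <= j by rewrite -ltzD1 -(ltr_int R) intrD; lra.
  have jn : j < size p by rewrite -(ltr_int R) -pmulrn; lra.
  rewrite (line_itv _ hj); case: j j0 jn hj => // j _ jn hj /=.
  rewrite (fphi j t) ?in_itv //=; first by rewrite t0.
  by rewrite -addn1 natrD; move: hj; rewrite -!pmulrn; lra.
have tE : t = 1 by lra.
rewrite tE phi1 (_ : (size p)%:R = (size p)%:Z%:~R) // line_int /= nth_default //.
have -> : i = 1.
  by rewrite -fi tE; apply: floor_def; rewrite lexx /=; lra.
by rewrite subrr dart_pt_le0.
Qed.

Lemma describes_edge_unique e p phi p' phi' :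
  describes_edge e p phi -> describes_edge e p' phi' -> p = p'.
Proof.
move=> hd hd'; have hh := extend_homeo hd; have hh' := extend_homeo hd'.
have [g [hg K K']] := homeoR_inv hh'.
have [||q [hq aq]] := @line_eq_shift R G (seqline (e, false) p) (seqline (e, false) p') 
  (extend phi (size p) \o g); first exact: homeoR_comp.
  by move=> x /=; rewrite (extend_line hd) -(extend_line hd') K'.
have E0 : extend phi (size p) 0 = 0 by rewrite /extend ltxx ler01; case: hd.
have E0' : extend phi' (size p') 0 = 0 by rewrite /extend ltxx ler01; case: hd'.
have q0 : q = 0.
  have := hq 0; rewrite /= -{1}E0' K E0 add0r => /esym/eqP.
  by rewrite intr_eq0 => /eqP.
have sz : size p = size p'.
  have := hq (extend phi' (size p') 1); rewrite /= K q0 addr0.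
  rewrite /extend ltNge ler01 /= lexx; case: hd => _ _ _ -> _; case: hd' => _ _ _ -> _.
  by move/eqP; rewrite eqr_nat => /eqP.
apply: (@eq_from_nth _ (e, false)) => // i _.
by have := aq i; rewrite q0 addr0 /= => ->.
Qed.

Lemma describes_code (D D' : description G) : describes D f -> describes D' f ->
  description_code D = description_code D'.
Proof.
move=> [h1 h2] [h1' h2']; rewrite /description_code.
have -> : vimage D = vimage D'.
  by apply/funext => v; have := h1 v; rewrite h1' => -[].
have -> // : eimage D = eimage D'.
apply/funext => e; have [phi hd] := h2 e; have [phi' hd'] := h2' e.
exact: (describes_edge_unique hd hd').
Qed.

Definition descr_size (D : description G) : nat :=
  sumn [seq size (eimage D e) | e <- enum 'I_(nedge G)].

(** Each dart of an image path is traversed monotonically, so it contributes at most one preimage of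
    [x]. *)
Lemma preimage_bound (D : description G) (x : gspace R G) : describes D f ->
  ~~ is_vert x -> exists2 s : seq (gspace R G), (size s <= descr_size D)%N &
    forall y, f y = x -> y \in s.
Proof.
move=> [hv he] nx.
have [phi hphi] := choice he.
have hd e : describes_edge e (eimage D e) (phi e) := hphi e.
pose Q e (j : nat) (y : gspace R G) := exists t, [/\ 0 <= t <= 1, y = edge_pt e t,
  f y = x & j%:R <= phi e t <= j.+1%:R].
pose cand e j := if pselect (exists y, Q e j y) is left h then projT1 (cid h) else Vertex R (src e).
have Qu e j y y' : (j < size (eimage D e))%N -> Q e j y -> Q e j y' -> y = y'.
  move=> js [t [t01 -> fx tj]] [t' [t'01 -> fx' t'j]].
  have [_ mphi _ _ fphi] := hd e.
  have := fphi j t js; rewrite in_itv /= => /(_ t01 tj); rewrite fx => xE.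
  have := fphi j t' js; rewrite in_itv /= => /(_ t'01 t'j); rewrite fx' xE.
  have := nx; rewrite xE is_vert_dart negbK => u01.
  move=> /dart_pt_inj[//|[_ pt]|[/esym/eqP]]; last by rewrite (negbTE (drev_neq _)).
  congr edge_pt; apply/eqP; rewrite eq_le !leNgt; apply/andP; split; apply/negP => tt.
    by have := mphi t' t; rewrite !in_itv /= => /(_ t'01 t01); rewrite tt; lra.
  by have := mphi t t'; rewrite !in_itv /= => /(_ t01 t'01); rewrite tt; lra.
exists (flatten [seq [seq cand e j | j <- iota 0 (size (eimage D e))] | e <- enum 'I_(nedge G)]).
  rewrite size_flatten /shape -map_comp /descr_size.
  by rewrite (eq_map (g := fun e => size (eimage D e))) // => e /=; rewrite size_map size_iota.
move=> y fy; case: (gspaceP y) fy => [v|e t t01] fy.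
  by exfalso; move: nx; rewrite -fy hv.
apply/flatten_mapP; exists e; first by rewrite mem_enum.
have [p0 pn h0 h1] := describes_edge_bound (hd e) (t := t) ltac:(lra).
have {}h1 := h1 ltac:(lra); have [j hj] := floorP (phi e t).
have j0 : 0 <= j by rewrite -ltzD1 -(ltr_int R) intrD; lra.
have jn : j < size (eimage D e) by rewrite -(ltr_int R) -pmulrn; lra.
case: j j0 jn hj => // j _ jn hj.
apply/mapP; exists j; first by rewrite mem_iota /= add0n.
have Qt : Q e j (edge_pt e t).
  exists t; split=> //; first by lra.
  by rewrite -addn1 natrD; move: hj; rewrite -!pmulrn; lra.
rewrite /cand; case: pselect => [h|[]]; last by exists (edge_pt e t).
by apply: (Qu e j) => //; case: cid.
Qed.

(** Vertices map to vertices, so every intermediate image of a preimage of [x] is again an inner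
    point and the one-step bound multiplies. *)
Lemma preimage_iter_bound (D : description G) M (x : gspace R G) : describes D f ->
  ~~ is_vert x -> exists2 s : seq (gspace R G), (size s <= descr_size D ^ M)%N &
    forall y, iter M f y = x -> y \in s.
Proof.
move=> hD; elim: M x => [|M IH] x nx.
  by exists [:: x] => // y /= ->; rewrite inE.
have [s sS hs] := preimage_bound hD nx.
have hI (y : gspace R G) : exists l : seq (gspace R G), ~~ is_vert y ->
    (size l <= descr_size D ^ M)%N /\ forall z, iter M f z = y -> z \in l.
  case vy : (is_vert y); first by exists [::].
  by have [l l1 l2] := IH y ltac:(by rewrite vy); exists l.
have [l hl] := choice hI.
exists (flatten [seq l y | y <- s & ~~ is_vert y]).
  rewrite size_flatten /shape -map_comp expnS.
  apply: leq_trans (leq_mul sS (leqnn _)).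
  elim: s {sS hs} => //= y s; case vy : (is_vert y) => //= h.
    by apply: leq_trans h _; rewrite leq_mul2r leqnSn orbT.
  by rewrite mulSn leq_add // (hl y _).1 // vy.
move=> y /= fy; apply/flatten_mapP; exists (iter M f y).
  rewrite mem_filter hs // andbT; case: hD => hv _.
  apply/negP; case E : (iter M f y) => [v|//] _.
  by move: nx; rewrite -fy E hv.
have := (hl (iter M f y) _).2; apply=> //.
apply/negP; case E : (iter M f y) => [v|//] _.
by case: hD => hv _; move: nx; rewrite -fy E hv.
Qed.

End DescriptionUnique.

(** * Lifts to the universal cover *)

Section Stacks.
Variable G : graph.
Implicit Types (a b : dart G) (w x y : seq (dart G)).

(** Right multiplication of a reduced word by a letter: the head of the list is the last letter of
    the word. *)
Definition push a w := if w is b :: w' then if b == drev a then w' else a :: w else [:: a].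
Definition red := sorted (fun a b : dart G => a != drev b).

Lemma red_tl a w : red (a :: w) -> red w.
Proof. exact: path_sorted. Qed.

Lemma red_push a w : red w -> red (push a w).
Proof.
case: w => [|b w] //= rw; case: eqP => [_|/eqP ba]; first exact: path_sorted rw.
by rewrite /red /= rw andbT; apply: contra ba => /eqP ->; rewrite drevK.
Qed.

Lemma push_rev a w : red w -> push (drev a) (push a w) = w.
Proof.
case: w => [|b w] /=; first by rewrite drevK eqxx.
move=> rw; case: eqP => [bE|/eqP ba] /=; last by rewrite drevK eqxx.
case: w rw => [|c w] /=; first by rewrite bE.
rewrite bE drevK => /andP[bc _]; case: eqP => // ca.
by move: bc; rewrite ca eqxx.
Qed.

Lemma push_revK a w : red w -> push a (push (drev a) w) = w.
Proof. by move=> rw; rewrite -{1}(drevK a) push_rev. Qed.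

(** The product of reduced words in path order: [foldr] starts at the bottom of the stack [y], that
    is, at its first letter. *)
Definition mul x y := foldr push x y.

Lemma red_mul x y : red x -> red (mul x y).
Proof. by move=> rx; elim: y => //= a y; exact: red_push. Qed.

Lemma mul_push x a y : red x -> red y -> mul x (push a y) = push a (mul x y).
Proof.
move=> rx; case: y => [|b y] //= ry; case: eqP => [->|//].
by rewrite push_revK //; exact: red_mul.
Qed.

(** [c] counts the letter pairs that cancel at the junction; in a reduced [y], once a letter has
    survived, all later ones do. *)
Lemma mul_cancel x y : red y -> exists c, [/\ (c <= size x)%N, (c <= size y)%N &
  mul x y = take (size y - c) y ++ drop c x].
Proof.
elim: y => [_|a y IH ry]; first by exists 0%N; rewrite drop0.
have [c [cx cy E]] := IH (red_tl ry); rewrite /= E.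
have [cy'|cy'] := ltnP c (size y).
  exists c; split=> //=; first exact: leqW.
  rewrite subSn //=; case: y ry cy' {IH cy E} => //= b y /andP[ab _].
  rewrite ltnS => cy; rewrite subSn //=.
  case: eqP => // bE; by move: ab; rewrite bE drevK eqxx.
have cE : c = size y by apply/eqP; rewrite eqn_leq cy.
rewrite {1}cE subnn take0 /=; case D : (drop c x) => [|b z].
  exists c; split=> //=; first exact: leqW.
  by rewrite D subSn // cE subnn /= take0.
have cx' : (c < size x)%N by rewrite ltnNge; apply/negP => h; move: D; rewrite drop_oversize.
rewrite /push; case: eqP => [bE|_].
  exists c.+1; split=> //=; rewrite ?cE ?ltnS // subnn /=.
  by rewrite -cE; move: D; rewrite (drop_nth a) // => -[_ ->].
by exists c; split=> //=; [exact: leqW|rewrite D subSn // cE subnn /= take0].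
Qed.

Definition stack := {w : seq (dart G) | red w}.
Definition snil : stack := exist (fun w => is_true (red w)) [::] isT.

Lemma stack_red (x : stack) : red (sval x). Proof. exact: svalP x. Qed.

Definition spush a (x : stack) : stack := exist _ (push a (sval x)) (red_push a (stack_red x)).

Lemma spush_bij a : bijective (spush a).
Proof.
by exists (spush (drev a)) => -[w rw]; apply: val_inj; rewrite /= ?push_rev ?push_revK.
Qed.
End Stacks.

Lemma cont_pair (T U V : topologicalType) (f : T -> U) (g : T -> V) (t : T) :
  {for t, continuous f}%classic -> {for t, continuous g}%classic ->
  {for t, continuous (fun x => (f x, g x))}%classic.
Proof.
move=> cf cg O [[A B] /= [nA nB] AB].
have h1 : (\forall s \near t, A (f s))%classic by exact: cf nA.
have h2 : (\forall s \near t, B (g s))%classic by exact: cg nB.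
suff : (\forall s \near t, O (f s, g s))%classic by [].
by near=> s; apply: (AB (f s, g s)); split; near: s.
Unshelve. all: by end_near. Qed.

Section Lifts.
Local Open Scope classical_set_scope.
Local Open Scope ring_scope.
Variables (R : realType) (G : graph).
Implicit Types (p q : gspace R G) (x y : stack G).

(* A lift of [H] to the universal cover assigns to [z] the reduced path, read
   as a stack with its last dart on top, from the base point to [H z] if
   [H z] is a vertex, and to the source of the edge containing [H z] otherwise. *)
Definition tr p q x : stack G :=
  if p is Vertex _ then
    if q is Inner e t _ then if t < 1/2 then x else spush (e, true) x else x
  else x.

Lemma tr_id p x : tr p p x = x. Proof. by case: p. Qed.

Lemma tr_bij p q : bijective (tr p q).
Proof.
rewrite /tr; case: p => [v|e t t01]; last by exists id.
case: q => [w|e t t01]; first by exists id.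
by case: (t < 1/2); [exists id|exact: spush_bij].
Qed.

Lemma nbhs_edge_open e (t l u : R) : 0 < t < 1 -> l < t < u ->
  nbhs (edge_pt e t : gspace R G)
    [set q | exists s, [/\ 0 < s < 1, l < s < u & q = edge_pt e s]].
Proof.
move=> t01 /andP[lt tu]; apply: nbhs_edge => //.
have h1 : \forall u' \near t, 0 < u' by apply: lt_nbhsr; lra.
have h2 : \forall u' \near t, u' < 1 by apply: lt_nbhsl; lra.
have h3 : \forall u' \near t, l < u' by apply: lt_nbhsr.
have h4 : \forall u' \near t, u' < u by apply: lt_nbhsl.
by near=> s; exists s; split=> //; apply/andP; split; near: s.
Unshelve. all: by end_near. Qed.

(** A cocycle condition: transport from [p] agrees with transport from any nearby [p1]. It makes the
    formula around one point a lift at all nearby points ([local_lift]). *)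
Lemma tr_coc p : \forall p1 \near p, \forall q \near p1,
  forall x, tr p q x = tr p1 q (tr p p1 x).
Proof.
case: (gspaceP p) => [v|e t t01].
  have := @nbhs_star R G v (1/2) ltac:(lra); apply: filterS => p1.
  case=> [->|[b [w [_ w12 ->]]]]; first by near=> q => x; rewrite tr_id.
  have [e [t [t01 -> t12]]] : exists e t, [/\ 0 < t < 1, dart_pt b w = edge_pt e t :> gspace R G &
      (t < 1/2) \/ (1/2 < t)].
    case: (b) => e [].
      by exists e, (1 - w); split=> //; [lra|right; lra].
    by exists e, w; split=> //; [lra|left; lra].
  case: t12 => t12.
    have := nbhs_edge_open e t01 (l := 0) (u := 1/2) ltac:(lra); apply: filterS.
    move=> q [s [s01 s12 ->]] x; rewrite !edge_ptE /=.
    by rewrite t12; case/andP: s12 => _ ->.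
  have := nbhs_edge_open e t01 (l := 1/2) (u := 1) ltac:(lra); apply: filterS.
  move=> q [s [s01 s12 ->]] x; rewrite !edge_ptE /=.
  by case/andP: s12 => s12 _; rewrite (ltNge t) (ltW t12) (ltNge s) (ltW s12).
have := nbhs_edge_open e t01 (l := 0) (u := 1) ltac:(lra); apply: filterS.
move=> p1 [s [s01 _ ->]].
by near=> q => x; rewrite !edge_ptE.
Unshelve. all: by end_near. Qed.

(** The fibers of the universal cover are discrete, so continuity of a lift means that its value at
    [z0] determines it nearby, through [tr]. *)
Definition is_liftat (T : topologicalType) (H : T -> gspace R G) (lam : T -> stack G) (z0 : T) :=
  \forall z \near z0, lam z = tr (H z0) (H z) (lam z0).

Lemma liftat_ext (T : topologicalType) (H : T -> gspace R G) (lam mu : T -> stack G) (z0 : T) :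
  (\forall z \near z0, mu z = lam z) -> is_liftat H lam z0 -> is_liftat H mu z0.
Proof.
move=> h l; have h0 := nbhs_singleton h; rewrite /is_liftat h0.
near=> z; have -> : mu z = lam z by near: z.
by near: z.
Unshelve. all: by end_near. Qed.

Lemma liftat_comp (T T' : topologicalType) (k : T' -> T) (H : T -> gspace R G) (lam : T -> stack G) (z0 : T') :
  {for z0, continuous k} -> is_liftat H lam (k z0) -> is_liftat (H \o k) (lam \o k) z0.
Proof. by move=> ck h; exact: ck _ h. Qed.

Lemma local_lift (T : topologicalType) (H : T -> gspace R G) (z0 : T) : continuous H ->
  \forall z1 \near z0, forall x, is_liftat H (fun z => tr (H z0) (H z) x) z1.
Proof.
move=> cH.
have h0 : \forall z1 \near z0, \forall q \near H z1,
    forall x, tr (H z0) q x = tr (H z1) q (tr (H z0) (H z1) x) := cH z0 _ (tr_coc (H z0)).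
apply: filterS h0 => z1 h x.
have h1 : \forall z \near z1, forall x, tr (H z0) (H z) x =
  tr (H z1) (H z) (tr (H z0) (H z1) x) := cH z1 _ h.
by apply: filterS h1 => z ->.
Qed.

Lemma liftat_near (T : topologicalType) (H : T -> gspace R G) (lam : T -> stack G) (z0 : T) :
  continuous H -> is_liftat H lam z0 -> \forall z1 \near z0, is_liftat H lam z1.
Proof.
move=> cH l; have h1 := local_lift z0 cH; have h2 := near_join l.
near=> z1; apply: (@liftat_ext _ _ (fun z => tr (H z0) (H z) (lam z0))); first by near: z1.
by have h : forall x, is_liftat H (fun z => tr (H z0) (H z) x) z1 by near: z1.
Unshelve. all: by end_near. Qed.

Lemma liftat_unique (T : topologicalType) (C : set T) (H : T -> gspace R G) (lam mu : T -> stack G) (z0 : T) :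
  connected C -> C z0 -> (forall z : T, C z -> is_liftat H lam z) ->
  (forall z : T, C z -> is_liftat H mu z) -> lam z0 = mu z0 -> forall z : T, C z -> lam z = mu z.
Proof.
move=> cC C0 ll lm e0; apply: (connected_ind cC C0 e0) => t Ct.
have h1 := ll t Ct; have h2 := lm t Ct; near=> s => _.
have -> : lam s = tr (H t) (H s) (lam t) by near: s.
have -> : mu s = tr (H t) (H s) (mu t) by near: s.
by split=> [|->//]; exact: (bij_inj (tr_bij _ _)).
Unshelve. all: by end_near. Qed.

Lemma lift_forward (H : R -> gspace R G) (x0 : stack G) (b : R) : continuous H -> 0 <= b ->
  exists lam, lam 0 = x0 /\ forall t, 0 <= t <= b -> is_liftat H lam t.
Proof.
move=> cH b0; pose P b := exists lam, lam 0 = x0 /\ forall t, 0 <= t <= b -> is_liftat H lam t.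
apply: (@real_ind R 0 b P); last by rewrite b0 lexx.
- exists (fun z => tr (H 0) (H z) x0); split; first exact: tr_id.
  move=> t t0; have -> : t = 0 by lra.
  by near=> z; rewrite tr_id.
- move=> t tb [lam [l0 hl]].
  have := liftat_near cH (hl t ltac:(lra)) => /nbhs_ballP[e /= e0 he].
  exists e => // s ts sb; exists lam; split=> // u us.
  have [ut|ut] := leP u t; first by apply: hl; lra.
  by apply: he; rewrite /ball /= ltr_norml; lra.
- move=> t t0b hs; have /nbhs_ballP[e /= e0 he] := local_lift t cH.
  pose s := Num.max (t - e / 2) 0.
  have [s1 s2 s3] : [/\ 0 <= s, t - e < s & s < t].
    by rewrite /s; case: (leP (t - e / 2) 0) => h; split; lra.
  have [lam [l0 hl]] := hs s ltac:(lra).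
  (* Inverting the transport selects the local lift around [t] that agrees with [lam] at [s]. *)
  have [g gK Kg] := tr_bij (H t) (H s).
  pose x := g (lam s); pose mu z := tr (H t) (H z) x.
  have hmu u : s <= u <= t -> is_liftat H mu u.
    by move=> su; apply: he; rewrite /ball /= ltr_norml; lra.
  have mus : mu s = lam s by rewrite /mu /x Kg.
  exists (fun z => if z <= s then lam z else mu z); split; first by rewrite s1.
  move=> u ut; case: (ltgtP u s) => [us|us|->].
  + apply: (@liftat_ext _ _ lam); last by apply: hl; lra.
    by near=> z; rewrite ifT //; apply: ltW; near: z; exact: lt_nbhsl.
  + apply: (@liftat_ext _ _ mu); last by apply: hmu; lra.
    by near=> z; rewrite ifF //; apply/negbTE; rewrite -ltNge; near: z; exact: lt_nbhsr.
  + have h1 := hl s ltac:(lra); have h2 := hmu s ltac:(lra).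
    rewrite /is_liftat lexx; near=> z; case: ifP => _; first by near: z.
    by rewrite -mus; near: z.
Unshelve. all: by end_near. Qed.

Lemma lift_two_sided (H : R -> gspace R G) (x0 : stack G) (b : R) : continuous H -> 0 <= b ->
  exists lam, lam 0 = x0 /\ forall t, - b <= t <= b -> is_liftat H lam t.
Proof.
move=> cH b0; have [l1 [l10 hl1]] := lift_forward x0 cH b0.
have cN : continuous (fun t : R => - t) by move=> t; exact: opp_continuous.
have cHN : continuous (H \o -%R).
  by move=> t; apply: continuous_comp; [exact: cN|exact: cH].
have [l2 [l20 hl2]] := lift_forward x0 cHN b0.
have hl2' t : - b <= t <= 0 -> is_liftat H (fun z => l2 (- z)) t.
  move=> tb; have := hl2 (- t) ltac:(lra) => /(@liftat_comp _ _ _ _ _ t (cN t)).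
  by rewrite (_ : (_ \o _) \o _ = H) //; apply/funext => z /=; rewrite opprK.
exists (fun z => if 0 <= z then l1 z else l2 (- z)); split; first by rewrite lexx.
move=> t tb; case: (ltgtP t 0) => [t0|t0|->].
- apply: (@liftat_ext _ _ (fun z => l2 (- z))); last by apply: hl2'; lra.
  by near=> z; rewrite ifF //; apply/negbTE; rewrite -ltNge; near: z; exact: lt_nbhsl.
- apply: (@liftat_ext _ _ l1); last by apply: hl1; lra.
  by near=> z; rewrite ifT //; apply: ltW; near: z; exact: lt_nbhsr.
have h1 := hl1 0 ltac:(lra); have h2 := hl2' 0 ltac:(lra).
rewrite /is_liftat oppr0 in h2.
rewrite /is_liftat lexx; near=> z; case: ifP => _; first by near: z.
by rewrite l10 -l20; near: z.
Unshelve. all: by end_near. Qed.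

Lemma lift_line (H : R -> gspace R G) (x0 : stack G) : continuous H ->
  exists lam, lam 0 = x0 /\ forall t, is_liftat H lam t.
Proof.
move=> cH; have hb (b : R) : exists lam, 0 <= b -> lam 0 = x0 /\ forall t, - b <= t <= b -> is_liftat H lam t.
  have [b0|b0] := leP 0 b; last by exists (fun=> x0).
  by have [lam hl] := lift_two_sided x0 cH b0; exists lam.
have [L hL] := choice hb.
have agree (b b' t : R) : 0 <= b -> b <= b' -> - b <= t <= b -> L b t = L b' t.
  move=> b0 bb tb; have [L0 hL1] := hL b b0; have [L0' hL1'] := hL b' (le_trans b0 bb).
  apply: (@liftat_unique _ [set` `[(- b), b]] H (L b) (L b') 0).
  - by apply/connected_intervalP; exact: interval_is_interval.
  - by rewrite /= in_itv /=; lra.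
  - by move=> z; rewrite /= in_itv /= => zb; apply: hL1.
  - by move=> z; rewrite /= in_itv /= => zb; apply: hL1'; lra.
  - by rewrite L0 L0'.
  - by rewrite /= in_itv.
have nle (t : R) : - `|t| <= t <= `|t| by rewrite -ler_norml.
exists (fun t => L (`|t| + 1) t); split.
  by rewrite normr0 add0r; have [] := hL 1 ltac:(lra).
move=> t; apply: (@liftat_ext _ _ (L (`|t| + 2))); last first.
  have t0 := normr_ge0 t; have := nle t.
  by have [_ h] := hL (`|t| + 2) ltac:(lra); move=> ?; apply: h; lra.
have : \forall s \near t, `|s| < `|t| + 1.
  have c : {for t, continuous (fun s : R => `|s|)} by exact: norm_continuous.
  by apply: (c [set y | y < `|t| + 1]); apply: lt_nbhsl; rewrite ltrDl.
apply: filterS => s st; have s0 := normr_ge0 s; have := nle s => ns.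
by apply: agree; lra.
Qed.

(** Homotopy lifting: lift along the axis [t = 0], then along each line [u = const] from the value
    found there. What remains is that these lifts fit together across the lines. *)
Lemma lift_plane (H : R * R -> gspace R G) (x0 : stack G) : continuous H ->
  exists lam, lam (0, 0) = x0 /\ forall z, is_liftat H lam z.
Proof.
move=> cH.
have c1 (t : R) : continuous (fun u : R => (u, t)).
  by move=> u; apply: cont_pair; [exact: cvg_id|exact: cvg_cst].
have c2 (u : R) : continuous (fun t : R => (u, t)).
  by move=> t; apply: cont_pair; [exact: cvg_cst|exact: cvg_id].
have cH1 t : continuous (H \o (fun u : R => (u, t))).
  by move=> u; apply: continuous_comp; [exact: c1|exact: cH].
have cH2 u : continuous (H \o (fun t : R => (u, t))).
  by move=> t; apply: continuous_comp; [exact: c2|exact: cH].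
have [nu [nu0 hnu]] := lift_line x0 (cH1 0).
have hl u : exists lam, lam 0 = nu u /\ forall t, is_liftat (H \o (fun t : R => (u, t))) lam t.
  exact: lift_line.
have [l hl'] := choice hl.
pose lam (z : R * R) := l z.1 z.2.
exists lam; split; first by rewrite /lam /= (hl' 0).1.
move=> [u0 t0].
(* The agreement of [lam] with a local lift propagates along the lines [u = const]. *)
have chart (ts : R) : exists2 e, 0 < e & forall (t' t'' : R) x, ts - e < t' < ts + e -> ts - e < t'' < ts + e ->
    is_liftat H (fun z => tr (H (u0, ts)) (H z) x) (u0, t') /\
    ((\forall u \near u0, lam (u, t') = tr (H (u0, ts)) (H (u, t')) x) ->
    is_liftat H lam (u0, t'')).
  have [[A B] /= [nA nB] AB] := local_lift (u0, ts) cH.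
  have [e /= e0 he] := (iffLR (nbhs_ballP _ _)) nB.
  exists e => // t' t'' x t't t''t.
  pose g z := tr (H (u0, ts)) (H z) x.
  have Bt (t : R) : ts - e < t < ts + e -> B t.
    by move=> tt; apply: he; rewrite /ball /= ltr_norml; lra.
  split; first by apply: (AB (u0, t')); split=> /=; [exact: nbhs_singleton|exact: Bt].
  move=> hx; apply: (@liftat_ext _ _ g); last first.
    by apply: (AB (u0, t'')); split=> /=; [exact: nbhs_singleton|exact: Bt].
  exists ([set u | A u /\ lam (u, t') = g (u, t')], [set t | ts - e < t < ts + e]) => /=.
    split; first exact: filterI.
    have h1 : \forall t \near t'', ts - e < t by apply: lt_nbhsr; lra.
    have h2 : \forall t \near t'', t < ts + e by apply: lt_nbhsl; lra.
    by near=> t; apply/andP; split; near: t.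
  move=> [u t] /= [[Au lg] tt].
  apply: (@liftat_unique _ [set` `](ts - e), (ts + e)[] (H \o (fun t : R => (u, t))) (fun t => lam (u, t)) (fun t => g (u, t)) t').
  - by apply/connected_intervalP; exact: interval_is_interval.
  - by rewrite /= in_itv.
  - by move=> z _; apply: (hl' u).2.
  - move=> z; rewrite /= in_itv /= => zt.
    by apply: (@liftat_comp _ _ (fun t : R => (u, t)) H g); [exact: c2|apply: (AB (u, z)); split=> //=; exact: Bt].
  - exact: lg.
  - by rewrite /= in_itv.
suff : forall t, is_liftat H lam (u0, t) by [].
apply: (@connectedT_ind _ _ (0 : R)); first exact: connectedR.
  have [e e0 he] := chart 0; apply: (he 0 0 (nu u0) _ _).2; [lra|lra|].
  by have := hnu u0; apply: filterS => u; rewrite /= /lam /= (hl' u).1.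
move=> ts; have [e e0 he] := chart ts; apply/nbhs_ballP; exists e => // s.
rewrite /ball /= ltr_norml => se.
have key (t' t'' : R) : ts - e < t' < ts + e -> ts - e < t'' < ts + e ->
    is_liftat H lam (u0, t') -> is_liftat H lam (u0, t'').
  move=> h1 h2 lt; have [g gK Kg] := tr_bij (H (u0, ts)) (H (u0, t')).
  have lg : is_liftat H (fun z => tr (H (u0, ts)) (H z) (g (lam (u0, t')))) (u0, t').
    by have [] := he t' t'' (g (lam (u0, t'))) h1 h2.
  apply: (he t' t'' (g (lam (u0, t'))) h1 h2).2.
  have h3 := liftat_comp (c1 t' u0) lt; have h4 := liftat_comp (c1 t' u0) lg.
  near=> u.
  have -> : lam (u, t') = tr (H (u0, t')) (H (u, t')) (lam (u0, t')) by near: u.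
  by rewrite -{1}(Kg (lam (u0, t'))); apply/esym; near: u.
by split; apply: key; lra.
Unshelve. all: by end_near. Qed.

End Lifts.

(** * Free homotopies *)

Section Homotopy.
Local Open Scope classical_set_scope.
Local Open Scope ring_scope.
Variable R : realType.

Lemma cont_fst_snd (T U : topologicalType) (z : T * U) :
  {for z, continuous (@fst T U)} /\ {for z, continuous (@snd T U)}.
Proof. by split; [exact: cvg_fst|exact: cvg_snd]. Qed.

Variable X : topologicalType.
Implicit Types (s : R -> X).

Lemma cont_affine (a b : R) : continuous (fun u : R => a * u + b).
Proof.
by move=> u; apply: cvgD; [apply: cvgM; [exact: cvg_cst|exact: cvg_id]|exact: cvg_cst].
Qed.

Lemma cont_left (h : R -> R) (H : R * R -> X) : continuous h -> continuous H ->
  continuous (fun z => H (h z.1, z.2)).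
Proof.
move=> ch cH z; apply: (@continuous_comp _ _ _ (fun z : R * R => (h z.1, z.2)) H); last exact: cH.
have [c1 c2] := cont_fst_snd z.
by apply: cont_pair => //; apply: continuous_comp; [exact: c1|exact: ch].
Qed.

Lemma freely_homotopic_sym s s' : freely_homotopic s s' -> freely_homotopic s' s.
Proof.
move=> [H [cH pH H0 H1]]; exists (fun z => H (-1 * z.1 + 1, z.2)); split.
- exact: (@cont_left (fun u => -1 * u + 1) H (@cont_affine (-1) 1) cH).
- by move=> u t /=; rewrite pH.
- by move=> t /=; rewrite mulr0 add0r.
- by move=> t /=; rewrite mulr1 addNr.
Qed.

Lemma freely_homotopic_trans s s' s'' : freely_homotopic s s' -> freely_homotopic s' s'' ->
  freely_homotopic s s''.
Proof.
move=> [H [cH pH H0 H1]] [K [cK pK K0 K1]].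
exists (fun z => if z.1 <= 1/2 then H (2 * z.1 + 0, z.2) else K (2 * z.1 + (-1), z.2)).
have cH' := cont_left (@cont_affine 2 0) cH; have cK' := cont_left (@cont_affine 2 (-1)) cK.
split.
- move=> [u t]; have [c1 _] := @cont_fst_snd R R (u, t).
  case: (ltgtP u (1/2)) => [ut|ut|ut].
  + apply: (cont_near (cH' _)).
    have h : \forall z \near (u, t), z.1 < 1/2 := c1 _ (lt_nbhsl ut).
    by apply: filterS h => -[v w] /= vt; rewrite (ltW vt).
  + apply: (cont_near (cK' _)).
    have h : \forall z \near (u, t), 1/2 < z.1 := c1 _ (lt_nbhsr ut).
    by apply: filterS h => -[v w] /= vt; rewrite leNgt vt.
  + apply: (cont_paste (cH' _) (cK' _)); first by rewrite /= ut lexx.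
      by rewrite /= ut lexx (_ : 2 * (1/2) + -1 = 0); [|lra]; rewrite (_ : 2 * (1/2) + 0 = 1); [rewrite K0 H1|lra].
    by near=> z; case: ifP => _; [left|right].
- by move=> u t /=; rewrite pH pK.
- by move=> t /=; rewrite ifT ?mulr0 ?addr0 //; lra.
- move=> t /=; have -> : (1 <= 1 / 2 :> R) = false by apply/negbTE; rewrite -ltNge; lra.
  by have -> : 2 * 1 + -1 = 1 :> R by lra.
Unshelve. all: by end_near. Qed.

Lemma loop_nat s (d : nat) t : (forall t, s (t + 1) = s t) -> s (t + d%:R) = s t.
Proof.
by move=> ps; elim: d t => [|d IH] t; rewrite ?addr0 // -natr1 addrA ps.
Qed.

(** The parameters [chi] and [d * t] both advance by [d] over a period, and so do their linear
    interpolations. *)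
Lemma reparam_homotopic s (chi : R -> R) (d : nat) : is_loop s -> continuous chi ->
  (forall t, chi (t + 1) = chi t + d%:R) -> freely_homotopic (s \o chi) (loop_power s d).
Proof.
move=> [cs ps] cchi pchi.
exists (fun z => s ((1 - z.1) * chi z.2 + z.1 * (d%:R * z.2))); split.
- move=> z; apply: (@continuous_comp _ _ _ (fun z : R * R => (1 - z.1) * chi z.2 + z.1 * (d%:R * z.2)) s); last exact: cs.
  have [c1 c2] := @cont_fst_snd R R z.
  apply: cvgD; apply: cvgM.
  + by apply: cvgB; [exact: cvg_cst|exact: c1].
  + by apply: continuous_comp; [exact: c2|exact: cchi].
  + exact: c1.
  + by apply: cvgM; [exact: cvg_cst|exact: c2].
- move=> u t /=; rewrite -[RHS](loop_nat d _ ps); congr s; rewrite pchi; ring.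
- by move=> t /=; rewrite subr0 mul1r mul0r addr0.
- by move=> t /=; rewrite subrr mul0r add0r mul1r.
Qed.

Lemma freely_homotopic_power s s' d : freely_homotopic s s' ->
  freely_homotopic (loop_power s d) (loop_power s' d).
Proof.
move=> [H [cH pH H0 H1]]; exists (fun z => H (z.1, d%:R * z.2)); split.
- move=> z; apply: (@continuous_comp _ _ _ (fun z : R * R => (z.1, d%:R * z.2)) H); last exact: cH.
  have [c1 c2] := @cont_fst_snd R R z.
  by apply: cont_pair => //; apply: cvgM; [exact: cvg_cst|exact: c2].
- by move=> u t /=; rewrite mulrDr mulr1; apply: (@loop_nat (fun t => H (u, t))) => t'; exact: pH.
- by move=> t /=; rewrite H0.
- by move=> t /=; rewrite H1.
Qed.

Lemma freely_homotopic_comp (Y : topologicalType) (f : X -> Y) s s' : continuous f ->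
  freely_homotopic s s' -> freely_homotopic (f \o s) (f \o s').
Proof.
move=> cf [H [cH pH H0 H1]]; exists (f \o H); split.
- by move=> z; apply: continuous_comp; [exact: cH|exact: cf].
- by move=> u t /=; rewrite pH.
- by move=> t /=; rewrite H0.
- by move=> t /=; rewrite H1.
Qed.

Lemma null_homotopic_trans s s' : freely_homotopic s s' -> null_homotopic s' -> null_homotopic s.
Proof. by move=> h [x h']; exists x; exact: freely_homotopic_trans h h'. Qed.

End Homotopy.

(** * Words spelled by lifts of lines and of homotopies *)

Section LiftLine.
Local Open Scope classical_set_scope.
Local Open Scope ring_scope.
Variables (R : realType) (G : graph).
Implicit Types (a b : int -> dart G).

(** [lam] is constant inside the edge. Comparing this constant with the values at both ends through
    [tr], exactly one of the two comparisons pushes a dart. *)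
Lemma lift_dart (P : R -> gspace R G) (lam : R -> stack G) (c : dart G) (t0 t1 dl : R) :
  0 < dl -> t1 = t0 + dl -> (forall t, is_liftat P lam t) ->
  (forall x, 0 <= x <= 1 -> P (t0 + dl * x) = dart_pt c x) -> lam t1 = spush c (lam t0).
Proof.
move=> dl0 -> hl hP.
have Pt t : t0 < t < t0 + dl -> exists x, [/\ 0 < x < 1, t = t0 + dl * x & P t = dart_pt c x].
  move=> tt; have x01 : 0 < (t - t0) / dl < 1.
    apply/andP; split; first by apply: divr_gt0 => //; lra.
    by rewrite ltr_pdivrMr // mul1r; lra.
  have tE : t = t0 + dl * ((t - t0) / dl) by rewrite mulrC divfK ?gt_eqF //; lra.
  by exists ((t - t0) / dl); split=> //; rewrite {1}tE hP //; lra.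
pose m := t0 + dl * (1/2).
have cst t : t0 < t < t0 + dl -> lam t = lam m.
  move=> tt; apply: (@connected_ind _ [set` `]t0, (t0 + dl)[] (fun t => lam t = lam m) m).
  - by apply/connected_intervalP; exact: interval_is_interval.
  - by rewrite /= in_itv /= /m; lra.
  - by [].
  - move=> u; rewrite /= in_itv /= => ut; have [x [x01 _ Pu]] := Pt u ut.
    have := hl u; apply: filterS => z -> _; rewrite Pu.
    have := is_vert_dart (R := R) c x; rewrite x01.
    by case: (dart_pt c x).
  - by rewrite /= in_itv.
have P0 : P t0 = Vertex R (dsrc c).
  by have := hP 0; rewrite mulr0 addr0 dart_pt_le0 //; apply; lra.
have P1 : P (t0 + dl) = Vertex R (dtgt c).
  by have := hP 1; rewrite mulr1 dart_pt_ge1 //; apply; lra.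
have [z0 z0t [z0m l0]] : exists2 z, t0 < z & z < m /\ lam z = tr (P t0) (P z) (lam t0).
  apply: near_right_ex; apply: filterI; last exact: hl.
  by apply: lt_nbhsl; rewrite /m; lra.
have [z1 z1t [z1m l1]] : exists2 z, z < t0 + dl & m < z /\ lam z = tr (P (t0 + dl)) (P z) (lam (t0 + dl)).
  apply: near_left_ex; apply: filterI; last exact: hl.
  by apply: lt_nbhsr; rewrite /m; lra.
have z0i : t0 < z0 < t0 + dl by rewrite /m in z0m; lra.
have z1i : t0 < z1 < t0 + dl by rewrite /m in z1m; lra.
move: l0 l1; rewrite (cst z0) // (cst z1) //.
have [x [x01 zx ->]] := Pt z0 z0i.
have [y [y01 zy ->]] := Pt z1 z1i.
have x12 : x < 1/2 by move: z0m; rewrite zx /m ltrD2l ltr_pM2l.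
have y12 : 1/2 < y by move: z1m; rewrite zy /m ltrD2l ltr_pM2l.
rewrite P0 P1 /dart_pt; case: c {P0 P1 hP Pt} => e [] /=.
  have x01' : 0 < 1 - x < 1 by lra.
  have y01' : 0 < 1 - y < 1 by lra.
  rewrite !edge_ptE /= ifF; last by apply/negbTE; rewrite -leNgt; lra.
  by rewrite ifT; [move=> -> ->|lra].
rewrite !edge_ptE /= x12 ifF; last by apply/negbTE; rewrite -leNgt; lra.
move=> -> ->; apply: val_inj; rewrite /= (@push_revK _ (e, false)) //; exact: stack_red.
Qed.

Fixpoint wd a (k : nat) : seq (dart G) := if k is k'.+1 then a k' :: wd a k' else [::].

Lemma size_wd a k : size (wd a k) = k. Proof. by elim: k => //= k ->. Qed.

Lemma red_wd a k : reducedw a -> red (wd a k).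
Proof.
move=> ra; elim: k => //= -[|k] //= IH; rewrite /red /= in IH *; rewrite IH andbT.
by apply/eqP; rewrite -addn1 PoszD; exact: ra.
Qed.

Lemma drop_wd a k c : drop c (wd a k) = wd a (k - c).
Proof. by elim: k c => [|k IH] [|c] //=; rewrite IH subSS. Qed.

Lemma nth_wd d a k i : (i < k)%N -> nth d (wd a k) i = a (k - i.+1)%N.
Proof. by elim: k i => // k IH [|i] ik /=; [rewrite subn1|rewrite IH // subSS]. Qed.

Lemma lift_walk a (c : R) (lam : R -> stack G) : walk a -> 0 < c ->
  (forall t, is_liftat (fun t => line a (c * t)) lam t) ->
  forall k : nat, sval (lam (k%:R / c)) = mul (sval (lam 0)) (wd a k).
Proof.
move=> wa c0 hl; elim=> [|k IH]; first by rewrite mul0r.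
rewrite (@lift_dart _ _ (a k) (k%:R / c) _ c^-1 _ _ hl) /= ?invr_gt0 ?IH //.
  by rewrite -natr1 mulrDl mul1r.
move=> x x01; rewrite (@line_itvc R G a k) //.
  by congr dart_pt; rewrite mulrDr mulrCA mulfV ?gt_eqF // mulr1 mulrA mulfV ?gt_eqF // mul1r -pmulrn; lra.
rewrite mulrDr mulrCA mulfV ?gt_eqF // mulr1 mulrA mulfV ?gt_eqF // mul1r -pmulrn; lra.
Qed.

Definition smul (x y : stack G) : stack G := exist _ (mul (sval x) (sval y)) (red_mul _ (stack_red x)).

(** Left multiplications are the deck transformations: they commute with pushes, which act on the
    right. *)
Lemma tr_smul x p q (y : stack G) : tr p q (smul x y) = smul x (tr (R := R) p q y).
Proof.
rewrite /tr; case: p => // v; case: q => // e t t01; case: ifP => // _.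
by apply: val_inj; rewrite /= mul_push //; exact: stack_red.
Qed.

Lemma lift_smul (P : R -> gspace R G) lam x t : is_liftat P lam t ->
  is_liftat P (fun t => smul x (lam t)) t.
Proof. by apply: filterS => z ->; rewrite tr_smul. Qed.

Lemma mul_nil (x : seq (dart G)) : red x -> mul [::] x = x.
Proof.
elim: x => //= a x IH rx; rewrite IH; last exact: red_tl rx.
by case: x rx {IH} => //= b x /andP[ab _]; case: eqP => // bE; move: ab; rewrite bE drevK eqxx.
Qed.

(* The lift along the bottom side of the homotopy spells [b], the lift along the
   top side spells [a], and the two vertical sides at integer times are the same
   path lifted from two different points of the fiber. *)
Lemma homotopy_words b (p : nat) (s : R -> gspace R G) : walk b -> reducedw b -> (0 < p)%N ->
  freely_homotopic (fun t : R => line b (p%:R * t)) s -> exists (eta : stack G) (mu : R -> stack G),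
  [/\ mu 0 = eta, forall t, is_liftat s mu t &
    forall m : nat, sval (mu m%:R) = mul (wd b (m * p)) (sval eta)].
Proof.
move=> wb rb p0 [H [cH pH H0 H1]].
have p0' : 0 < p%:R :> R by rewrite ltr0n.
have [lam [l0 hl]] := lift_plane (snil G) cH.
have c1 (t : R) : continuous (fun u : R => (u, t)).
  by move=> u; apply: cont_pair; [exact: cvg_id|exact: cvg_cst].
have c2 (u : R) : continuous (fun t : R => (u, t)).
  by move=> t; apply: cont_pair; [exact: cvg_cst|exact: cvg_id].
have hlu (t u : R) : is_liftat (fun u : R => H (u, t)) (fun u => lam (u, t)) u.
  exact: (liftat_comp (c1 t u) (hl (u, t))).
have hlt (u t : R) : is_liftat (fun t : R => H (u, t)) (fun t => lam (u, t)) t.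
  exact: (liftat_comp (c2 u t) (hl (u, t))).
have HE0 : (fun t => H (0, t)) = (fun t => line b (p%:R * t)) by apply/funext.
have HE1 : (fun t => H (1, t)) = s by apply/funext.
exists (lam (1, 0)), (fun t => lam (1, t)); split=> //; first by rewrite -HE1.
move=> m.
have lm : sval (lam (0, m%:R)) = wd b (m * p).
  have := hlt 0; rewrite HE0 => /(lift_walk wb p0' (lam := fun t => lam (0, t))) /(_ (m * p)%N).
  by rewrite l0 /= natrM mulfK ?gt_eqF // mul_nil //; exact: red_wd.
have -> : lam (1, m%:R) = smul (lam (0, m%:R)) (lam (1, 0)).
  have HEm : (fun u => H (u, m%:R)) = (fun u => H (u, 0)).
    by apply/funext => u; rewrite -[in LHS](add0r m%:R) (@loop_nat R _ (fun t => H (u, t))).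
  apply: (@liftat_unique R G R setT (fun u => H (u, 0)) (fun u => lam (u, m%:R))
     (fun u => smul (lam (0, m%:R)) (lam (u, 0))) 0) => //.
  - exact: connectedR.
  - by move=> u _; rewrite -HEm.
  - by move=> u _; apply: lift_smul.
  - by rewrite l0; exact: val_inj.
by rewrite /= lm.
Qed.

End LiftLine.

(** * Uniqueness of tight loops in a free homotopy class *)

Section LoopWords.
Local Open Scope classical_set_scope.
Local Open Scope ring_scope.
Variables (R : realType) (G : graph).
Implicit Types (a b : int -> dart G).

Lemma size_mul (x y : seq (dart G)) : red y -> exists c : nat,
  [/\ (c <= size x)%N, (c <= size y)%N & size (mul x y) = (size y - c + (size x - c))%N].
Proof.
move=> ry; have [c [cx cy ->]] := mul_cancel x ry; exists c; split=> //.
by rewrite size_cat size_drop size_take_min (minn_idPl _) // leq_subr.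
Qed.

(** At most [size eta] letters cancel in each product, however large [m] is. Comparing lengths for
    large [m] gives [p = q]; then a full period of [a] survives inside a stretch of [b]. *)
Lemma conjugate_words a b (p q : nat) (eta : seq (dart G)) :
  reducedw a -> reducedw b -> red eta -> (0 < p)%N -> (0 < q)%N -> per b p -> per a q ->
  (forall m : nat, mul (wd b (m * p)) eta = mul eta (wd a (m * q))) ->
  p = q /\ exists dl, forall i, a i = b (i + dl).
Proof.
(* [m] exceeds [2 * n], the largest discrepancy of the lengths due to cancellation, and [m * p]
   leaves room for a complete period. *)
move=> ra rb re p0 q0 pb pa hm; pose n := size eta; pose m := (2 * n + 2)%N.
have [c [c1 c2 E1]] := mul_cancel (wd b (m * p)) re.
have [c' [c1' c2' E2]] := mul_cancel eta (red_wd (m * q) ra).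
have E := hm m; rewrite E1 E2 in E; rewrite !size_wd -/n in c1 c2 c1' c2' E.
have sE := congr1 size E.
rewrite !size_cat !size_drop !size_take_min !size_wd -/n in sE.
rewrite !(minn_idPl _) ?leq_subr // in sE.
have m2n : (2 * n < m)%N by rewrite /m; lia.
have pq : p = q.
  case: (ltngtP p q) => // pq.
    have : (m * p + m <= m * q)%N by rewrite addnC -mulnS leq_mul2l pq orbT.
    by lia.
  have : (m * q + m <= m * p)%N by rewrite addnC -mulnS leq_mul2l pq orbT.
  by lia.
subst q; split=> //.
have cc : c' = c by lia.
subst c'.
have mp : (2 * n + 2 * p <= m * p)%N.
  rewrite /m mulnDl leq_add2r; have : (2 * n * 1 <= 2 * n * p)%N by rewrite leq_mul2l p0 orbT.
  by rewrite muln1.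
pose h := (n - c)%N.
have win (k : nat) : (c <= k)%N -> (k < c + p)%N -> a k = b (k%:Z + (h%:Z - c%:Z)).
  move=> ck kcp; pose i := (m * p - k.+1)%N.
  have d := a 0.
  have hi : (h <= i)%N by rewrite /h /i; lia.
  have hi2 : (i < m * p - c)%N by rewrite /i; lia.
  have := congr1 (fun s => nth d s i) E; rewrite !nth_cat drop_wd.
  rewrite !size_take_min !size_wd (minn_idPl _) ?leq_subr // -/n -/h ltnNge hi /=.
  rewrite (minn_idPl _) ?leq_subr // hi2 nth_take // !nth_wd; [|rewrite /i; lia|lia].
  have -> : (m * p - i.+1)%N = k by rewrite /i; lia.
  by move=> <-; congr b; rewrite /i /h; lia.
exists (h%:Z - c%:Z) => i.
pose r := ((i - c%:Z) %% p)%Z.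
have r0 : 0 <= r by apply: modz_ge0; lia.
have rp : r < p by apply: ltz_pmod; lia.
have iE : i = (c%:Z + r) + p%:Z * ((i - c%:Z) %/ p)%Z.
  by have := divz_eq (i - c%:Z) p; rewrite -/r; lia.
rewrite iE (per_mul _ pa) [in RHS]addrAC (per_mul _ pb).
case: r r0 rp {iE} => // r _ rp; rewrite -PoszD.
by apply: win; lia.
Qed.

Lemma homotopic_lines a b (p q : nat) : walk a -> walk b -> reducedw a -> reducedw b ->
  (0 < p)%N -> (0 < q)%N -> per b p -> per a q ->
  freely_homotopic (fun t : R => line b (p%:R * t) : gspace R G) (fun t : R => line a (q%:R * t)) ->
  p = q /\ exists dl, forall i, a i = b (i + dl).
Proof.
move=> wa wb ra rb p0 q0 pb pa /(homotopy_words wb rb p0)[eta [mu [mu0 hmu hm]]].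
apply: (conjugate_words ra rb (stack_red eta)) => // m.
have q0' : 0 < q%:R :> R by rewrite ltr0n.
rewrite -hm -mu0 -(lift_walk wa q0' hmu) natrM mulfK // gt_eqF //.
Qed.

(** The lift of a constant loop is constant, while [m] turns along [a] spell a reduced word of
    length [m * p]; multiplication by [eta] changes its length by a bounded amount. *)
Lemma line_not_null a (p : nat) : walk a -> reducedw a -> (0 < p)%N ->
  ~ null_homotopic (fun t : R => line a (p%:R * t) : gspace R G).
Proof.
move=> wa ra p0 [x /(homotopy_words wa ra p0)[eta [mu [mu0 hmu hm]]]].
have muc t : mu t = eta.
  rewrite -mu0; apply: (@liftat_unique R G R setT (cst x) mu (fun=> mu 0) 0) => //.
  - exact: connectedR.
  - by move=> u _; near=> z; rewrite tr_id.
pose m := (2 * size (sval eta) + 1)%N.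
have := hm m; rewrite muc => /(congr1 size).
have [c [c1 c2 ->]] := size_mul (wd a (m * p)) (stack_red eta).
rewrite size_wd in c1 *; have : (m * 1 <= m * p)%N by rewrite leq_mul2l p0 orbT.
by rewrite /m; lia.
Unshelve. all: by end_near. Qed.

End LoopWords.

(** * Tightening a loop *)

Section PeriodicExtension.
Local Open Scope classical_set_scope.
Local Open Scope ring_scope.
Variable R : realType.

Definition frac (t : R) : R := t - (Num.floor t)%:~R.

Lemma frac_itv t : 0 <= frac t < 1.
Proof. by have := floor_itv t; rewrite intrD /frac; lra. Qed.

Lemma fracE (i : int) (t : R) : i%:~R <= t < i%:~R + 1 -> frac t = t - i%:~R.
Proof. by move=> h; rewrite /frac (@floor_def _ t i) // intrD. Qed.

Lemma floorD1 (t : R) : Num.floor (t + 1) = Num.floor t + 1.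
Proof. by apply: floor_def; have := floor_itv t; rewrite !intrD; lra. Qed.

Lemma fracD1 t : frac (t + 1) = frac t.
Proof. by rewrite /frac floorD1 intrD; lra. Qed.

Lemma cont_frac (X : topologicalType) (k : R * R -> X) : continuous k ->
  (forall u, k (u, 0) = k (u, 1)) -> continuous (fun z => k (z.1, frac z.2)).
Proof.
move=> ck k01 [u t].
have cs (i : int) : {for (u, t), continuous (fun z : R * R => k (z.1, z.2 - i%:~R))}.
  apply: (@continuous_comp _ _ _ (fun z : R * R => (z.1, z.2 - i%:~R)) k); last exact: ck.
  have [c1 c2] := @cont_fst_snd R R (u, t).
  by apply: cont_pair => //; apply: cvgB; [exact: c2|exact: cvg_cst].
have c2 := (@cont_fst_snd R R (u, t)).2.
have [i hi] := floorP t.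
have [ti|ti] := eqVneq t i%:~R.
  apply: (cont_paste (cs (i - 1)) (cs i)) => /=.
  - by rewrite (fracE hi) ti intrB opprB addrCA subrr addr0 k01.
  - by rewrite (fracE hi).
  have h1 : \forall z \near (u, t), i%:~R - 1 < z.2 by apply: (c2 [set y | i%:~R - 1 < y]); apply: lt_nbhsr => /=; lra.
  have h2 : \forall z \near (u, t), z.2 < i%:~R + 1 by apply: (c2 [set y | y < i%:~R + 1]); apply: lt_nbhsl => /=; lra.
  near=> z.
  have z1 : i%:~R - 1 < z.2 by near: z.
  have z2 : z.2 < i%:~R + 1 by near: z.
  have [zi|zi] := ltP z.2 i%:~R; [left|right].
    by rewrite (@fracE (i - 1)) // intrB; lra.
  by rewrite (@fracE i) // zi.
apply: (cont_near (cs i)).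
have h1 : \forall z \near (u, t), i%:~R < z.2.
  apply: (c2 [set y | i%:~R < y]); apply: lt_nbhsr => /=.
  by rewrite lt_neqAle eq_sym ti; case/andP: hi.
have h2 : \forall z \near (u, t), z.2 < i%:~R + 1 by apply: (c2 [set y | y < i%:~R + 1]); apply: lt_nbhsl => /=; lra.
near=> z.
have z1 : i%:~R < z.2 by near: z.
have z2 : z.2 < i%:~R + 1 by near: z.
by rewrite (@fracE i) // (ltW z1).
Unshelve. all: by end_near. Qed.

Lemma cont_frac1 (X : topologicalType) (k : R -> X) : continuous k -> k 0 = k 1 ->
  continuous (k \o frac).
Proof.
move=> ck k01 t.
have ck2 : continuous (fun z : R * R => k z.2).
  by move=> z; apply: continuous_comp; [exact: cvg_snd|exact: ck].
apply: (@continuous_comp _ _ _ (fun t : R => (0 : R, t)) (fun z => k (frac z.2))).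
  by apply: cont_pair; [exact: cvg_cst|exact: cvg_id].
exact: (cont_frac ck2).
Qed.

(** The retraction of the line onto [[0, 1]], written with absolute values so that continuity is
    inherited from the norm. *)
Definition clamp (u : R) : R := (`|u| - `|u - 1| + 1) / 2.

Lemma clamp_cont : continuous clamp.
Proof.
move=> u; apply: cvgMl; apply: cvgD; last exact: cvg_cst.
apply: cvgB; first exact: norm_continuous.
apply: (@continuous_comp _ _ _ (fun u : R => u - 1) (fun u : R => `|u|)); last exact: norm_continuous.
by apply: cvgB; [exact: cvg_id|exact: cvg_cst].
Qed.

Lemma clamp_le0 u : u <= 0 -> clamp u = 0.
Proof. by move=> u0; rewrite /clamp !ler0_norm; lra. Qed.

Lemma clamp_ge1 u : 1 <= u -> clamp u = 1.
Proof. by move=> u0; rewrite /clamp !ger0_norm; lra. Qed.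

Lemma clamp_id u : 0 <= u <= 1 -> clamp u = u.
Proof. by move=> u0; rewrite /clamp ger0_norm ?ler0_norm; lra. Qed.

Lemma clamp01 u : 0 <= clamp u <= 1.
Proof.
have [h|h] := leP u 0; first by rewrite clamp_le0 //; lra.
have [h'|h'] := leP 1 u; first by rewrite clamp_ge1 //; lra.
by rewrite clamp_id; lra.
Qed.

(** The lift to the line of the degree 1 circle map that is [k] on a fundamental domain. *)
Lemma clamp_reparam (k : R -> R) : continuous k -> k 0 = 0 -> k 1 = 1 ->
  continuous (fun t : R => (Num.floor t)%:~R + k (frac t)) /\
  forall t : R, (Num.floor (t + 1))%:~R + k (frac (t + 1)) = (Num.floor t)%:~R + k (frac t) + 1%N%:R.
Proof.
move=> ck k0 k1; split; last by move=> t; rewrite floorD1 fracD1 intrD; lra.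
have E : (fun t : R => (Num.floor t)%:~R + k (frac t)) = (fun t => t + (k (frac t) - frac t)).
  by apply/funext => t; rewrite /frac; lra.
rewrite E => t; apply: cvgD; first exact: cvg_id.
apply: (@cont_frac1 _ (fun t => k t - t)); last by rewrite k0 k1 !subrr.
by move=> x; apply: cvgB; [exact: ck|exact: cvg_id].
Qed.

End PeriodicExtension.

(** * Contracting a loop to the word of its lift *)

Section Contraction.
Local Open Scope classical_set_scope.
Local Open Scope ring_scope.
Variables (R : realType) (G : graph).
Implicit Types (v : 'I_(nvert G)) (w : seq (dart G)) (p q : gspace R G).

Fixpoint dwalk v0 w v : bool :=
  if w is a :: w' then (dtgt a == v) && dwalk v0 w' (dsrc a) else v0 == v.

Fixpoint slin v0 w (x : R) : gspace R G :=
  if w is a :: w' then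
    if x <= (size w')%:R then slin v0 w' x else dart_pt a (x - (size w')%:R)
  else Vertex R v0.

Lemma slin_le0 v0 w x : x <= 0 -> slin v0 w x = Vertex R v0.
Proof. by move=> x0; elim: w => //= a w ->; rewrite (le_trans x0). Qed.

Lemma slin_ge v0 w v x : dwalk v0 w v -> (size w)%:R <= x -> slin v0 w x = Vertex R v.
Proof.
case: w => [/eqP -> //|a w] /= /andP[/eqP <- _] wx.
rewrite -natr1 in wx; rewrite ifF; last by apply/negbTE; rewrite -ltNge; lra.
by rewrite dart_pt_ge1 //; lra.
Qed.

Lemma slin_cons v0 a w x : x <= (size w)%:R -> slin v0 (a :: w) x = slin v0 w x.
Proof. by move=> /= ->. Qed.

Lemma slin_top v0 a w x : dwalk v0 w (dsrc a) -> (size w)%:R <= x ->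
  slin v0 (a :: w) x = dart_pt a (x - (size w)%:R).
Proof.
move=> dw wx /=; case: leP => // xw; have -> : x = (size w)%:R by lra.
by rewrite (slin_ge dw) // subrr dart_pt_le0.
Qed.

Lemma slin_cont v0 w v : dwalk v0 w v -> continuous (slin v0 w).
Proof.
elim: w v => [|a w IH] v /=; first by move=> _ x; exact: cvg_cst.
move=> /andP[_ dw] x.
have cd : continuous (fun x : R => dart_pt a (x - (size w)%:R) : gspace R G).
  move=> y; apply: (@continuous_comp _ _ _ (fun x : R => x - (size w)%:R) (dart_pt a)); last exact: dart_pt_cont.
  by apply: cvgB; [exact: cvg_id|exact: cvg_cst].
have cw := IH _ dw x.
case: (ltgtP x (size w)%:R) => xw.
- by apply: (cont_near cw); near=> y; rewrite ifT //; apply: ltW; near: y; exact: lt_nbhsl.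
- apply: (cont_near (cd x)); near=> y; rewrite ifF //; apply/negbTE; rewrite -ltNge.
  by near: y; exact: lt_nbhsr.
- apply: (cont_paste cw (cd x)); rewrite /= ?xw ?lexx //.
    by rewrite subrr dart_pt_le0 // (slin_ge dw).
  by near=> y; case: ifP => _; [left|right].
Unshelve. all: by end_near. Qed.

(** Pushing preserves being a path from [v0]; the converse is the same fact for the reversed dart,
    which undoes the push. *)
Lemma dwalk_push v0 a w v : red w -> dsrc a = v -> dwalk v0 (push a w) (dtgt a) = dwalk v0 w v.
Proof.
have imp b u : dwalk v0 u (dsrc b) -> dwalk v0 (push b u) (dtgt b).
  case: u => [|c u] /=; first by move=> ->; rewrite eqxx.
  move=> /andP[cv du]; case: eqP => [cE|_] /=; last by rewrite eqxx cv.
  by move: du; rewrite cE dsrc_rev.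
move=> rw <-; apply/idP/idP; last exact: imp.
by rewrite -{1}(dsrc_rev a) => /imp; rewrite push_rev // dtgt_rev.
Qed.

Definition base p := match p with Vertex v => v | Inner e _ _ => src e end.

Lemma lift_dwalk (s : R -> gspace R G) (lam : R -> stack G) v0 : continuous s ->
  (forall t, is_liftat s lam t) -> dwalk v0 (sval (lam 0)) (base (s 0)) ->
  forall t, dwalk v0 (sval (lam t)) (base (s t)).
Proof.
move=> cs hl h0; apply: (@connectedT_ind _ _ (0 : R)) => //; first exact: connectedR.
move=> t; have ht := hl t; case E : (s t) => [v|e x x01].
  have hs : \forall u \near t, star v (1/2) (s u).
    by apply: (cs t); rewrite E; apply: nbhs_star; lra.
  near=> u; have -> : lam u = tr (s t) (s u) (lam t) by near: u.
  have : star v (1/2) (s u) by near: u.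
  rewrite E; case=> [->//|[[e b] [x [bv x12 ->]]]].
  rewrite /dart_pt; case: b bv => /= bv.
    have x01 : 0 < 1 - x < 1 by lra.
    rewrite edge_ptE /= ifF; last by apply/negbTE; rewrite -leNgt; lra.
    by have := @dwalk_push v0 (e, true) (sval (lam t)) v (stack_red _) bv; rewrite /dtgt /= => ->.
  have x01 : 0 < x < 1 by lra.
  rewrite edge_ptE /= ifT; last by lra.
  by rewrite -bv.
have hs : \forall u \near t, exists y, [/\ 0 < y < 1, 0 < y < 1 & s u = edge_pt e y].
  apply: (cs t [set q | exists y, [/\ 0 < y < 1, 0 < y < 1 & q = edge_pt e y]]).
  by rewrite E -edge_ptE; apply: nbhs_edge_open.
near=> u; have -> : lam u = tr (s t) (s u) (lam t) by near: u.
have [y [y01 _ ->]] : exists y, [/\ 0 < y < 1, 0 < y < 1 & s u = edge_pt e y] by near: u.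
by rewrite E edge_ptE.
Unshelve. all: by end_near. Qed.

(* The point at the fraction [u] of the geodesic of the universal cover from the
   base point to the lift of [p] encoded by the stack [w]. *)
Definition cpath v0 p w (u : R) : gspace R G :=
  match p with
  | Vertex _ => slin v0 w (u * (size w)%:R)
  | Inner e t _ =>
      if ohead w == Some (e, true) then slin v0 w (u * ((size w)%:R - t))
      else slin v0 ((e, false) :: w) (u * ((size w)%:R + t))
  end.

Lemma cpath_down v0 e t w u : 0 < t < 1 -> ohead w = Some (e, true) ->
  cpath v0 (edge_pt e t) w u = slin v0 w (u * ((size w)%:R - t)).
Proof. by move=> t01 we; rewrite edge_ptE /cpath we eqxx. Qed.

Lemma cpath_up v0 e t w u : 0 < t < 1 -> ohead w <> Some (e, true) ->
  cpath v0 (edge_pt e t) w u = slin v0 ((e, false) :: w) (u * ((size w)%:R + t)).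
Proof. by move=> t01 /eqP/negbTE we; rewrite edge_ptE /cpath we. Qed.

Lemma cpath0 v0 p w : cpath v0 p w 0 = Vertex R v0.
Proof.
case: p => [v|e t t01]; rewrite /cpath !mul0r ?slin_le0 //.
by case: (_ == _); rewrite ?slin_le0.
Qed.

Lemma cpath1 v0 p w : dwalk v0 w (base p) -> cpath v0 p w 1 = p.
Proof.
case: p => [v|e t t01] dw; rewrite /cpath mul1r; first exact: (slin_ge dw).
case: eqP => [|_].
  case: w dw => // a w /andP[_ dw] [aE]; subst a.
  rewrite slin_top //=; last by rewrite -natr1; lra.
  rewrite -edge_ptE /dart_pt /= -natr1; congr edge_pt; lra.
rewrite slin_top //; last by lra.
rewrite -edge_ptE /dart_pt /=; congr edge_pt; lra.
Qed.

(** Near a vertex this is the distance to it, by which the geodesic to a nearby point is longer or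
    shorter than the one to the vertex. *)
Definition tent p : R := if p is Inner _ t _ then Num.min t (1 - t) else 0.

(** The delicate points are over vertices: leaving a vertex, the geodesic either gets an additional
    dart or retreats along its last one, and the encoding changes accordingly. All variants agree at
    the vertex. *)
Lemma cpath_cont v0 (s : R -> gspace R G) (lam : R -> stack G) : continuous s ->
  (forall t, is_liftat s lam t) -> (forall t, dwalk v0 (sval (lam t)) (base (s t))) ->
  continuous (fun z : R * R => cpath v0 (s z.2) (sval (lam z.2)) (clamp z.1)).
Proof.
move=> cs hl dw [u0 t0]; have [c1 c2] := @cont_fst_snd R R (u0, t0).
have cc : {for (u0, t0), continuous (fun z : R * R => clamp z.1)}.
  by apply: continuous_comp; [exact: c1|exact: clamp_cont].
have hl2 : \forall z \near (u0, t0), lam z.2 = tr (s t0) (s z.2) (lam t0) := c2 _ (hl t0).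
have dw0 := dw t0; case E : (s t0) dw0 => [v|e x x01] /= dw0; last first.
  have hs : \forall t \near t0, exists y, [/\ 0 < y < 1, 0 < y < 1 & s t = edge_pt e y].
    apply: (cs t0 [set q | exists y, [/\ 0 < y < 1, 0 < y < 1 & q = edge_pt e y]]).
    by rewrite E -edge_ptE; apply: nbhs_edge_open.
  have hs2 : \forall z \near (u0, t0), exists y, [/\ 0 < y < 1, 0 < y < 1 & s z.2 = edge_pt e y] := c2 _ hs.
  have cx : {for (u0, t0), continuous (fun z : R * R => coord (s z.2))}.
    apply: (@continuous_comp _ _ _ (fun z : R * R => s z.2) (@coord R G)).
      by apply: continuous_comp; [exact: c2|exact: cs].
    by rewrite /= E -edge_ptE; exact: coord_cont.
  set w0 := sval (lam t0) in dw0 *.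
  pose g (z : R * R) := if ohead w0 == Some (e, true)
    then slin v0 w0 (clamp z.1 * ((size w0)%:R - coord (s z.2)))
    else slin v0 ((e, false) :: w0) (clamp z.1 * ((size w0)%:R + coord (s z.2))).
  apply: (@cont_near _ _ _ g); last first.
    near=> z; rewrite /g (_ : lam z.2 = tr (s t0) (s z.2) (lam t0)); last by near: z.
    have [y [y01 _ ->]] : exists y, [/\ 0 < y < 1, 0 < y < 1 & s z.2 = edge_pt e y] by near: z.
    by rewrite E !edge_ptE.
  rewrite /g; case: (ohead w0 == Some (e, true)).
    apply: (@continuous_comp _ _ _ (fun z : R * R => clamp z.1 * ((size w0)%:R - coord (s z.2))) (slin v0 w0)).
      by apply: cvgM; [exact: cc|apply: cvgB; [exact: cvg_cst|exact: cx]].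
    exact: slin_cont dw0 _.
  apply: (@continuous_comp _ _ _ (fun z : R * R => clamp z.1 * ((size w0)%:R + coord (s z.2))) (slin v0 ((e, false) :: w0))).
    by apply: cvgM; [exact: cc|apply: cvgD; [exact: cvg_cst|exact: cx]].
  by apply: (@slin_cont _ _ (tgt e)); rewrite /= dw0 eqxx.
have hs : \forall t \near t0, star v (1/2) (s t).
  by apply: (cs t0); rewrite E; apply: nbhs_star; lra.
have hs2 : \forall z \near (u0, t0), star v (1/2) (s z.2) := c2 _ hs.
have ct : {for (u0, t0), continuous (fun z : R * R => tent (s z.2))}.
  apply: (@continuous_comp _ _ _ (fun z : R * R => s z.2) tent).
    by apply: continuous_comp; [exact: c2|exact: cs].
  suff : {for Vertex R v, continuous tent} by rewrite -E.
  move=> O /nbhs_ballP[eps /= e0 hO].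
  have ns : nbhs (Vertex R v : gspace R G) (star v (Num.min eps (1/2))).
    by apply: nbhs_star; rewrite lt_min e0; lra.
  suff sO : star v (Num.min eps (1/2)) `<=` tent @^-1` O by exact: filterS sO ns.
  move=> q sq; apply: hO; rewrite /ball /= sub0r normrN; move: sq.
  case=> [->|[[e b] [y [_ y1 ->]]]]; first by rewrite normr0.
  move: y1; rewrite lt_min => y1.
  rewrite /dart_pt /=; case: b.
    have y01 : 0 < 1 - y < 1 by lra.
    by rewrite edge_ptE /= min_r; [rewrite ger0_norm; lra|lra].
  have y01 : 0 < y < 1 by lra.
  by rewrite edge_ptE /= min_l; [rewrite ger0_norm; lra|lra].
set w0 := sval (lam t0) in dw0 *.
set m : R := (size w0)%:R.
have rw0 : red w0 by exact: stack_red.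
move=> O; rewrite /= E /= -/w0 -/m => nO.
(* This covers at once all the paths that a nearby geodesic can follow: [w0], or [w0] extended by
   any dart out of [v]. *)
pose good (x : R) := O (slin v0 w0 x) /\ forall a, dsrc a = v -> O (slin v0 (a :: w0) x).
have c0 := clamp01 u0.
have c0m : clamp u0 * m <= m by apply: ler_piMl; [exact: ler0n|lra].
have ngood : \forall x \near clamp u0 * m, good x.
  have h1 : \forall x \near clamp u0 * m, O (slin v0 w0 x) by exact: (slin_cont dw0 (x := clamp u0 * m)) nO.
  suff h2 : \forall x \near clamp u0 * m, forall a, dsrc a = v -> O (slin v0 (a :: w0) x).
    by near=> x; split; near: x.
  suff ha (a : dart G) : \forall x \near clamp u0 * m, dsrc a = v -> O (slin v0 (a :: w0) x).
    exact: (@filter_forall R _ (fun a x => dsrc a = v -> O (slin v0 (a :: w0) x)) _ _ ha).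
  have [av|av] := eqVneq (dsrc a) v; last by near=> x => /eqP; rewrite (negbTE av).
  have ca : continuous (slin v0 (a :: w0)) by apply: (@slin_cont _ _ (dtgt a)); rewrite /= eqxx av.
  have h : \forall x \near clamp u0 * m, O (slin v0 (a :: w0) x).
    by apply: ca; rewrite slin_cons.
  by apply: filterS h => x Ox _.
have cp : {for (u0, t0), continuous (fun z : R * R => clamp z.1 * (m + tent (s z.2)))}.
  by apply: cvgM; [exact: cc|apply: cvgD; [exact: cvg_cst|exact: ct]].
have cm : {for (u0, t0), continuous (fun z : R * R => clamp z.1 * (m - tent (s z.2)))}.
  by apply: cvgM; [exact: cc|apply: cvgB; [exact: cvg_cst|exact: ct]].
have gp : \forall z \near (u0, t0), good (clamp z.1 * (m + tent (s z.2))).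
  by apply: cp; rewrite /= E /= addr0.
have gm : \forall z \near (u0, t0), good (clamp z.1 * (m - tent (s z.2))).
  by apply: cm; rewrite /= E /= subr0.
suff : \forall z \near (u0, t0), O (cpath v0 (s z.2) (sval (lam z.2)) (clamp z.1)) by [].
near=> z.
have gpz : good (clamp z.1 * (m + tent (s z.2))) by near: z.
have gmz : good (clamp z.1 * (m - tent (s z.2))) by near: z.
have -> : lam z.2 = tr (s t0) (s z.2) (lam t0) by near: z.
have : star v (1/2) (s z.2) by near: z.
move=> sz; rewrite E; case: sz gpz gmz => [->|[[e b] [y [bv y12 ->]]]].
  by rewrite /= addr0 => -[].
case: b bv => bv.
  have y01 : 0 < 1 - y < 1 by lra.
  rewrite (_ : dart_pt (e, true) y = edge_pt e (1 - y)) //.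
  have -> : tent (edge_pt e (1 - y)) = y by rewrite edge_ptE /= min_r; lra.
  have -> : tr (Vertex R v) (edge_pt e (1 - y)) (lam t0) = spush (e, true) (lam t0).
    by rewrite edge_ptE /= ifF //; apply/negbTE; rewrite -leNgt; lra.
  move=> gq gn; rewrite [sval _]/= -/w0.
  have [[w' W]|W] : (exists w', w0 = (e, false) :: w') \/ push (e, true) w0 = (e, true) :: w0.
    case: (w0) => [|b w'] /=; first by right.
    by case: eqP => [->|_]; [left; exists w'|right].
  - rewrite W /= eqxx cpath_up //.
      move: gn; rewrite /good /m W => -[gn _]; move: gn.
      by congr (O (slin _ _ (_ * _))); rewrite [size _]/= -natr1; lra.
    move=> we; move: rw0; rewrite W; case: w' we {W} => //= b w' [->].
    by rewrite /red /= /drev /= eqxx.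
  - rewrite W cpath_down //; case: gq => _ /(_ (e, true) bv).
    by congr (O (slin _ _ (_ * _))); rewrite /m [size (_ :: _)]/= -natr1; lra.
have y01 : 0 < y < 1 by lra.
rewrite (_ : dart_pt (e, false) y = edge_pt e y) //.
have -> : tent (edge_pt e y) = y by rewrite edge_ptE /= min_l; lra.
have y12' : y < 1/2 by lra.
have -> : tr (Vertex R v) (edge_pt e y) (lam t0) = lam t0 by rewrite edge_ptE /= y12'.
move=> [_ /(_ (e, false) bv) gq] [gn _]; rewrite -/w0.
have [we|we] := eqVneq (ohead w0) (Some (e, true)); first by rewrite cpath_down.
by rewrite cpath_up //; apply/eqP.
Unshelve. all: by end_near. Qed.

Definition std v0 w (t : R) : gspace R G := slin v0 w ((size w)%:R * frac t).

Lemma std_loop v0 w : dwalk v0 w v0 -> is_loop (std v0 w).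
Proof.
move=> dw; split; last by move=> t; rewrite /std fracD1.
apply: (@cont_frac1 _ _ (fun t => slin v0 w ((size w)%:R * t))).
  move=> t; apply: (@continuous_comp _ _ _ (fun t : R => (size w)%:R * t) (slin v0 w)).
    by apply: cvgM; [exact: cvg_cst|exact: cvg_id].
  exact: slin_cont dw _.
by rewrite mulr0 mulr1 slin_le0 // (slin_ge dw).
Qed.

Lemma loop_power1 (X : topologicalType) (s : R -> X) : loop_power s 1 = s.
Proof. by apply/funext => t; rewrite /loop_power mul1r. Qed.

Lemma loop_contract v0 (s : R -> gspace R G) (lam : R -> stack G) : is_loop s ->
  s 0 = Vertex R v0 -> (forall t, is_liftat s lam t) -> lam 0 = snil G ->
  dwalk v0 (sval (lam 1)) v0 /\ freely_homotopic s (std v0 (sval (lam 1))).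
Proof.
move=> ls s0 hl l0; have [cs ps] := ls.
have dw : forall t, dwalk v0 (sval (lam t)) (base (s t)).
  by apply: lift_dwalk => //; rewrite l0 s0 /= eqxx.
have s1 : s 1 = Vertex R v0 by rewrite -(add0r 1) ps.
have dw1 : dwalk v0 (sval (lam 1)) v0 by have := dw 1; rewrite s1.
set w := sval (lam 1) in dw1 *; split=> //.
have lw := std_loop dw1.
pose H z := cpath v0 (s z.2) (sval (lam z.2)) (clamp z.1).
have cH : continuous H by exact: cpath_cont.
(* Shrinking the lifted path toward the base point opens the loop, since its end runs back along
   [w]. The second half of [k] closes it by following [w] from the fraction [u] to the end. *)
pose k (z : R * R) := if z.2 <= 1/2 then H (z.1, 2 * z.2) else
  slin v0 w ((clamp z.1 + (1 - clamp z.1) * (2 * z.2 - 1)) * (size w)%:R).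
have ck : continuous k.
  move=> [u t]; have [c1 c2] := @cont_fst_snd R R (u, t).
  have ch : {for (u, t), continuous (fun z : R * R => H (z.1, 2 * z.2))}.
    apply: (@continuous_comp _ _ _ (fun z : R * R => (z.1, 2 * z.2)) H); last exact: cH.
    by apply: cont_pair => //; apply: cvgM; [exact: cvg_cst|exact: c2].
  have cc : {for (u, t), continuous (fun z : R * R => clamp z.1)}.
    by apply: continuous_comp; [exact: c1|exact: clamp_cont].
  have cg : {for (u, t), continuous (fun z : R * R =>
      slin v0 w ((clamp z.1 + (1 - clamp z.1) * (2 * z.2 - 1)) * (size w)%:R))}.
    apply: (@continuous_comp _ _ _ (fun z : R * R => (clamp z.1 + (1 - clamp z.1) * (2 * z.2 - 1)) * (size w)%:R) (slin v0 w)).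
      apply: cvgMl; apply: cvgD; first exact: cc.
      apply: cvgM; first by apply: cvgB; [exact: cvg_cst|exact: cc].
      apply: cvgB; last exact: cvg_cst.
      by apply: cvgM; [exact: cvg_cst|exact: c2].
    exact: slin_cont dw1 _.
  case: (ltgtP t (1/2)) => tt.
  - apply: (cont_near ch).
    have h : \forall z \near (u, t), z.2 < 1/2 := c2 _ (lt_nbhsl tt).
    by apply: filterS h => -[v x] /= vt; rewrite /k /= (ltW vt).
  - apply: (cont_near cg).
    have h : \forall z \near (u, t), 1/2 < z.2 := c2 _ (lt_nbhsr tt).
    by apply: filterS h => -[v x] /= vt; rewrite /k /= leNgt vt.
  - apply: (cont_paste ch cg).
    + by rewrite /k /= tt lexx.
    + rewrite /k /= tt lexx /H /= (_ : 2 * (1/2) = 1 :> R) ?s1; last by lra.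
      by rewrite subrr mulr0 addr0.
    + by near=> z; rewrite /k; case: ifP => _; [left|right].
have k01 u : k (u, 0) = k (u, 1).
  rewrite /k /= ifT; last by lra.
  rewrite ifF; last by apply/negbTE; rewrite -ltNge; lra.
  rewrite /H /= mulr0 s0 l0 /= (_ : clamp u + (1 - clamp u) * (2 * 1 - 1) = 1); last by ring.
  by rewrite mul1r (slin_ge dw1).
have kh : freely_homotopic (fun t => k (0, frac t)) (fun t => k (1, frac t)).
  exists (fun z => k (z.1, frac z.2)); split=> //; first exact: cont_frac.
  by move=> u t /=; rewrite fracD1.
have cl (h : R -> R) : continuous h -> continuous (@clamp R \o h).
  by move=> ch t; apply: continuous_comp; [exact: ch|exact: clamp_cont].
(* The two ends of the homotopy are [s] and [std v0 w], each run on one half of the period and at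
   rest on the other; these are degree 1 reparametrizations. *)
have [||c0 p0] := clamp_reparam (cl _ (@cont_affine R 2 (-1))).
- by rewrite /= clamp_le0 //; lra.
- by rewrite /= clamp_ge1 //; lra.
have [||c1 p1] := clamp_reparam (cl _ (@cont_affine R 2 0)).
- by rewrite /= clamp_le0 //; lra.
- by rewrite /= clamp_ge1 //; lra.
have h0 := reparam_homotopic lw c0 p0; have h1 := reparam_homotopic ls c1 p1.
rewrite !loop_power1 in h0 h1.
apply: (freely_homotopic_trans (freely_homotopic_sym h1)).
apply: freely_homotopic_trans h0.
have fr (t : R) (h : R -> R) : 0 <= h (frac t) < 1 -> frac ((Num.floor t)%:~R + h (frac t)) = h (frac t).
  by move=> h01; rewrite (@fracE R (Num.floor t)); lra.
have -> : s \o (fun t => (Num.floor t)%:~R + (@clamp R \o (fun u => 2 * u + 0)) (frac t)) =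
    (fun t => k (1, frac t)).
  apply/funext => t /=; rewrite addr0 addrC (loop_int _ _ ps).
  have f01 := frac_itv t; rewrite /k /=; case: ifP => ft.
    by rewrite /H /= (clamp_ge1 (lexx _)) cpath1 // clamp_id //; lra.
  move/negbT: ft; rewrite -ltNge => ft.
  rewrite (@clamp_ge1 _ (2 * _)) ?s1; last by lra.
  by rewrite (clamp_ge1 (lexx _)) subrr mul0r addr0 mul1r (slin_ge dw1).
have <- : (fun t => k (0, frac t)) = std v0 w \o (fun t => (Num.floor t)%:~R + (@clamp R \o (fun u => 2 * u + -1)) (frac t)).
  apply/funext => t /=; rewrite /std.
  have f01 := frac_itv t.
  rewrite (fr t (fun t => clamp (2 * t + -1))); last first.
    have := clamp01 (2 * frac t + -1).
    have [h|h] := leP (2 * frac t + -1) 0; first by rewrite clamp_le0 //; lra.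
    by rewrite clamp_id; lra.
  rewrite /k /=; case: ifP => ft.
    by rewrite /H /= (clamp_le0 (lexx _)) cpath0 (@clamp_le0 _ (_ + _)) ?mulr0 ?slin_le0 //; lra.
  move/negbT: ft; rewrite -ltNge => ft.
  rewrite (clamp_le0 (lexx _)) add0r subr0 mul1r clamp_id; last by lra.
  by rewrite mulrC.
exact: freely_homotopic_sym.
Unshelve. all: by end_near. Qed.

Lemma slin_line v0 w v (a : int -> dart G) : dwalk v0 w v -> wd a (size w) = w ->
  forall (j : nat) (x : R), (j < size w)%N -> j%:R <= x <= j%:R + 1 ->
  slin v0 w x = dart_pt (a j) (x - j%:R).
Proof.
elim: w v => [//|b w IH] v /= /andP[bv dw] [ab wE] j x jw xj.
have dwb : dwalk v0 w (dsrc b) by [].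
case: leP => xw; last first.
  have -> : j = size w; last by rewrite ab.
  apply/eqP; rewrite eqn_leq -ltnS jw /= -ltnS -(ltr_nat R) -natr1; lra.
have [jw'|jw'] := ltnP j (size w); first exact: (IH _ dw wE).
have -> : j = size w by apply/eqP; rewrite eqn_leq jw' -ltnS jw.
have xE : x = (size w)%:R.
  by apply/eqP; rewrite eq_le xw /=; apply: le_trans (proj1 (andP xj)); rewrite ler_nat.
by rewrite xE subrr (slin_ge dw) // ab dart_pt_le0.
Qed.

(** [rev] restores path order, the head of a stack being its last dart; [d] is only a default for
    [nth]. *)
Definition cyc_word (d : dart G) w (i : int) : dart G :=
  nth d (rev w) `|(i %% size w)%Z|%N.

Lemma cyc_word_per d w : per (cyc_word d w) (size w).
Proof. by move=> i; rewrite /cyc_word modzDr. Qed.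

Lemma cyc_word_small d w (j : nat) : (j < size w)%N -> cyc_word d w j = nth d (rev w) j.
Proof. by move=> jw; rewrite /cyc_word modz_small. Qed.

Lemma wd_rcons (a : int -> dart G) k : wd a k.+1 = rcons (wd (fun i => a (i + 1)) k) (a 0).
Proof. by elim: k => [//|k IH]; rewrite [LHS]/= -/(wd a k.+1) IH /= -addn1 PoszD. Qed.

Lemma wd_cyc_word d w : wd (cyc_word d w) (size w) = w.
Proof.
apply: (@eq_from_nth _ d); first by rewrite size_wd.
move=> i; rewrite size_wd => iw; rewrite nth_wd // cyc_word_small ?nth_rev; [|lia|lia].
by congr nth; lia.
Qed.

Lemma dwalk_nth d v0 w v (j : nat) : dwalk v0 w v -> (j.+1 < size w)%N ->
  dtgt (nth d (rev w) j) = dsrc (nth d (rev w) j.+1).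
Proof.
elim: w v => // b w IH v /= /andP[_ dw] jw; rewrite rev_cons !nth_rcons size_rev.
rewrite ltnS in jw; rewrite jw; case: ltnP => jw'; first exact: IH dw jw'.
have -> : j.+1 = size w by apply/eqP; rewrite eqn_leq jw jw'.
rewrite eqxx nth_rev // (_ : (size w - j.+1)%N = 0%N); last by lia.
by case: w jw dw {IH jw'} => // c w _ /= /andP[/eqP].
Qed.

Lemma dwalk_ends d v0 w v : dwalk v0 w v -> (0 < size w)%N ->
  dsrc (nth d (rev w) 0) = v0 /\ dtgt (nth d (rev w) (size w).-1) = v.
Proof.
elim: w v => // b w IH v /= /andP[/eqP bv dw] _; rewrite rev_cons !nth_rcons size_rev.
rewrite ltnn eqxx; split=> //; case: ltnP => w0; first exact: (IH _ dw w0).1.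
by move: w0 dw; rewrite leqn0 size_eq0 => /eqP -> /= /eqP.
Qed.

Lemma cyc_word_walk d v0 w : dwalk v0 w v0 -> (0 < size w)%N -> walk (cyc_word d w).
Proof.
move=> dw w0 i; have [e1 e2] := dwalk_ends d dw w0.
have r0 : 0 <= (i %% size w)%Z by apply: modz_ge0; lia.
have rp : (i %% size w)%Z < size w by apply: ltz_pmod; lia.
rewrite /cyc_word -(modzDml i 1); case: (i %% size w)%Z r0 rp => // r _ rp.
have [rw|rw] := ltnP r.+1 (size w).
  by rewrite -PoszD addn1 modz_small ?rw //=; apply: dwalk_nth dw rw.
have -> : r = (size w).-1 by lia.
rewrite -PoszD addn1 prednK // modzz /=.
by rewrite e1 e2.
Qed.

Lemma std_line d v0 w : dwalk v0 w v0 -> (0 < size w)%N ->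
  std v0 w = (fun t : R => line (cyc_word d w) ((size w)%:R * t)).
Proof.
move=> dw w0; apply/funext => t; rewrite /std.
have -> : (size w)%:R * t = (size w)%:R * frac t + ((size w)%:Z * Num.floor t)%:~R.
  by rewrite intrM -pmulrn /frac -mulrDr subrK.
rewrite line_per; last exact: (per_mul _ (cyc_word_per d w)).
have f01 := frac_itv t; set x := _ * frac t.
have w0' : 0 < (size w)%:R :> R by rewrite ltr0n.
have x0 : 0 <= x by apply: mulr_ge0; [exact: ler0n|lra].
have xw : x < (size w)%:R by rewrite /x gtr_pMr //; lra.
have [j hj] := floorP x.
have j0 : 0 <= j by rewrite -ltzD1 -(ltr_int R) intrD; lra.
have jn : j < size w by rewrite -(ltr_int R) -pmulrn; lra.
rewrite (line_itv _ hj); case: j j0 jn hj => // j _ jn hj.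
by apply: (slin_line dw (wd_cyc_word d w)) => //; rewrite -!pmulrn in hj; lra.
Qed.

Lemma lift_of_line (a : int -> dart G) (n : nat) : walk a -> (0 < n)%N ->
  exists lam : R -> stack G, [/\ lam 0 = snil G,
    forall t, is_liftat (fun t : R => line a (n%:R * t)) lam t &
    sval (lam 1) = mul [::] (wd a n)].
Proof.
move=> wa n0; have n0' : 0 < n%:R :> R by rewrite ltr0n.
have cl : continuous (fun t : R => line a (n%:R * t) : gspace R G).
  move=> t; apply: (@continuous_comp _ _ _ (fun t : R => n%:R * t) (line a)); last exact: line_cont.
  by apply: cvgM; [exact: cvg_cst|exact: cvg_id].
have [lam [l0 hl]] := lift_line (snil G) cl.
exists lam; split=> //; have := lift_walk wa n0' hl n.
by rewrite divff ?gt_eqF // l0.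
Qed.

Lemma line_is_loop (a : int -> dart G) (n : nat) : walk a -> per a n ->
  is_loop (fun t : R => line a (n%:R * t) : gspace R G).
Proof.
move=> wa pa; split=> t.
  apply: (@continuous_comp _ _ _ (fun t : R => n%:R * t) (line a)); last exact: line_cont.
  by apply: cvgM; [exact: cvg_cst|exact: cvg_id].
by rewrite mulrDr mulr1 pmulrn (line_per _ pa).
Qed.

Lemma homotopic_rotate (X : topologicalType) (s : R -> X) (c : R) : is_loop s ->
  freely_homotopic s (fun t => s (t + c)).
Proof.
move=> ls; have := @reparam_homotopic R X s (fun t => t + c) 1 ls.
rewrite loop_power1 => h; apply: freely_homotopic_sym; apply: h.
  by move=> t; apply: cvgD; [exact: cvg_id|exact: cvg_cst].
by move=> t; rewrite addrAC.
Qed.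

(* Each turn of the induction removes the first and the last dart of the word
   when they cancel, after rotating the loop by one dart. *)
Lemma loop_tight_vertex (m : nat) v0 (s : R -> gspace R G) (lam : R -> stack G) :
  (size (sval (lam 1%R)) < m)%N -> is_loop s -> s 0 = Vertex R v0 ->
  (forall t, is_liftat s lam t) -> lam 0 = snil G -> ~ null_homotopic s ->
  exists a (n : nat), [/\ (0 < n)%N, per a n, walk a, reducedw a &
    freely_homotopic s (fun t : R => line a (n%:R * t))].
Proof.
elim: m v0 s lam => // m IH v0 s lam wm ls s0 hl l0 nn.
have [dw h] := loop_contract ls s0 hl l0.
set w := sval (lam 1) in wm dw h; have rw : red w by exact: stack_red.
have [w0|w0] := posnP (size w).
  exfalso; apply: nn; exists (Vertex R v0); move/size0nil: w0 h => ->.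
  by rewrite (_ : std v0 [::] = cst (Vertex R v0)).
have d : dart G by case: (w) w0.
rewrite (std_line d dw w0) in h.
set a := cyc_word d w in h; set n := size w in w0 h wm.
have wa : walk a := cyc_word_walk d dw w0.
have pa : per a n by exact: cyc_word_per.
have [ra|nra] := pselect (reducedw a); first by exists a, n.
have wE : wd a n = w by exact: wd_cyc_word.
have [k [kn ak]] : exists k : nat, (k < n)%N /\ a (k%:Z + 1) = drev (a k).
  apply: contrapT => nk; apply: nra => i ai; apply: nk.
  exists `|(i %% n)%Z|%N.
  have r0 : 0 <= (i %% n)%Z by apply: modz_ge0; lia.
  have rn : (i %% n)%Z < n by apply: ltz_pmod; lia.
  rewrite gez0_abs //; split; first by lia.
  have iE : i = (i %% n)%Z + n%:Z * (i %/ n)%Z by have := divz_eq i n; lia.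
  by move: ai; rewrite {1 2}iE addrAC !(per_mul _ pa).
(* [w] itself is reduced, so a backtrack can only occur at the seam between two turns. *)
have kn1 : k = n.-1.
  apply: contrapT => kn1; have k1n : (k.+1 < n)%N by lia.
  have := rw; rewrite -wE /red => /(sortedP d).
  rewrite size_wd => /(_ (n - k.+2)%N ltac:(lia)).
  rewrite !nth_wd; [|lia|lia].
  rewrite (_ : (n - (n - k.+2).+1)%N = k.+1); last by lia.
  rewrite (_ : (n - (n - k.+2).+2)%N = k); last by lia.
  by rewrite -addn1 PoszD ak eqxx.
have a0 : a 0 = drev (a n.-1).
  by rewrite -kn1 -ak -[0]addr0 -(pa 0) add0r; congr a; lia.
have n1 : (1 < n)%N.
  case: (n) w0 a0 => // -[|//] _ /= a0.
  by have := drev_neq (a 0); rewrite -a0 eqxx.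
pose b i := a (i + 1).
have wb : walk b by move=> i; exact: wa.
have pb : per b n by move=> i; rewrite /b addrAC pa.
have [mu [m0 hmu m1]] := lift_of_line wb w0.
have bE t : line b (n%:R * t) = line a (n%:R * (t + n%:R^-1)) :> gspace R G.
  rewrite mulrDr mulfV ?pnatr_eq0 -?lt0n //.
  by rewrite (line_shift a 1).
have hb : freely_homotopic s (fun t : R => line b (n%:R * t)).
  apply: freely_homotopic_trans h _.
  rewrite (_ : (fun t : R => line b (n%:R * t)) = (fun t => line a (n%:R * (t + n%:R^-1)))); last exact/funext.
  exact: (@homotopic_rotate _ (fun t : R => line a (n%:R * t)) _ (line_is_loop wa pa)).
(* After the rotation by one dart the cancelling pair is on top of the stack, so the new lift is
   shorter by two. *)
have wdb : exists z, wd b n = a 0 :: drev (a 0) :: z /\ red (drev (a 0) :: z) /\ (size z).+2 = n.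
  case: (n) w0 n1 a0 wE pa => // -[//|n'] _ _ a0 wE pan.
  exists (wd b n'); split.
    rewrite /= /b; congr [:: _, _ & _].
      by rewrite -(pan 0) add0r; congr a; lia.
    by rewrite a0 drevK; congr a; lia.
  rewrite size_wd; split=> //.
  have := rw; rewrite -wE wd_rcons -cats1 /red => /cat_sorted2[h1 _].
  have -> : drev (a 0) = b n' by rewrite a0 drevK /b; congr a; lia.
  exact: h1.
have [z [zE [rz sz]]] := wdb.
have szmu : (size (sval (mu 1%R)) < m)%N.
  rewrite m1 zE /= -/(mul [::] z) (mul_nil (red_tl rz)).
  have -> : push (drev (a 0)) z = drev (a 0) :: z.
    by have := mul_nil rz; rewrite /= -/(mul [::] z) (mul_nil (red_tl rz)).
  by rewrite /= eqxx; lia.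
have [||a' [n' [n'0 pa' wa' ra' h']]] := IH (dsrc (b 0)) _ mu szmu (line_is_loop wb pb) _ hmu m0.
- by rewrite mulr0; exact: (@line_int R G b 0).
- by move=> nb; apply: nn; apply: null_homotopic_trans hb nb.
- by exists a', n'; split=> //; apply: freely_homotopic_trans hb h'.
Qed.

Lemma loop_tight (s : R -> gspace R G) : is_loop s -> ~ null_homotopic s ->
  exists a (n : nat), [/\ (0 < n)%N, per a n, walk a, reducedw a &
    freely_homotopic s (fun t : R => line a (n%:R * t))].
Proof.
move=> ls nn; have [cs ps] := ls.
have [[t0 vt0]|nv] := pselect (exists t, is_vert (s t)).
  have h := homotopic_rotate t0 ls.
  have ls' : is_loop (fun t => s (t + t0)).
    split=> t; last by rewrite addrAC ps.
    by apply: (@continuous_comp _ _ _ (fun t => t + t0) s); [apply: cvgD; [exact: cvg_id|exact: cvg_cst]|exact: cs].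
  case E : (s t0) vt0 => [v0|//] _.
  have [lam [l0 hl]] := lift_line (snil G) ls'.1.
  have [||a [n [n0 pa wa ra h']]] := loop_tight_vertex (ltnSn _) ls' (v0 := v0) _ hl l0.
  - by rewrite add0r.
  - by move=> nb; apply: nn; apply: null_homotopic_trans h nb.
  - by exists a, n; split=> //; apply: freely_homotopic_trans h h'.
(* A loop that avoids all vertices lies in one open edge and contracts to the source of that
   edge. *)
exfalso; apply: nn.
have [||||e he] := @inner_edge R G R setT s 0.
- exact: connectedR.
- by [].
- by move=> t _; exact: cs.
- by move=> t _; apply/negP => vt; apply: nv; exists t.
exists (edge_pt e 0); exists (fun z => edge_pt e ((1 - z.1) * coord (s z.2))); split.
- move=> z; apply: (@continuous_comp _ _ _ (fun z : R * R => (1 - z.1) * coord (s z.2)) (edge_pt e)); last exact: edge_pt_cont.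
  have [c1 c2] := @cont_fst_snd R R z.
  apply: cvgM; first by apply: cvgB; [exact: cvg_cst|exact: c1].
  apply: (@continuous_comp _ _ _ (fun z : R * R => s z.2) (@coord R G)).
    by apply: continuous_comp; [exact: c2|exact: cs].
  by have [x01 ->] := he z.2 I; exact: coord_cont.
- by move=> u t /=; rewrite ps.
- by move=> t /=; rewrite subr0 mul1r; have [_ <-] := he t I.
- by move=> t /=; rewrite subrr mul0r.
Qed.

End Contraction.

(** * Embedded circles *)

Section EmbeddedCircle.
Local Open Scope classical_set_scope.
Local Open Scope ring_scope.
Variable R : realType.

Lemma hausdorff_pair (X Y : topologicalType) : hausdorff_space X -> hausdorff_space Y ->
  hausdorff_space (X * Y)%type.
Proof.
move=> hX hY [x y] [x' y'] h; congr pair.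
  apply: hX => A B nA nB.
  have [||[u v] [/= Au Bu]] := h (A `*` setT) (B `*` setT).
  - by exists (A, setT) => //; split=> //=; exact: filterT.
  - by exists (B, setT) => //; split=> //=; exact: filterT.
  - by exists u; split; [exact: Au.1|exact: Bu.1].
apply: hY => A B nA nB.
have [||[u v] [/= Au Bu]] := h (setT `*` A) (setT `*` B).
- by exists (setT, A) => //; split=> //=; exact: filterT.
- by exists (setT, B) => //; split=> //=; exact: filterT.
- by exists v; split; [exact: Au.2|exact: Bu.2].
Qed.

Lemma closed_eqfun (T X : topologicalType) (f g : T -> X) : hausdorff_space X ->
  continuous f -> continuous g -> closed [set t | f t = g t].
Proof.
move=> hX cf cg; rewrite -[X in closed X]setCK; apply: open_closedC.
rewrite openE => t /= h; rewrite /interior.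
exact: (near_neq hX (cf t) (cg t) h).
Qed.

(** Return pairs [(t, d)] with [d] at least [eps] form a compact set, and one of minimal [d] bounds
    an arc without smaller returns. Its ends meet, so it is an embedded circle. *)
Lemma shortest_return (X : topologicalType) (c : R -> X) (T : R) : hausdorff_space X ->
  0 < T -> continuous c -> locinj c -> (forall t, c (t + T) = c t) ->
  exists t0 d0, [/\ 0 < d0, c (t0 + d0) = c t0 &
    forall x y, t0 <= x -> x < y -> y < t0 + d0 -> c x <> c y].
Proof.
move=> hX T0 cc lc pc.
(* Local injectivity excludes short returns, uniformly on a period by compactness; this keeps the
   minimum away from [d = 0]. *)
have [eps eps0 heps] : exists2 eps, 0 < eps & forall t d, 0 <= t <= T -> 0 < d < eps -> c t <> c (t + d).
  have /compact_near_coveringP nc := @segment_compact R 0 T.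
  pose P (e t : R) := forall d, 0 < d < e -> c t <> c (t + d).
  have : \forall e \near 0^'+, `[0, T] `<=` P e.
    apply: (nc R 0^'+ P) => t _; have [A /nbhs_ballP[r /= r0 rA] iA] := lc t.
    exists (ball t (r / 2), [set e | e < r / 2]) => /=.
      split; first by apply: nbhsx_ballx; lra.
      by apply: nbhs_right_lt; lra.
    move=> [x e] [/=]; rewrite /ball /= ltr_norml => xt er d de ceq.
    have : x = x + d.
      by apply: iA ceq; apply/mem_set/rA; rewrite /ball /= ltr_norml; lra.
    by lra.
  move=> [r /= r0 hr]; exists (r / 2); first by lra.
  move=> t d tT; apply: (hr (r / 2)); [|lra|by rewrite /= in_itv].
  by rewrite /ball /= sub0r normrN ger0_norm; lra.
pose K : set (R * R) := (`[0, T] `*` `[eps, T]) `&` [set z | c z.1 = c (z.1 + z.2)].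
have cK : compact K.
  apply: (@subclosed_compact _ _ (`[0, T] `*` `[eps, T])); last by move=> z [].
    apply: closedI; first by apply: compact_closed; [apply: hausdorff_pair; exact: Rhausdorff|apply: compact_setX; exact: segment_compact].
    apply: closed_eqfun => //.
      by move=> z; apply: continuous_comp; [exact: cvg_fst|exact: cc].
    move=> z; apply: (@continuous_comp _ _ _ (fun z : R * R => z.1 + z.2) c); last exact: cc.
    by apply: cvgD; [exact: cvg_fst|exact: cvg_snd].
  by apply: compact_setX; exact: segment_compact.
have epsT : eps <= T.
  rewrite leNgt; apply/negP => Te; have := heps 0 T; rewrite add0r => h.
  by apply: h; [lra|lra|rewrite -(pc 0) add0r].
have nK : K !=set0.
  exists (0, T); split; first by split; rewrite /= in_itv /=; lra.
  by rewrite /= add0r -(pc 0) add0r.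
have [|[t0 d0] /set_mem[[]]] := @compact_EVT_min _ R snd K nK cK.
  by apply: continuous_subspaceT => z; exact: cvg_snd.
rewrite /= !in_itv /= => t0T d0T ct0 dmin.
exists t0, d0; split; [lra|by []|].
suff main x y : 0 <= x <= T -> x < y -> y < x + d0 -> c x <> c y.
  move=> x y tx xy yt; have [xT|xT] := leP x T; first by apply: main; lra.
  have := main (x - T) (y - T) ltac:(lra) ltac:(lra) ltac:(lra).
  by rewrite -(pc (x - T)) -(pc (y - T)) !subrK.
move=> xT xy yx cxy; have [e1|e1] := ltP (y - x) eps.
  by apply: (heps x (y - x)); [lra|lra|rewrite addrC subrK].
have := dmin (x, y - x); rewrite leNgt => /(_ _)/negP; apply; last by rewrite /=; lra.
apply/mem_set; split; first by split; rewrite /= in_itv /=; lra.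
by rewrite /= addrC subrK.
Qed.

Definition circle : graph := @Graph 1 1 (fun=> ord0) (fun=> ord0).

Lemma circle_core_subspace (X : topologicalType) (c : R -> X) (t0 d0 : R) : hausdorff_space X ->
  continuous c -> 0 < d0 -> c (t0 + d0) = c t0 ->
  (forall x y, t0 <= x -> x < y -> y < t0 + d0 -> c x <> c y) ->
  exists A : set X, [/\ A `<=` range c, A !=set0 & is_core_subspace R A].
Proof.
move=> hX cc d00 cE cinj.
pose h (p : gspace R circle) := match p with Vertex _ => c t0 | Inner e t _ => c (t0 + t * d0) end.
have hE (e : 'I_1) t : 0 <= t <= 1 -> h (edge_pt (e : 'I_(nedge circle)) t) = c (t0 + t * d0).
  move=> t01; have [->|t0'] := eqVneq t 0; first by rewrite edge_pt_le0 //= mul0r addr0.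
  have [->|t1'] := eqVneq t 1; first by rewrite edge_pt_ge1 //= mul1r cE.
  have tt : 0 < t < 1 by rewrite !lt_neqAle t1' eq_sym t0'; lra.
  by rewrite edge_ptE.
have hcl (e : 'I_1) t : h (edge_pt (e : 'I_(nedge circle)) t) = c (t0 + clamp t * d0).
  have [t00|t00] := leP t 0; first by rewrite clamp_le0 // edge_pt_le0 //= mul0r addr0.
  have [t11|t11] := leP 1 t; first by rewrite clamp_ge1 // edge_pt_ge1 //= mul1r cE.
  by rewrite clamp_id ?hE //; lra.
have caff : continuous (fun t => c (t0 + clamp t * d0)).
  move=> t; apply: (@continuous_comp _ _ _ (fun t : R => t0 + clamp t * d0) c); last exact: cc.
  by apply: cvgD; [exact: cvg_cst|apply: cvgMl; exact: clamp_cont].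
have ch : continuous h.
  apply: gspace_cont => e; rewrite (_ : h \o _ = (fun t => c (t0 + clamp t * d0))) //.
  by apply/funext => t; exact: hcl.
have scale (t : R) : 0 < t < 1 -> t0 < t0 + t * d0 < t0 + d0.
  by move=> t01; have := mulr_gt0 (proj1 (andP t01)) d00; have := gtr_pMl t d00; rewrite (andP t01).2; lra.
have injh : injective h.
  move=> p q; case: (gspaceP p) => [v|e t t01]; case: (gspaceP q) => [w|e' t' t'01].
  - by rewrite (ord1 v) (ord1 w).
  - rewrite hE /=; last by lra.
    by have := scale _ t'01 => s1 /(cinj _ _ (lexx _)); case; lra.
  - rewrite hE /=; last by lra.
    by have := scale _ t01 => s1 /esym /(cinj _ _ (lexx _)); case; lra.
  - rewrite !hE; [|lra|lra]; have s1 := scale _ t01; have s2 := scale _ t'01.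
    rewrite (ord1 e) (ord1 e') => ceq; congr edge_pt.
    have [//|tt] := eqVneq t t'; exfalso.
    case: (ltgtP t t') tt => // tt _.
      by apply: (cinj _ _ _ _ _ ceq); rewrite ?ltrD2l ?ltr_pM2r //; lra.
    by apply: (cinj _ _ _ _ _ (esym ceq)); rewrite ?ltrD2l ?ltr_pM2r //; lra.
exists (range h); split.
- move=> _ [p _ <-]; case: (gspaceP p) => [v|e t t01]; first by exists t0.
  by exists (t0 + t * d0) => //; rewrite hE //; lra.
- by exists (h (Vertex R (ord0 : 'I_(nvert circle)))); exists (Vertex R (ord0 : 'I_(nvert circle))).
exists circle; split.
  move=> v; rewrite /valency (_ : finset _ = finset.setT); last first.
    by apply/setP => e; rewrite !inE (ord1 v).
  by rewrite cardsT card_ord.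
pose g x := if pselect (exists p, h p = x) is left hp then projT1 (cid hp) else Vertex R (ord0 : 'I_(nvert circle)).
have K : cancel h g.
  move=> p; rewrite /g; case: pselect => [hp|[]]; last by exists p.
  by apply: injh; case: cid.
exists h, g; split=> //.
(* A closed part of the circle is compact, and so is its image, which is therefore closed; this is
   continuity of the inverse. *)
apply/continuous_closedP => C cC; apply/closed_subspaceP.
exists (h @` C).
  apply: (compact_closed hX).
  have -> : h @` C = (fun t => c (t0 + clamp t * d0)) @` (`[0, 1] `&` edge_pt (ord0 : 'I_(nedge circle)) @^-1` C).
    apply/seteqP; split=> x /=.
      move=> [p Cp <-]; case: (gspaceP p) Cp => [v|e t t01] Cp.
        exists 0; first by rewrite in_itv /= lexx ler01 edge_pt_le0 // (ord1 v) in Cp *.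
        by rewrite clamp_le0 // mul0r addr0.
      exists t; last by rewrite -(hcl e).
      have e0 : e = ord0 := ord1 e.
      by rewrite e0 in Cp; split=> //; rewrite /= in_itv /=; lra.
    by move=> [t [t01 Ct] <-]; exists (edge_pt (ord0 : 'I_(nedge circle)) t).
  apply: continuous_compact; first exact: continuous_subspaceT.
  apply: (@subclosed_compact R _ (`[0, 1]%classic : set R)); [|exact: segment_compact|by move=> t []].
  apply: closedI; first by apply: compact_closed; [exact: Rhausdorff|exact: segment_compact].
  by move/continuous_closedP: (@edge_pt_cont R circle ord0); apply.
apply/seteqP; split=> x /=.
  by move=> [[p Cp <-] Ax]; split=> //; change (C (g (h p))); rewrite K.
move=> [Cg [p _ px]]; split; last by exists p.
by exists p => //; move: Cg; change (C (g x) -> C p); rewrite -px K.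
Qed.

(** Reduces nonemptiness of a core to exhibiting a locally injective loop in [B], which may cross
    itself. *)
Lemma max_core_loop (X : topologicalType) (c : R -> X) (T : R) (B : set X) : hausdorff_space X ->
  0 < T -> continuous c -> locinj c -> (forall t, c (t + T) = c t) -> (forall t, B (c t)) ->
  max_core R B !=set0.
Proof.
move=> hX T0 cc lc pc cB.
have [t0 [d0 [d00 cE cinj]]] := shortest_return hX T0 cc lc pc.
have [A [Ac [x Ax] hA]] := circle_core_subspace hX cc d00 cE cinj.
exists x; exists A => //; split=> // y /Ac[t _ <-]; exact: cB.
Qed.

End EmbeddedCircle.

(** * From an invariant loop to a nonempty core *)

Section InvariantLine.
Local Open Scope classical_set_scope.
Local Open Scope ring_scope.
Variables (R : realType) (G : graph).
Implicit Types (a b : int -> dart G).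

(** Conjugating the translation by [n] with [phi] gives a reparametrization of [a] onto itself,
    hence a translation by a period, which is a multiple of [n]. *)
Lemma line_degree (g : gspace R G -> gspace R G) a (n : nat) (phi : R -> R) :
  (0 < n)%N -> per a n -> (forall q, per a q -> (n %| q)%Z) -> homeoR phi ->
  (forall x, g (line a x) = line a (phi x)) ->
  exists d : nat, (0 < d)%N /\ forall x, phi (x + n%:R) = phi x + (d * n)%:R.
Proof.
move=> n0 pa mina hphi gphi; have [phi' [hphi' K K']] := homeoR_inv hphi.
have n0' : 0 < n%:R :> R by rewrite ltr0n.
have [||q [hq aq]] := @line_eq_shift R G a a (fun y => phi (phi' y + n%:R)).
- exact: (homeoR_comp hphi (homeoR_comp (homeoR_shift n%:R) hphi')).
- by move=> y; rewrite -gphi pmulrn (line_per _ pa) gphi K'.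
have pq : per a q by move=> i; rewrite -aq.
have /dvdzP[e qe] := mina q pq.
have q0 : 0 < q.
  rewrite -(ltr_int R); have := hq 0; rewrite add0r => <-.
  have : phi (phi' 0) < phi (phi' 0 + n%:R) by rewrite hphi.1 ltrDl.
  by rewrite K'.
have e0 : 0 < e by rewrite qe in q0; rewrite -(@pmulr_lgt0 _ n%:Z) //; lia.
case: e qe e0 => // d qe d0; exists d; split=> // x.
by have := hq (phi x); rewrite K qe => ->; rewrite -PoszM pmulrn.
Qed.

Lemma iter_line (g : gspace R G -> gspace R G) a (phi : R -> R) j :
  (forall x, g (line a x) = line a (phi x)) ->
  forall x, iter j g (line a x) = line a (iter j phi x).
Proof. by move=> h x; elim: j => //= j ->. Qed.

Lemma iter_degree (phi : R -> R) (n d j : nat) :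
  (forall x, phi (x + n%:R) = phi x + (d * n)%:R) ->
  forall x, iter j phi (x + n%:R) = iter j phi x + (d ^ j * n)%:R.
Proof.
move=> h; have h' (m : nat) x : phi (x + (m * n)%:R) = phi x + (m * (d * n))%:R.
  elim: m x => [|m IH] x; first by rewrite !addr0.
  by rewrite mulSn addnC natrD addrA h IH -addrA -natrD; congr (_ + _%:R); lia.
elim: j => [|j IH] x /=; first by rewrite expn0 mul1n.
by rewrite IH h' expnS; congr (_ + _%:R); lia.
Qed.

(** At level [i] the two paths are lifts through [f^(j - i)] of the same path, so they agree
    everywhere or nowhere. *)
Lemma level_const (f : gspace R G -> gspace R G) (al be : R -> gspace R G) i j t0 :
  continuous f -> locinj f -> continuous al -> continuous be -> (i <= j)%N ->
  (forall t, iter j f (al t) = iter j f (be t)) ->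
  iter i f (al t0) = iter i f (be t0) -> forall t, iter i f (al t) = iter i f (be t).
Proof.
move=> cf lf cal cbe ij ej ei t.
apply: (@lift_unique R _ _ (iter (j - i) f) (iter i f \o al) (iter i f \o be) setT t0) => //.
- exact: gspace_hausdorff.
- exact: (locinj_iter _ cf lf).2.
- exact: connectedR.
- by move=> u _; apply: continuous_comp; [exact: cal|exact: (locinj_iter _ cf lf).1].
- by move=> u _; apply: continuous_comp; [exact: cbe|exact: (locinj_iter _ cf lf).1].
- by move=> u _ /=; rewrite -!iterD subnK.
Qed.

Lemma locinj_scale (X : topologicalType) (s : R -> X) (c : R) : 0 < c -> locinj s ->
  locinj (fun t => s (c * t)).
Proof.
move=> c0 ls; apply: (@locinj_comp _ _ _ (fun t : R => c * t) s) => //.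
  exact: homeoR_cont (homeoR_scale c0).
by move=> x; exists setT; [exact: filterT|move=> u w _ _; exact: homeoR_inj (homeoR_scale c0) _ _].
Qed.

Lemma invariant_line (f : gspace R G -> gspace R G) (d : nat) (s : R -> gspace R G) :
  continuous f -> locinj f -> invariant_loop f d s ->
  exists a (n k : nat) (phi : R -> R), [/\ (0 < n)%N, (0 < k)%N, walk a /\ reducedw a,
    per a n /\ (forall q, per a q -> (n %| q)%Z) &
    [/\ homeoR phi, (forall x, iter k f (line a x) = line a (phi x)) &
      forall x, phi (x + n%:R) = phi x + (d * n)%:R]].
Proof.
move=> cf lf [d1 ls nn [k k0 hk]].
have [a [m [m0 pm wa ra hs]]] := loop_tight ls nn.
have [n [n0 pn minn]] := min_period m0 pm.
have m0' : 0 < m%:R :> R by rewrite ltr0n.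
have [cfk lfk] := locinj_iter k cf lf.
have la := @line_locinj R G a wa ra.
have [crho prho] := @line_is_loop R G _ _ wa pm.
set rho := (fun t : R => line a (m%:R * t)) in hs crho prho.
have lrho : locinj rho by exact: locinj_scale.
pose al := iter k f \o rho.
have cal : continuous al by move=> t; apply: continuous_comp; [exact: crho|exact: cfk].
have lal : locinj al by exact: locinj_comp.
have pal t : al (t + 1) = al t by rewrite /al /=; congr (iter k f _); exact: prho.
have [b [p [th [p0 pb hth thp alE]]]] := loop_line cal lal pal.
have [wb rb] := line_homeo_walk cal lal hth alE.
have p0' : 0 < p%:R :> R by rewrite ltr0n.
(* The image of the tight loop and the [d]-th power of the tight loop are both tight and freely
   homotopic, so they have the same word up to rotation. *)
have [pmd [dl hdl]] : p = (m * d)%N /\ exists dl, forall i, a i = b (i + dl).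
  apply: (@homotopic_lines R G a b p (m * d)) => //.
  - by rewrite muln_gt0 m0.
  - by move=> i; rewrite PoszM (per_mul _ pm).
  apply: (@freely_homotopic_trans _ _ _ al).
    have lb := @line_is_loop R G _ _ wb pb.
    have := @reparam_homotopic R _ _ (fun t => p%:R^-1 * th t) 1 lb.
    rewrite loop_power1 => h; apply: freely_homotopic_sym.
    rewrite (_ : al = (fun t : R => line b (p%:R * t)) \o (fun t => p%:R^-1 * th t)); last first.
      by apply/funext => t /=; rewrite alE mulVKf // gt_eqF.
    apply: h.
      by move=> t; apply: cvgM; [exact: cvg_cst|exact: homeoR_cont].
    by move=> t; rewrite thp mulrDr mulVf ?gt_eqF.
  apply: (@freely_homotopic_trans _ _ _ (iter k f \o s)).
    by apply: freely_homotopic_comp => //; exact: freely_homotopic_sym.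
  apply: (freely_homotopic_trans hk).
  rewrite (_ : (fun t : R => line a ((m * d)%:R * t)) = loop_power rho d); last first.
    by apply/funext => t; rewrite /loop_power /rho natrM mulrA.
  exact: freely_homotopic_power.
pose phi x := th (m%:R^-1 * x) - dl%:~R.
have hphi : homeoR phi.
  have h1 : homeoR (fun x : R => m%:R^-1 * x) by apply: homeoR_scale; rewrite invr_gt0.
  exact: (homeoR_comp (homeoR_shift (- dl%:~R)) (homeoR_comp hth h1)).
have fphi x : iter k f (line a x) = line a (phi x).
  have := alE (m%:R^-1 * x); rewrite /al /rho /= mulVKf ?gt_eqF // => ->.
  have -> : line a (phi x) = line b (phi x + dl%:~R) :> gspace R G.
    by rewrite line_shift; congr line; apply/funext => i.
  by rewrite subrK.
have [e [e0 he]] := line_degree n0 pn minn hphi fphi.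
exists a, n, k, phi; split=> //; split=> // x.
rewrite he; congr (_ + _%:R); congr (_ * _)%N.
(* The degree [e] of [phi] refers to the minimal period [n], whereas [d] was read off over the
   period [m] of the tight loop. Evaluating [phi] over [m] identifies them. *)
have /dvdzP[c mc] := minn m pm.
have c0 : 0 < c by move: m0; rewrite -ltz_nat mc; nia.
case: c mc c0 => // c mc c0.
have mcn : m = (c * n)%N by lia.
have hc (j : nat) y : phi (y + (j * n)%:R) = phi y + (j * (e * n))%:R.
  elim: j y => [|j IH] y; first by rewrite !addr0.
  by rewrite mulSn addnC natrD addrA he IH -addrA -natrD; congr (_ + _%:R); lia.
have := hc c 0; rewrite -mcn /phi !add0r mulVf ?gt_eqF // mulr0.
rewrite -{1}[1]add0r thp pmd addrAC => /addrI/eqP; rewrite eqr_nat mcn => /eqP E.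
have : (c * n * e = c * n * d)%N by lia.
by move/eqP; rewrite eqn_mul2l => /orP[/eqP|/eqP //]; lia.
Qed.

Lemma invariant_loop_hat (f : gspace R G -> gspace R G) (d : nat) (s : R -> gspace R G) :
  continuous f -> locinj f -> (2 <= d)%N -> invariant_loop f d s ->
  forall N, hatGamma f N !=set0.
Proof.
move=> cf lf d2 hs N.
have [a [n [k [phi [n0 k0 [wa ra] [pa mina] [hphi fphi degphi]]]]]] := invariant_line cf lf hs.
have hG := @gspace_hausdorff R G.
have la := @line_locinj R G a wa ra; have ca := @line_cont R G a wa.
have [phi' [hphi' K K']] := homeoR_inv hphi.
have n0' : 0 < n%:R :> R by rewrite ltr0n.
(* [a] and [a \o psi] have the same image under [f^k], but [psi] moves points by
   less than the period [n] because [d] is at least 2. *)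
pose psi x := phi' (phi x + n%:R).
have hpsi : homeoR psi by exact: (homeoR_comp hphi' (homeoR_comp (homeoR_shift n%:R) hphi)).
have phi'n x : phi' (x + (d * n)%:R) = phi' x + n%:R.
  by apply: (homeoR_inj hphi); rewrite K' degphi K'.
have psin x : psi (x + n%:R) = psi x + n%:R.
  by rewrite /psi degphi addrAC phi'n.
have cfi j := (locinj_iter j cf lf).1; have lfi j := (locinj_iter j cf lf).2.
pose Q := iter N phi'; pose P := iter N phi.
have hQ : homeoR Q by exact: homeoR_iter.
have PQ x : P (Q x) = x.
  by rewrite /P /Q; elim: N x {hQ P Q} => //= j IH x; rewrite -[phi' (iter j phi' x)]/(iter j.+1 phi' x) iterSr IH K'.
have hP : homeoR P by exact: homeoR_iter.
(* [Q] contracts [d ^ N] periods to one, so this is the period of the precomposed paths. *)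
pose T : nat := (d ^ N * n)%N.
have T0 : 0 < T%:R :> R by rewrite ltr0n muln_gt0 expn_gt0 n0 (ltnW d2).
have QT x : Q (x + T%:R) = Q x + n%:R.
  by apply: (homeoR_inj hP); rewrite PQ /P (iter_degree N degphi) -/P PQ.
have psiT x : psi (x + T%:R) = psi x + T%:R.
  rewrite /T; elim: (d ^ N)%N x => [|j IH] x; first by rewrite !addr0.
  by rewrite mulSn natrD !addrA IH psin.
have ne x : line a x <> line a (psi x) :> gspace R G.
  (* A single coincidence would spread to the whole line by unique lifting, and [psi] would be a
     translation by a period strictly between 0 and [n]. *)
  move=> e; have hall y : line a (psi y) = line a y :> gspace R G.
    apply/esym; apply: (@lift_unique R _ _ (iter k f) (line a) (line a \o psi) setT x) => //.
    - exact: connectedR.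
    - by move=> t _; exact: ca.
    - by move=> t _; apply: (@continuous_comp _ _ _ psi (line a)); [exact: homeoR_cont|exact: ca].
    - by move=> t _ /=; rewrite !fphi /psi K' pmulrn (line_per _ pa).
  have [q [hq aq]] := line_eq_shift hpsi hall.
  have pq : per a q by move=> i; rewrite -aq.
  have /dvdzP[c qc] := mina q pq.
  have q1 : 0 < q.
    rewrite -(ltr_int R); have := hq 0; rewrite add0r => <-.
    have : phi' (phi 0) < psi 0 by rewrite hphi'.1 ltrDl.
    by rewrite K.
  have q2 : q < n.
    rewrite -(ltr_int R); have := hq 0; rewrite add0r => <-.
    have : psi 0 < phi' (phi 0 + (d * n)%:R) by rewrite hphi'.1 ltrD2l ltr_nat; nia.
    by rewrite phi'n K add0r.
  move: q1 q2; rewrite qc pmulr_lgt0 //; clear -n0; case: c => // -[//|c] _ h1.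
  by rewrite -PoszM ltz_nat mulSn ltnNge leq_addr in h1.
pose al := line a \o Q : R -> gspace R G; pose be := (line a \o Q) \o psi : R -> gspace R G.
have cal : continuous al by move=> t; apply: continuous_comp; [exact: homeoR_cont|exact: ca].
have cbe : continuous be by move=> t; apply: continuous_comp; [exact: homeoR_cont|exact: cal].
have fal x : iter (N * k) f (al x) = line a x by rewrite iterM (iter_line _ fphi) -/P PQ.
have fbe x : iter (N * k) f (be x) = line a (psi x) by rewrite iterM (iter_line _ fphi) -/P PQ.
have fE x : iter (k + N * k) f (al x) = iter (k + N * k) f (be x).
  by rewrite !iterD fal fbe !fphi /psi K' pmulrn (line_per _ pa).
(* [J] is the first level at which the two paths coincide. It exceeds [N * k], where they are still
   [line a] and [line a \o psi]; starting at level [J - N] they need exactly [N] steps. *)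
have exJ : exists J, iter J f (al 0) == iter J f (be 0) by exists (k + N * k)%N; rewrite fE.
have [J /eqP eJ minJ] := ex_minnP exJ.
have NJ : (N * k < J)%N.
  rewrite ltnNge; apply/negP => JN; apply: (ne 0); rewrite -fal -fbe.
  by rewrite -(subnK JN) !iterD eJ.
have all_J t : iter J f (al t) = iter J f (be t).
  have lJ : (J <= k + N * k)%N by apply: minJ; rewrite fE.
  by apply: (level_const cf lf cal cbe lJ fE eJ).
have none t j : (j < J)%N -> iter j f (al t) <> iter j f (be t).
  move=> jJ e; have := level_const cf lf cal cbe (ltnW jJ) all_J e 0.
  by move/eqP/minJ; rewrite leqNgt jJ.
have NJ' : (N <= J)%N by apply: leq_trans (ltnW NJ); rewrite leq_pmulr.
pose c t := (iter (J - N) f (al t), iter (J - N) f (be t)).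
apply: (@max_core_loop R _ c T%:R) => //.
- exact: hausdorff_pair.
- move=> t; apply: (@cont_pair _ _ _ (iter (J - N) f \o al) (iter (J - N) f \o be)).
    by apply: continuous_comp; [exact: cal|exact: cfi].
  by apply: continuous_comp; [exact: cbe|exact: cfi].
- have lal : locinj al.
    apply: locinj_comp => //; first exact: homeoR_cont.
    by move=> x; exists setT; [exact: filterT|move=> u w _ _; exact: homeoR_inj].
  move=> t; have [A nA iA] := locinj_comp cal lal (lfi (J - N)%N) t.
  by exists A => // u w Au Aw [e _]; apply: iA.
- by move=> t; rewrite /c /be /al /= psiT !QT !pmulrn !(line_per _ pa).
move=> t; split; first by rewrite /Gamma /= -!iterD subnKC.
case EN: N => [|N']; first by [].
move=> h; have {h} : iter N' f (c t).1 = iter N' f (c t).2 by exact: h.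
by rewrite /c /= -!iterD; apply: none; move: NJ'; rewrite EN; lia.
Qed.

End InvariantLine.

(** * From a nonempty core to an invariant loop *)

Section CoreLoops.
Local Open Scope classical_set_scope.
Local Open Scope ring_scope.
Variables (R : realType) (G : graph).
Implicit Types (f : gspace R G -> gspace R G).

Lemma iter_periodic (T : finType) (g : T -> T) (x : T) :
  exists y n, (0 < n)%N /\ iter n g y = y.
Proof.
have /trajectP[i io e] := looping_order g x.
exists (iter i g x), (order g x - i)%N; split; first by rewrite subn_gt0.
by rewrite -iterD subnK // ltnW.
Qed.

(** Valency at least 2 allows a fixed choice of a successor without backtracking for each dart;
    iterated on finitely many darts, it becomes periodic. *)
Lemma reduced_cycle (H : graph) (v : 'I_(nvert H)) :
  (forall v : 'I_(nvert H), (2 <= valency v)%N) ->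
  exists (a : int -> dart H) (n : nat), [/\ (0 < n)%N, per a n, walk a & reducedw a].
Proof.
move=> v2.
have ex (x : dart H) : exists b, dsrc b = dtgt x /\ b <> drev x.
  have := v2 (dtgt x); rewrite -card_darts (cardsD1 (drev x)) => h.
  have : (0 < #|([set b : dart H | dsrc b == dtgt x] :\ drev x)%SET|)%N.
    by move: h; case: (_ \in _) => /=; lia.
  by move/card_gt0P => [b]; rewrite !inE => /andP[/eqP bx /eqP bv]; exists b.
have [g hg] := choice ex.
have [x0 _] : exists x : dart H, dsrc x == v.
  have : (0 < #|[set b : dart H | dsrc b == v]%SET|)%N by rewrite card_darts; have := v2 v; lia.
  by move/card_gt0P => [b]; rewrite !inE => bv; exists b.
have [y [n [n0 ny]]] := iter_periodic g x0.
pose a (z : int) := iter `|(z %% n)%Z|%N g y.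
have aS z : a (z + 1) = g (a z).
  rewrite /a; have zn := ltz_pmod z (n0 : 0 < n%:Z); have z0 : 0 <= (z %% n)%Z by apply: modz_ge0; lia.
  rewrite -modzDml; case: (z %% n)%Z zn z0 => // m mn _.
  rewrite -PoszD addn1 modz_nat !absz_nat.
  have [e|e] := eqVneq m.+1 n; first by rewrite e modnn -iterS e ny.
  by rewrite modn_small //; lia.
exists a, n; split=> //.
- by move=> z; rewrite /a modzDr.
- by move=> z; rewrite aS (hg (a z)).1.
- by move=> z; rewrite aS; exact: (hg (a z)).2.
Qed.

Lemma hatGamma_loops f (N : nat) : continuous f -> locinj f -> hatGamma f N !=set0 ->
  exists (al be : R -> gspace R G) (T : R), [/\ 0 < T,
    [/\ continuous al, locinj al & forall t, al (t + T) = al t],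
    [/\ continuous be, locinj be & forall t, be (t + T) = be t],
    (forall t, iter N f (al t) = iter N f (be t)) &
    forall j t, (j < N)%N -> iter j f (al t) <> iter j f (be t)].
Proof.
move=> cf lf [x [A [AG [H [v2 [h [g [ch rh _ K]]]]]] Ax]].
have [v _] : exists v : 'I_(nvert H), True.
  have [p _ _] : range h x by rewrite rh.
  by case: p => [v|e _ _]; [exists v|exists (src e)].
have [a [n [n0 pa wa ra]]] := reduced_cycle v v2.
have cfi j := (locinj_iter j cf lf).1; have lfi j := (locinj_iter j cf lf).2.
pose c := h \o line a : R -> gspace R G * gspace R G.
have cc : continuous c by move=> t; apply: continuous_comp; [exact: line_cont|exact: ch].
have lc : locinj c.
  apply: locinj_comp; [exact: line_cont|exact: line_locinj|].
  by move=> y; exists setT; [exact: filterT|move=> u w _ _; exact: (can_inj K)].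
have pc t : c (t + n%:R) = c t by rewrite /c /= pmulrn (line_per _ pa).
have cG t : (Gamma f N `\` Gamma_pred f N) (c t).
  by apply: AG; rewrite -rh; exists (line a t).
have c1 : continuous (fst \o c) by move=> t; apply: continuous_comp; [exact: cc|exact: cvg_fst].
have c2 : continuous (snd \o c) by move=> t; apply: continuous_comp; [exact: cc|exact: cvg_snd].
(* In [Gamma f N] either coordinate locally determines the other through the local injection [f^N],
   so each projection of [c] remains locally injective. *)
have lproj (p q : gspace R G * gspace R G -> gspace R G) :
    continuous (q \o c) ->
    (forall u w, p u = p w -> q u = q w -> u = w) ->
    (forall t, iter N f (p (c t)) = iter N f (q (c t))) -> locinj (p \o c).
  move=> cq pq e t; have [U nU iU] := lc t; have [V nV iV] := lfi N (q (c t)).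
  exists (U `&` (q \o c) @^-1` V); first by apply: filterI => //; exact: cq.
  move=> u w /set_mem[Uu Vu] /set_mem[Uw Vw] /= puw.
  apply: iU; [exact/mem_set|exact/mem_set|apply: pq => //].
  by apply: iV; [exact/mem_set|exact/mem_set|rewrite -!e puw].
exists (fst \o c), (snd \o c), n%:R; split.
- by rewrite ltr0n.
- split=> //; last by move=> t; rewrite /= pc.
  apply: (lproj _ snd) => //; first by move=> [? ?] [? ?] /= -> ->.
  by move=> t; exact: (cG t).1.
- split=> //; last by move=> t; rewrite /= pc.
  apply: (lproj _ fst) => //; first by move=> [? ?] [? ?] /= -> ->.
  by move=> t; apply/esym; exact: (cG t).1.
- by move=> t; exact: (cG t).1.
move=> j t; have [_] := cG t; case: N {lproj cG AG} => // N nN jN e; apply: nN.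
change (iter N f (c t).1 = iter N f (c t).2).
by rewrite -(subnK (jN : (j <= N)%N)) !iterD; congr (iter _ f _).
Qed.

Lemma loop_word (al : R -> gspace R G) (T : R) : 0 < T -> continuous al -> locinj al ->
  (forall t, al (t + T) = al t) ->
  exists a (n : nat) th, [/\ (0 < n)%N, per a n /\ (forall q, per a q -> (n %| q)%Z),
    walk a /\ reducedw a, homeoR th & forall t, al t = line a (th t)].
Proof.
move=> T0 ca la pa; have [a [m [th [m0 pm hth _ alE]]]] := loop_line_period T0 ca la pa.
have [n [n0 pn mn]] := min_period m0 pm.
by exists a, n, th; split=> //; exact: (line_homeo_walk ca la hth alE).
Qed.

Lemma inner_near (al : R -> gspace R G) t : {for t, continuous al} -> ~~ is_vert (al t) ->
  \forall s \near t, ~~ is_vert (al s).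
Proof.
move=> ca nv; apply: (ca [set p | ~~ is_vert p]); move: nv.
case: (gspaceP (al t)) => // e u u01 _; apply: nbhs_edge => //.
have h0 : \forall w \near u, 0 < w by apply: lt_nbhsr; lra.
have h1 : \forall w \near u, w < 1 by apply: lt_nbhsl; lra.
near=> w; have w01 : 0 < w < 1 by apply/andP; split; near: w.
by rewrite /= (edge_ptE _ w01).
Unshelve. all: by end_near. Qed.

(* A locally injective path cannot turn inside an edge. *)
Lemma germ_eq (F : gspace R G -> gspace R G) (A A' : R -> gspace R G) (x0 e : R) (b b' : dart G) :
  0 < e -> continuous A -> locinj A -> continuous A' -> locinj A' ->
  (forall t, x0 - e <= t <= x0 -> A t = A' t) -> ~~ is_vert (A x0) ->
  (forall s, 0 <= s <= 1 -> F (A (x0 + s)) = dart_pt b s) ->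
  (forall s, 0 <= s <= 1 -> F (A' (x0 + s)) = dart_pt b' s) -> b = b'.
Proof.
move=> e0 cA lA cA' lA' AA' nv hb hb'.
have nv' : ~~ is_vert (A' x0) by rewrite -AA' //; lra.
have : nbhs x0 ([set s | ~~ is_vert (A s)] `&` [set s | ~~ is_vert (A' s)]).
  by apply: filterI; [exact: inner_near (cA x0) nv|exact: inner_near (cA' x0) nv'].
move=> /nbhs_ballP[d /= d0 hd].
pose m := Num.min d (Num.min e 1).
have [m0 [md [me m1]]] : 0 < m /\ m <= d /\ m <= e /\ m <= 1.
  by rewrite /m; clear -d0 e0; case: (leP e 1) => h1; [case: (leP d e)|case: (leP d 1)] => h2; (split; [|split; [|split]]); lra.
have hm t : x0 - m < t < x0 + m -> ~~ is_vert (A t) /\ ~~ is_vert (A' t).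
  by move=> tm; apply: hd; rewrite /ball /= ltr_norml; lra.
have ss : x0 - m < x0 + m by lra.
have [a [r [hr rc rm]]] := inner_dart ss cA (locinj_locinj_on lA) (fun t h => (hm t h).1).
have [a' [r' [hr' rc' rm']]] := inner_dart ss cA' (locinj_locinj_on lA') (fun t h => (hm t h).2).
have eqt t : x0 - m < t <= x0 -> a = a' /\ r t = r' t \/ a' = drev a /\ r' t = 1 - r t.
  move=> tm; have [r01 aE] := hr t ltac:(lra); have [_ aE'] := hr' t ltac:(lra).
  by apply: dart_pt_inj => //; rewrite -aE -aE' AA' //; lra.
have aa : a = a'.
  have := eqt (x0 - m / 2) ltac:(lra); have := eqt x0 ltac:(lra).
  case=> [[//]|[_ h1]] [[//]|[_ h2]].
  have := rm (x0 - m / 2) x0 ltac:(lra) ltac:(lra) ltac:(lra).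
  have := rm' (x0 - m / 2) x0 ltac:(lra) ltac:(lra) ltac:(lra).
  rewrite h1 h2 => u w; exfalso; lra.
have r0 : r x0 = r' x0.
  by have := eqt x0 ltac:(lra); case=> [[]//|[]]; rewrite -aa => /esym/eqP; rewrite (negbTE (drev_neq _)).
(* By time [x0 + m / 4] the faster path has passed, at some time [s], through the point reached by
   the other. The images under [F] agree there at parameters below 1/2, which identifies the
   darts. *)
have key (B B' : R -> gspace R G) (q q' : R -> R) (c c' : dart G) :
    (forall t, x0 - m < t < x0 + m -> B t = dart_pt a (q t)) ->
    (forall t, x0 - m < t < x0 + m -> B' t = dart_pt a (q' t)) ->
    (forall x y, x0 - m < x -> x < y -> y < x0 + m -> q x < q y) ->
    (forall t, x0 - m < t < x0 + m -> {for t, continuous q'}) -> q x0 = q' x0 ->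
    (forall s, 0 <= s <= 1 -> F (B (x0 + s)) = dart_pt c s) ->
    (forall s, 0 <= s <= 1 -> F (B' (x0 + s)) = dart_pt c' s) ->
    q (x0 + m / 4) <= q' (x0 + m / 4) -> c = c'.
  move=> hB hB' qm qc' q0 hc hc' qq.
  have cI : {within `[x0, x0 + m / 4], continuous q'}.
    by apply: continuous_in_subspaceT => t; rewrite inE /= in_itv /= => tt; apply: qc'; lra.
  have q1 : q x0 < q (x0 + m / 4) by apply: qm; lra.
  have [||s] := @IVT R q' x0 (x0 + m / 4) (q (x0 + m / 4)) _ cI; first by lra.
    by rewrite -q0 min_l ?max_r; lra.
  rewrite in_itv /= => st sE.
  have s0 : x0 < s.
    by rewrite lt_neqAle; apply/andP; split; [apply/eqP => xs; move: q1; rewrite -sE -xs q0 ltxx|lra].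
  have hs := hB' s ltac:(lra); have ht := hB (x0 + m / 4) ltac:(lra).
  have E : dart_pt c (m / 4) = dart_pt c' (s - x0) :> gspace R G.
    rewrite -hc ?ht -?hc'; [|lra|lra].
    by rewrite (_ : x0 + (s - x0) = s) ?hs ?sE //; lra.
  have u1 : 0 < m / 4 < 1 / 2 by clear -m0 m1; lra.
  have u2 : s - x0 < 1 / 2 by clear -st m1; lra.
  by have [] := dart_pt_inj_half u1 u2 E.
have hrA t : x0 - m < t < x0 + m -> A t = dart_pt a (r t) by move=> /hr[].
have hrA' t : x0 - m < t < x0 + m -> A' t = dart_pt a (r' t) by rewrite aa => /hr'[].
have [le|lt] := leP (r (x0 + m / 4) : R) (r' (x0 + m / 4) : R).
  exact: (key A A' r r' b b' hrA hrA' rm rc' r0 hb hb' le).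
exact/esym/(key A' A r' r b' b hrA' hrA rm' rc (esym r0) hb' hb (ltW lt)).
Qed.

End CoreLoops.

(** * Bounds on the periods of words *)

Section PeriodBounds.
Local Open Scope classical_set_scope.
Local Open Scope ring_scope.
Variables (R : realType) (G : graph).
Implicit Types (F : gspace R G -> gspace R G) (a b g : int -> dart G).

Lemma pigeonhole (T : finType) (n : nat) (F : 'I_n -> T) : (#|T| < n)%N ->
  exists i j : 'I_n, (i < j)%N /\ F i = F j.
Proof.
move=> h; have /injectivePn[i [j ij e]] : ~~ injectiveb F.
  by apply/injectiveP => /leq_card; rewrite card_ord leqNgt h.
have := ij; rewrite -val_eqE neq_ltn => /orP[lt|lt]; first by exists i, j.
by exists j, i.
Qed.

Lemma cont_shift (c : R) : continuous (fun x : R => x + c).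
Proof. exact: homeoR_cont (homeoR_shift c). Qed.

Lemma lift_segment F (A : R -> gspace R G) g (z w : int) t0 : locinj F -> walk g ->
  continuous A -> (forall x, F (A x) = line g x) -> g z = g w ->
  z%:~R <= t0 <= z%:~R + 1 -> A t0 = A (t0 + (w - z)%:~R) ->
  forall t, z%:~R <= t <= z%:~R + 1 -> A t = A (t + (w - z)%:~R).
Proof.
move=> lF wg cA FA gzw t01 e t tz.
apply: (@lift_unique R _ _ F A (fun x => A (x + (w - z)%:~R)) `[z%:~R, z%:~R + 1] t0) => //.
- exact: gspace_hausdorff.
- by apply/connected_intervalP; exact: interval_is_interval.
- by move=> x _; exact: cA.
- move=> x _; apply: (@continuous_comp _ _ _ (fun x : R => x + (w - z)%:~R) A); last exact: cA.
  exact: cont_shift.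
- move=> x; rewrite /= in_itv /= => xz; rewrite !FA (line_itvc wg xz).
  rewrite (@line_itvc R G g w); [|by []|by rewrite intrB; lra].
  by rewrite gzw; congr dart_pt; rewrite intrB; lra.
Qed.

(* At each vertex of the line one of the two lifts is inside an edge, where it
   can be continued in one way only. Hence the line and its lifts are determined
   by one dart of the line and the two points of the lifts over its middle. *)
Lemma common_image_period F (S L : nat) (A B : R -> gspace R G) g :
  continuous F -> locinj F ->
  (forall x, ~~ is_vert x -> exists2 s, (size s <= S)%N & forall y, F y = x -> y \in s) ->
  continuous A -> locinj A -> continuous B -> locinj B -> walk g -> (0 < L)%N -> per g L ->
  (forall x, F (A x) = line g x) -> (forall x, F (B x) = line g x) ->
  (forall x, ~~ (is_vert (A x) && is_vert (B x))) ->
  exists p : nat, [/\ (0 < p)%N, (p <= nedge G * 2 * (S.+1 * S.+1))%N & per g p].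
Proof.
move=> cF lF hS cA lA cB lB wg L0 pg FA FB nAB.
have hS' (c : dart G) : exists s : seq (gspace R G), (size s <= S)%N /\
    forall y, F y = dart_pt c (1 / 2) -> y \in s.
  have [|s s1 s2] := hS (dart_pt c (1 / 2)); last by exists s.
  by rewrite is_vert_dart negbK; lra.
have [ss hss] := choice hS'.
have half (z : int) : line g (z%:~R + 1 / 2) = dart_pt (g z) (1 / 2) :> gspace R G.
  by rewrite (@line_itv R G g z); [congr dart_pt; lra|lra].
(* The point of a lift over the middle of an edge is recorded by its rank in a list of all
   preimages, so that states form a finite type. *)
pose ix (C : R -> gspace R G) (z : int) : 'I_S.+1 := inord (index (C (z%:~R + 1 / 2)) (ss (g z))).
have ixE (C : R -> gspace R G) (z w : int) : (forall x, F (C x) = line g x) -> g z = g w ->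
    ix C z = ix C w -> C (z%:~R + 1 / 2) = C (w%:~R + 1 / 2).
  move=> FC gzw /(congr1 val).
  have mem (u : int) : C (u%:~R + 1 / 2) \in ss (g u) by apply: (hss (g u)).2; rewrite FC half.
  have lt (u : int) : (index (C (u%:~R + 1 / 2)%R) (ss (g u)) < S.+1)%N.
    by apply: (@leq_trans (size (ss (g u)))); [rewrite index_mem|apply: leqW; exact: (hss (g u)).1].
  rewrite /= !inordK // => e.
  by rewrite -(nth_index (C 0) (mem z)) e gzw nth_index.
pose same (z w : int) := [/\ g z = g w, A (z%:~R + 1 / 2) = A (w%:~R + 1 / 2) &
  B (z%:~R + 1 / 2) = B (w%:~R + 1 / 2)].
have step z w : same z w -> same (z + 1) (w + 1).
  move=> [gzw Az Bz].
  have shE (y : R) : w%:~R + y = z%:~R + y + (w - z)%:~R by rewrite intrB; clear; lra.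
  rewrite shE in Az; rewrite shE in Bz.
  have zz : z%:~R <= z%:~R + (1 / 2 : R) <= z%:~R + 1 by clear; lra.
  have segA := lift_segment lF wg cA FA gzw zz Az.
  have segB := lift_segment lF wg cB FB gzw zz Bz.
  have gS : g (z + 1) = g (w + 1).
    have germ (C : R -> gspace R G) : continuous C -> locinj C -> (forall x, F (C x) = line g x) ->
        (forall t, z%:~R <= t <= z%:~R + 1 -> C t = C (t + (w - z)%:~R)) ->
        ~~ is_vert (C (z%:~R + 1)) -> g (z + 1) = g (w + 1).
      move=> cC lC FC segC nC.
      apply: (@germ_eq R G F C (fun x => C (x + (w - z)%:~R)) (z%:~R + 1) 1) => //.
      - move=> x; apply: (@continuous_comp _ _ _ (fun x : R => x + (w - z)%:~R) C); last exact: cC.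
        exact: cont_shift.
      - apply: (@locinj_comp _ _ _ (fun x : R => x + (w - z)%:~R) C) => //.
          exact: cont_shift.
        by move=> x; exists setT; [exact: filterT|move=> u v _ _ /addIr].
      - by move=> t tz; apply: segC; rewrite addrK in tz.
      - move=> s s01; rewrite FC (@line_itvc R G g (z + 1)) //; last by rewrite intrD; clear -s01; lra.
        by congr dart_pt; rewrite intrD; clear; lra.
      - move=> s s01; rewrite FC (@line_itvc R G g (w + 1)) //; last by rewrite intrB intrD; clear -s01; lra.
        by congr dart_pt; rewrite intrB intrD; clear; lra.
    have := nAB (z%:~R + 1); rewrite negb_and => /orP[]; [exact: germ|exact: germ].
  have zS : (z + 1)%:~R <= (z%:~R + 1 : R) <= (z + 1)%:~R + 1 by rewrite intrD; clear; lra.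
  have zS' : (z + 1)%:~R <= (z + 1)%:~R + (1 / 2 : R) <= (z + 1)%:~R + 1 by clear; lra.
  have dE : w + 1 - (z + 1) = w - z by clear; lia.
  have shE' : (w + 1)%:~R + 1 / 2 = (z + 1)%:~R + 1 / 2 + (w - z)%:~R :> R.
    by rewrite intrB !intrD; clear; lra.
  split=> //; rewrite shE' -dE.
    apply: (lift_segment lF wg cA FA gS zS _ zS'); rewrite dE; apply: segA; clear; lra.
  apply: (lift_segment lF wg cB FB gS zS _ zS'); rewrite dE; apply: segB; clear; lra.
pose state (i : 'I_(nedge G * 2 * (S.+1 * S.+1)).+1) : (dart G * ('I_S.+1 * 'I_S.+1))%type :=
  (g i%:Z, (ix A i%:Z, ix B i%:Z)).
have [|i [j [ij []]]] := pigeonhole state.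
  by rewrite !card_prod !card_ord card_bool.
move=> gij Aij Bij; have jQ : (j <= nedge G * 2 * (S.+1 * S.+1))%N by rewrite -ltnS.
have s0 : same i%:Z j%:Z by split=> //; apply: ixE.
exists (j - i)%N; split; [by rewrite subn_gt0|exact: leq_trans (leq_subr _ _) jQ|].
have sm (m : nat) : same (i%:Z + m) (j%:Z + m).
  elim: m => [|m IH]; first by rewrite !addr0.
  by rewrite (intS m) (addrC 1) !addrA; exact: step.
(* The automaton only runs forward from [i]; adding a large multiple of the known period [L] brings
   any [z] beyond [i]. *)
move=> z; pose c : int := (absz z + i)%N.
have pc := per_mul c pg.
have [m mE] : exists m : nat, z + L%:Z * c = i%:Z + m.
  exists (absz (z + L%:Z * c - i%:Z)%R); rewrite gez0_abs; first by lia.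
  have : c <= L%:Z * c by rewrite ler_peMl.
  by rewrite /c; lia.
have [e _ _] := sm m.
rewrite -[LHS]pc -[RHS]pc mE e; congr g.
by rewrite addrAC mE -subzn ?(ltnW ij) //; lia.
Qed.

(** If [n] were larger, two integers less than [n] apart would have the same vertex on [a] and the
    same phase on [b] modulo [r]. Unique lifting through [F] would make their difference a period of
    [a]. *)
Lemma period_bound F a (n : nat) b (r : nat) phi : continuous F -> locinj F ->
  (forall v, is_vert (F (Vertex R v))) -> walk a ->
  (0 < n)%N -> (forall q, per a q -> (n %| q)%Z) ->
  (0 < r)%N -> per b r -> homeoR phi -> (forall x, F (line a x) = line b (phi x)) ->
  (n <= nvert G * r)%N.
Proof.
move=> cF lF vF wa n0 mina r0 pb hphi Fphi.
have [phi' [hphi' K K']] := homeoR_inv hphi.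
have vZ (i : int) : exists k : int, phi i%:~R = k%:~R.
  have : is_vert (line b (phi i%:~R) : gspace R G) by rewrite -Fphi line_int.
  by move/is_vert_line.
have [k hk] := choice vZ.
rewrite leqNgt; apply/negP => h.
have r0' : 0 < r%:Z by [].
have kr i : (`|(k i %% r)%Z| < r)%N.
  by have := ltz_pmod (k i) r0'; have := modz_ge0 (k i) (lt0r_neq0 r0'); lia.
pose st (i : 'I_n) : ('I_(nvert G) * 'I_r)%type := (dsrc (a i%:Z), Ordinal (kr i%:Z)).
have [|i [j [ij []]]] := pigeonhole st; first by rewrite card_prod !card_ord.
move=> vij /(congr1 Posz); rewrite !gez0_abs ?modz_ge0 ?lt0r_neq0 // => e.
have [c hc] : exists c : int, k j%:Z = k i%:Z + c * r%:Z.
  by exists ((k j%:Z %/ r)%Z - (k i%:Z %/ r)%Z); have := divz_eq (k j%:Z) r; have := divz_eq (k i%:Z) r; rewrite e; lia.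
pose psi x := phi' (phi x + (c * r%:Z)%:~R).
have hpsi : homeoR psi by exact: (homeoR_comp hphi' (homeoR_comp (homeoR_shift _) hphi)).
have psii : psi (i%:Z)%:~R = (j%:Z)%:~R.
  by rewrite /psi hk -intrD -hc -hk K.
have pbc : per b (c * r%:Z) by rewrite mulrC; exact: per_mul.
have hall x : line a (psi x) = line a x :> gspace R G.
  apply/esym; apply: (@lift_unique R _ _ F (line a) (line a \o psi) setT (i%:Z)%:~R) => //.
  - exact: gspace_hausdorff.
  - exact: connectedR.
  - by move=> t _; exact: line_cont.
  - by move=> t _; apply: (@continuous_comp _ _ _ psi (line a)); [exact: homeoR_cont|exact: line_cont].
  - by move=> t _ /=; rewrite !Fphi /psi K' line_per.
  - by rewrite /= psii !line_int vij.
have [q [hq aq]] := line_eq_shift hpsi hall.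
have pq : per a q by move=> z; rewrite -aq.
have qE : q = j%:Z - i%:Z.
  by have := hq (i%:Z)%:~R; rewrite psii -intrD => /intr_inj; lia.
have h' : (n %| j - i)%N by have := mina q pq; rewrite qE subzn ?(ltnW ij).
by have := dvdn_leq _ h'; rewrite subn_gt0 ij => /(_ isT); have := ltn_ord j; lia.
Qed.

End PeriodBounds.

(** * Repetition of words among the levels *)

Section HatInvariantLoop.
Local Open Scope classical_set_scope.
Local Open Scope ring_scope.
Variables (R : realType) (G : graph).
Implicit Types (f : gspace R G -> gspace R G) (a b g : int -> dart G).

Lemma line_invariant_loop f a (n k d : nat) (phi : R -> R) : walk a -> reducedw a ->
  (0 < n)%N -> per a n -> (0 < k)%N -> (0 < d)%N -> homeoR phi ->
  (forall x, iter k f (line a x) = line a (phi x)) ->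
  (forall x, phi (x + n%:R) = phi x + (d * n)%:R) ->
  invariant_loop f d (fun t => line a (n%:R * t)).
Proof.
move=> wa ra n0 pa k0 d0 hphi fphi degphi.
have n0' : n%:R != 0 :> R by rewrite pnatr_eq0; lia.
have ls := @line_is_loop R G _ _ wa pa.
split=> //; first exact: line_not_null.
exists k => //.
have -> : iter k f \o (fun t => line a (n%:R * t)) =
    (fun t : R => line a (n%:R * t)) \o (fun t => n%:R^-1 * phi (n%:R * t)).
  by apply/funext => t /=; rewrite fphi mulVKf.
apply: reparam_homotopic => //.
  move=> t; apply: cvgM; first exact: cvg_cst.
  apply: (@continuous_comp _ _ _ (fun t : R => n%:R * t) phi); last exact: homeoR_cont.
  by apply: homeoR_cont; apply: homeoR_scale; rewrite ltr0n.
by move=> t; rewrite mulrDr mulr1 degphi mulrDr natrM mulrCA mulVf // mulr1.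
Qed.

(** Two vertices follow an orbit in the set of pairs, which repeats at some [i < j <= M]. As the
    pair at time [j] merges after [M - j] steps, so does the pair at time [i], before level [N]. *)
Lemma never_both_vertices f (D : description G) (al be : R -> gspace R G) (N : nat) :
  describes D f -> (nvert G * nvert G <= N)%N ->
  (forall t, iter N f (al t) = iter N f (be t)) ->
  (forall j t, (j < N)%N -> iter j f (al t) <> iter j f (be t)) ->
  forall t, ~~ (is_vert (iter (N - nvert G * nvert G) f (al t)) &&
                is_vert (iter (N - nvert G * nvert G) f (be t))).
Proof.
move=> [fv _] MN eN neq t; set M := (nvert G * nvert G)%N in MN *.
apply/negP => /andP[].
case Ea : (iter _ f (al t)) => [v|//] _; case Eb : (iter _ f (be t)) => [w|//] _.
have itv j u : iter j f (Vertex R u) = Vertex R (iter j (vimage D) u).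
  by elim: j => //= j ->; rewrite fv.
pose st (i : 'I_M.+1) := (iter i (vimage D) v, iter i (vimage D) w).
have [|i [j [ij [e1 e2]]]] := pigeonhole st; first by rewrite card_prod !card_ord.
have jM : (j <= M)%N by rewrite -ltnS.
apply: (neq ((M - j + i) + (N - M))%N t); first by lia.
rewrite !(iterD _ (N - M)) Ea Eb !(iterD (M - j) i) (itv i) (itv i) e1 e2.
rewrite -!itv -!iterD subnK // -Ea -Eb -!iterD subnKC //.
Qed.

Lemma int_degree (P : R -> R) (c : R) : (forall x, P (x + c) = P x + c) ->
  forall (e : int) x, P (x + c * e%:~R) = P x + c * e%:~R.
Proof.
move=> h; elim/int_rec => [|n IH|n IH] x; first by rewrite mulr0 !addr0.
  by rewrite intS intrD mulrDr mulr1 !addrA IH h.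
have hN y : P (y - c) = P y - c by rewrite -{2}(subrK c y) h addrK.
by rewrite intS opprD intrD mulrDr mulrN1 !addrA IH hN.
Qed.

(* [S] exceeds the size of the fibers of [f^M] over points that are not
   vertices, [B] bounds the periods of the words of the iterates of the two
   loops, and [W] the number of such words. *)
Definition level_bound (nv ne s : nat) : nat :=
  let M := (nv * nv)%N in
  let S := (s ^ M).+1 in
  let B := (nv * (ne * 2 * (S * S)))%N in
  let W := (B.+1 * (ne * 2) ^ B)%N in
  (M + W * W)%N.

Lemma hat_invariant_loop f (D : description G) (N : nat) :
  continuous f -> locinj f -> describes D f ->
  (level_bound (nvert G) (nedge G) (descr_size D) <= N)%N -> hatGamma f N !=set0 ->
  exists (d : nat) (s : R -> gspace R G), (2 <= d)%N /\ invariant_loop f d s.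
Proof.
rewrite /level_bound => cf lf hD; set M := (nvert G * nvert G)%N; set S := (_ ^ M).+1.
set B := (nvert G * _)%N; set W := (B.+1 * _)%N => MWN /(hatGamma_loops cf lf).
have MN : (M <= N)%N := leq_trans (leq_addr _ _) MWN.
have WN : (W * W <= N)%N := leq_trans (leq_addl _ _) MWN.
move=> [al [be [T [T0 [ca la pa] [cb lb pb] eN neq]]]].
have cfi j := (locinj_iter j cf lf).1; have lfi j := (locinj_iter j cf lf).2.
have vf j v : is_vert (iter j f (Vertex R v)).
  elim: j => //= j; case: (iter j f _) => [u|//] _.
  by rewrite hD.1.
have caj j : continuous (iter j f \o al).
  by move=> t; apply: continuous_comp; [exact: ca|exact: cfi].
have cbj j : continuous (iter j f \o be).
  by move=> t; apply: continuous_comp; [exact: cb|exact: cfi].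
have laj j : locinj (iter j f \o al) by exact: locinj_comp.
have lbj j : locinj (iter j f \o be) by exact: locinj_comp.
have paj j t : (iter j f \o al) (t + T) = (iter j f \o al) t by rewrite /= pa.
have pbj j t : (iter j f \o be) (t + T) = (iter j f \o be) t by rewrite /= pb.
have [g [L [eta [L0 pg heta etaT gE]]]] := loop_line_period T0 (caj N) (laj N) (paj N).
have [wg rg] := line_homeo_walk (caj N) (laj N) heta gE.
have [eta' [heta' K K']] := homeoR_inv heta.
have eta'L x : eta' (x + L%:R) = eta' x + T.
  by apply: (homeoR_inj heta); rewrite K' etaT K'.
have linv (X : topologicalType) (s : R -> X) : locinj s -> locinj (s \o eta').
  move=> ls; apply: locinj_comp => //; first exact: homeoR_cont.
  by move=> x; exists setT; [exact: filterT|move=> u w _ _; exact: homeoR_inj].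
have cinv (X : topologicalType) (s : R -> X) : continuous s -> continuous (s \o eta').
  by move=> cs x; apply: continuous_comp; [exact: homeoR_cont|exact: cs].
have NMM : (M + (N - M))%N = N by rewrite subnKC.
have [p [p0 pB pp]] : exists p : nat,
    [/\ (0 < p)%N, (p <= nedge G * 2 * (S * S))%N & per g p].
  apply: (@common_image_period R G (iter M f) (descr_size D ^ M) L
    ((iter (N - M) f \o al) \o eta') ((iter (N - M) f \o be) \o eta') g) => //.
  - by move=> x nx; exact: (preimage_iter_bound M hD nx).
  - exact: cinv.
  - exact: linv.
  - exact: cinv.
  - exact: linv.
  - by move=> x; rewrite /= -iterD NMM -[LHS]/((iter N f \o al) (eta' x)) gE K'.
  - by move=> x; rewrite /= -iterD NMM -eN -[LHS]/((iter N f \o al) (eta' x)) gE K'.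
  - by move=> x; exact: (never_both_vertices hD MN eN neq).
have gE' t : iter N f (be t) = line g (eta t) by rewrite -eN -gE.
(* The words at all levels [j <= N] map under [f^(N - j)] to the same [g], whose period has just
   been bounded. *)
have bound (c : R -> gspace R G) a n th j : (j <= N)%N ->
    (forall t, iter N f (c t) = line g (eta t)) -> walk a -> (0 < n)%N ->
    (forall q, per a q -> (n %| q)%Z) -> homeoR th -> (forall t, iter j f (c t) = line a (th t)) ->
    (n <= B)%N.
  move=> jN cE wa n0 mina hth aE; have [th' [hth' H H']] := homeoR_inv hth.
  apply: (leq_trans (@period_bound R G (iter (N - j) f) a n g p (eta \o th') _ _ _ wa n0 mina p0 pp _ _)) => //.
  - exact: homeoR_comp.
  - by move=> x; rewrite -{1}(H' x) -aE -iterD subnK // cE.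
  - by rewrite leq_mul2l pB orbT.
pose word := ((int -> dart G) * nat * (R -> R))%type.
pose isword (s : R -> gspace R G) (w : word) := [/\ (0 < w.1.2)%N,
  per w.1.1 w.1.2 /\ (forall q, per w.1.1 q -> (w.1.2 %| q)%Z),
  walk w.1.1 /\ reducedw w.1.1, homeoR w.2 & forall t, s t = line w.1.1 (w.2 t)].
have wex (s : R -> gspace R G) : continuous s -> locinj s -> (forall t, s (t + T) = s t) ->
    exists w, isword s w.
  move=> cs ls ps; have [a [n [th h]]] := loop_word T0 cs ls ps.
  by exists (a, n, th).
have [wa hwa] := choice (fun j => wex _ (caj j) (laj j) (paj j)).
have [wb hwb] := choice (fun j => wex _ (cbj j) (lbj j) (pbj j)).
(* The reparametrization is dropped: only the minimal period and the darts at [0, ..., B - 1] are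
   recorded. As the period is at most [B], they determine the word. *)
pose code (w : word) : ('I_B.+1 * {ffun 'I_B -> dart G})%type :=
  (inord w.1.2, [ffun x : 'I_B => w.1.1 (x : nat)%:Z]).
have codeE s s' w w' : isword s w -> isword s' w' -> (w.1.2 <= B)%N -> (w'.1.2 <= B)%N ->
    code w = code w' -> w.1.1 = w'.1.1 /\ w.1.2 = w'.1.2.
  case: w w' => [[a n] th] [[a' n'] th'] [/= n0 [pn _] _ _ _] [/= n0' [pn' _] _ _ _] nB nB' [e1 e2].
  have nn : n = n' by move: e1 => /(congr1 val); rewrite /= !inordK.
  split=> //; apply/funext => z.
  have modE b : per b n -> b z = b (z %% n)%Z.
    move=> hb; have := per_mul (z %/ n)%Z hb ((z %% n)%Z).
    by rewrite addrC mulrC -divz_eq.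
  rewrite modE // (modE a') ?nn //; rewrite nn in n0 nB *.
  have zn := ltz_pmod z (n0' : 0 < n'%:Z).
  have : 0 <= (z %% n')%Z by apply: modz_ge0; lia.
  case: (z %% n')%Z zn => // m mn _.
  have mB : (m < B)%N by apply: leq_trans nB'.
  by move/ffunP: e2 => /(_ (Ordinal mB)); rewrite !ffunE.
have nBa j : (j <= N)%N -> ((wa j).1.2 <= B)%N.
  move=> jN; have [n0 [_ mn] [w _] h e] := hwa j.
  by apply: (bound al _ _ _ j jN _ w n0 mn h e) => t; rewrite -gE.
have nBb j : (j <= N)%N -> ((wb j).1.2 <= B)%N.
  move=> jN; have [n0 [_ mn] [w _] h e] := hwb j.
  exact: (bound be _ _ _ j jN gE' w n0 mn h e).
pose st (i : 'I_N.+1) := (code (wa i), code (wb i)).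
have [|i [j [ij est]]] := pigeonhole st.
  by rewrite card_prod !card_prod !card_ffun !card_prod !card_ord card_bool.
have jN : (j <= N)%N by rewrite -ltnS.
have iN : (i <= N)%N by apply: ltnW; apply: leq_trans ij jN.
have e1 : code (wa i) = code (wa j) := congr1 fst est.
have e2 : code (wb i) = code (wb j) := congr1 snd est.
have [aE _] := codeE _ _ _ _ (hwa i) (hwa j) (nBa i iN) (nBa j jN) e1.
have [bE _] := codeE _ _ _ _ (hwb i) (hwb j) (nBb i iN) (nBb j jN) e2.
have k0 : (0 < j - i)%N by rewrite subn_gt0.
have push (c : R -> gspace R G) a (h h' : R -> R) : cancel h' h ->
    (forall t, iter i f (c t) = line a (h t)) -> (forall x, iter (j - i) f (line a x) = iter j f (c (h' x))).
  by move=> hK cE x; rewrite -{1}(hK x) -cE -iterD subnK // ltnW.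
have [n0 [pn mn] [w r] ha aiE] := hwa i; have [_ _ _ ha2 ajE] := hwa j; rewrite -aE in ajE.
have [m0 _ [w2 r2] hb biE] := hwb i; have [_ _ _ hb2 bjE] := hwb j; rewrite -bE in bjE.
move: (wa i).1.1 (wa i).1.2 (wa i).2 (wa j).2 (wb i).1.1 (wb i).2 (wb j).2 n0 pn mn w r ha aiE ha2 ajE w2 r2 hb biE hb2 bjE.
move=> a n ta ta2 b tb tb2 n0 pn mn w r ha aiE ha2 ajE w2 r2 hb biE hb2 bjE.
have [ta' [ha' Ka Ka']] := homeoR_inv ha; have [tb' [hb' Kb Kb']] := homeoR_inv hb.
have hphi := homeoR_comp ha2 ha'; have hphi2 := homeoR_comp hb2 hb'.
have fphi x : iter (j - i) f (line a x) = line a ((ta2 \o ta') x).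
  by rewrite (push al a ta ta') // -ajE.
have fphi2 x : iter (j - i) f (line b x) = line b ((tb2 \o tb') x).
  by rewrite (push be b tb tb') // -bjE.
have [d [d0 degphi]] := line_degree n0 pn mn hphi fphi.
case: (leqP 2 d) => d2.
  exists d, (fun t => line a (n%:R * t)); split=> //.
  exact: (line_invariant_loop w r n0 pn k0 d0 hphi fphi degphi).
have {d d0 d2 degphi} degphi x : (ta2 \o ta') (x + n%:R) = (ta2 \o ta') x + (1 * n)%:R.
  by rewrite degphi; have -> : d = 1%N by lia.
(* Degree 1 makes the comparison [ht] of the two loops a translation by a period
   already at level [i]. *)
exfalso; apply: (neq i 0 (leq_trans ij jN)).
(* Since [j - i] is positive, applying [f^(j - i)] [N] times from level [i] goes past level [N],
   where the two loops agree. *)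
have hP := homeoR_iter N hphi; have hP2 := homeoR_iter N hphi2.
have FP x := iter_line N fphi x; have FP2 x := iter_line N fphi2 x.
have degP x : iter N (ta2 \o ta') (x + n%:R) = iter N (ta2 \o ta') x + n%:R.
  by rewrite (iter_degree N degphi) exp1n mul1n.
set P := iter N (ta2 \o ta') in hP FP degP; set P2 := iter N (tb2 \o tb') in hP2 FP2.
set F := iter N (iter (j - i) f) in FP FP2.
have [P' [hP' KP KP']] := homeoR_inv hP; have [P2' [hP2' KP2 KP2']] := homeoR_inv hP2.
have Feq t : F (iter i f (al t)) = F (iter i f (be t)).
  rewrite /F -!iterM -!iterD.
  have le : (N <= N * (j - i) + i)%N by apply: leq_trans (leq_addr _ _); rewrite leq_pmulr.
  by rewrite -(subnK le) !iterD eN.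
have h1 t : line a (P (ta t)) = line b (P2 (tb t)) by rewrite -FP -FP2 -aiE -biE Feq.
have [|y|q [_ bq]] := @line_eq_shift R G a b (fun y => P (ta (tb' (P2' y)))).
- exact: (homeoR_comp hP (homeoR_comp ha (homeoR_comp hb' hP2'))).
- by rewrite h1 Kb' KP2'.
have lbE x : line b x = line a (x + q%:~R) :> gspace R G.
  by rewrite line_shift; congr line; apply/funext.
pose ht t := tb t + q%:~R.
have hht : homeoR ht by exact: (homeoR_comp (homeoR_shift _) hb).
have h2 t : line a (P (ht t)) = line a (P (ta t)) :> gspace R G.
  by rewrite -!FP -lbE -biE -aiE Feq.
have [|y|c [hc ac]] := @line_eq_shift R G a a (fun y => P (ht (ta' (P' y)))).
- exact: (homeoR_comp hP (homeoR_comp hht (homeoR_comp ha' hP'))).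
- by rewrite h2 Ka' KP'.
have pc : per a c by move=> z; rewrite -ac.
have /dvdzP[e ce] := mn c pc.
(* After [P] the parameters [ht] and [ta] differ at time 0 by [e] periods. In degree 1 [P] commutes
   with this translation, so they differ by [e] periods before [P] as well. *)
have Pe := int_degree degP e.
change ((iter i f \o al) 0 = (iter i f \o be) 0); rewrite aiE biE lbE.
have := hc (P (ta 0)); rewrite KP Ka ce mulrC intrM -pmulrn -Pe => /(homeoR_inj hP).
by rewrite /ht => ->; rewrite pmulrn -intrM line_per //; exact: per_mul.
Qed.

End HatInvariantLoop.

(** * A computable level *)

Section Computability.

Definition computable1 (F : nat -> nat) := exists p, forall x, reval p [:: x] (F x).

Definition padd := RPrec (RProj 0) (RComp RSucc [:: RProj 1]).
Definition pmul := RPrec RZero (RComp padd [:: RProj 1; RProj 2]).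
Definition pexp := RPrec (RComp RSucc [:: RZero]) (RComp pmul [:: RProj 1; RProj 2]).

Lemma reval_proj_nth i xs y : (i < size xs)%N -> nth 0%N xs i = y -> reval (RProj i) xs y.
Proof. by move=> h <-; exact: reval_proj. Qed.

Lemma revals2 p q xs y z : reval p xs y -> reval q xs z -> revals [:: p; q] xs [:: y; z].
Proof. by move=> hp hq; do 2 (apply: revals_cons => //); exact: revals_nil. Qed.

Lemma reval_add x y : reval padd [:: x; y] (x + y).
Proof.
elim: x => [|x IH]; first by apply: reval_prec0; exact: reval_proj_nth.
apply: reval_precS IH _; apply: (@reval_comp _ _ _ [:: (x + y)%N]); last exact: reval_succ.
by apply: revals_cons; [exact: reval_proj_nth|exact: revals_nil].
Qed.

Lemma reval_mul x y : reval pmul [:: x; y] (x * y).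
Proof.
elim: x => [|x IH]; first by apply: reval_prec0; exact: reval_zero.
apply: reval_precS IH _; rewrite mulSn addnC.
apply: (@reval_comp _ _ _ [:: (x * y)%N; y]); last exact: reval_add.
by apply: revals2; exact: reval_proj_nth.
Qed.

Lemma reval_exp x y : reval pexp [:: x; y] (y ^ x).
Proof.
elim: x => [|x IH].
  apply: reval_prec0; rewrite expn0; apply: (@reval_comp _ _ _ [:: 0%N]); last exact: reval_succ.
  by apply: revals_cons; [exact: reval_zero|exact: revals_nil].
apply: reval_precS IH _; rewrite expnSr.
apply: (@reval_comp _ _ _ [:: (y ^ x)%N; y]); last exact: reval_mul.
by apply: revals2; exact: reval_proj_nth.
Qed.

Lemma computable1_id : computable1 id.
Proof. by exists (RProj 0) => x; exact: reval_proj_nth. Qed.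

Lemma computable1S F : computable1 F -> computable1 (fun x => (F x).+1).
Proof.
move=> [p hp]; exists (RComp RSucc [:: p]) => x.
apply: (@reval_comp _ _ _ [:: F x]); last exact: reval_succ.
by apply: revals_cons; [exact: hp|exact: revals_nil].
Qed.

Lemma computable1_cst c : computable1 (fun=> c).
Proof.
by elim: c => [|c IH]; [exists RZero => x; exact: reval_zero|exact: computable1S IH].
Qed.

Lemma computable1_op2 op (h : nat -> nat -> nat) F F' :
  (forall x y, reval op [:: x; y] (h x y)) -> computable1 F -> computable1 F' ->
  computable1 (fun x => h (F x) (F' x)).
Proof.
move=> hop [p hp] [q hq]; exists (RComp op [:: p; q]) => x.
by apply: (@reval_comp _ _ _ [:: F x; F' x]); [exact: revals2|exact: hop].
Qed.

(** With [x] the code of the description, this makes [level_bound x x x] large enough and spares any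
    decoding in the algorithm. *)
Lemma leq_level_bound V E S x : (0 < x)%N -> (V <= x)%N -> (E <= x)%N -> (S <= x)%N ->
  (level_bound V E S <= level_bound x x x)%N.
Proof.
move=> x0 Vx Ex Sx; rewrite /level_bound.
have hM : (V * V <= x * x)%N by exact: leq_mul.
have hX (m n y z : nat) : (m <= n)%N -> (y <= z)%N -> (0 < z)%N -> (y ^ m <= z ^ n)%N.
  move=> mn yz z0; apply: (@leq_trans (z ^ m)%N); last by rewrite leq_pexp2l.
  by case: m mn => // m _; rewrite leq_exp2r.
set S1 := (S ^ _).+1; set S2 := (x ^ _).+1.
have hS : (S1 <= S2)%N by rewrite ltnS; exact: hX.
set B1 := (V * (E * 2 * (S1 * S1)))%N; set B2 := (x * (x * 2 * (S2 * S2)))%N.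
have hB : (B1 <= B2)%N by do !apply: leq_mul.
have hW : (B1.+1 * (E * 2) ^ B1 <= B2.+1 * (x * 2) ^ B2)%N.
  by apply: leq_mul => //; apply: hX; rewrite ?leq_mul2r ?Ex ?orbT // muln_gt0 x0.
by apply: leq_add => //; exact: leq_mul.
Qed.

Lemma computable_level_bound : computable1 (fun x => level_bound x x x).
Proof.
have cM F F' : computable1 F -> computable1 F' -> computable1 (fun x => F x * F' x)%N.
  by exact: computable1_op2 reval_mul.
have cX F F' : computable1 F -> computable1 F' -> computable1 (fun x => F x ^ F' x)%N.
  by move=> h h'; exact: (@computable1_op2 pexp (fun x y => (y ^ x)%N) F' F reval_exp h' h).
have cI := computable1_id; have c2 := computable1_cst 2.
have cMM := cM _ _ cI cI.
have cS := computable1S (cX _ _ cI cMM).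
have cB := cM _ _ cI (cM _ _ (cM _ _ cI c2) (cM _ _ cS cS)).
have cW := cM _ _ (computable1S cB) (cX _ _ (cM _ _ cI c2) cB).
exact: (computable1_op2 reval_add cMM (cM _ _ cW cW)).
Qed.

(** [CodeSeq.code (n :: s)] is [2 ^ n * (2 * CodeSeq.code s + 1)], which dominates both the head and
    the code of the tail. *)
Lemma code_cons n s : (n + CodeSeq.code s < CodeSeq.code (n :: s))%N.
Proof.
rewrite /=; have h : (n < 2 ^ n)%N by exact: ltn_expl.
apply: (@leq_trans (2 ^ n + CodeSeq.code s)%N); first by rewrite ltn_add2r.
rewrite -muln2 mulnS leq_add2l; set c := CodeSeq.code s.
by apply: (@leq_trans (1 * (c * 2))%N); [lia|apply: leq_mul => //; lia].
Qed.

Lemma sumn_code s : (sumn s <= CodeSeq.code s)%N.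
Proof.
elim: s => //= n s IH; apply: leq_trans (ltnW (code_cons n s)).
by rewrite leq_add2l.
Qed.

Lemma size_code s : (size s <= CodeSeq.code s)%N.
Proof.
elim: s => //= n s IH; apply: leq_trans (code_cons n s).
by rewrite ltnS; apply: (leq_trans IH); exact: leq_addl.
Qed.

Lemma mem_code n s : n \in s -> (n <= CodeSeq.code s)%N.
Proof.
elim: s => //= m s IH; rewrite inE => h; apply: leq_trans (ltnW (code_cons m s)).
case/orP: h => [/eqP->|/IH h]; first exact: leq_addr.
by apply: (leq_trans h); exact: leq_addl.
Qed.

Lemma description_code_bounds (G : graph) (D : description G) :
  [/\ (0 < description_code D)%N, (nvert G <= description_code D)%N,
      (nedge G <= description_code D)%N & (descr_size D <= description_code D)%N].
Proof.
rewrite /description_code; split.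
- exact: leq_ltn_trans (leq0n _) (code_cons _ _).
- by apply: mem_code; rewrite !inE eqxx.
- by apply: mem_code; rewrite !inE eqxx orbT.
set s := [seq CodeSeq.code _ | e <- _].
apply: (@leq_trans (CodeSeq.code s)); last by apply: mem_code; rewrite !inE eqxx !orbT.
apply: leq_trans (sumn_code s); rewrite /descr_size /s.
elim: (enum _) => //= e l IH; apply: leq_add => //.
by apply: leq_trans (size_code _); rewrite size_map.
Qed.

End Computability.

Local Open Scope classical_set_scope.

Theorem corollary6p8 (R : realType) :
  exists (L : forall G : graph, (gspace R G -> gspace R G) -> nat) (p : recfun),
    forall G : graph,
      connected [set: gspace R G] ->
      core_graph G ->
      (forall v : 'I_(nvert G), (3 <= valency v)%N) ->
      forall f : gspace R G -> gspace R G, immersion f ->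
        (forall D : description G, describes D f ->
           reval p [:: description_code D] (L G f)) /\
        ((~ exists (d : nat) (s : R -> gspace R G),
              (2 <= d)%N /\ invariant_loop f d s) <->
         hatGamma f (L G f) = set0).
Proof.
have [p hp] := computable_level_bound.
(* The description is chosen classically, but the value depends only on [f] because all its
   descriptions have the same code ([describes_code]). The value 0 is a default for maps without a
   description. *)
pose L (G : graph) (f : gspace R G -> gspace R G) :=
  if pselect (exists D, describes D f) is left h
  then let x := description_code (projT1 (cid h)) in level_bound x x x else 0%N.
have LE (G : graph) (f : gspace R G -> gspace R G) (D : description G) : describes D f ->
    L G f = let x := description_code D in level_bound x x x.
  move=> hD; rewrite /L; case: pselect => [h|[]]; last by exists D.
  by case: cid => D' hD' /=; rewrite (describes_code hD' hD).
exists L, p => G _ _ v3 f [cf lf0].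
have lf : locinj f by move=> x; have [U nU iU] := lf0 x; exists U.
split=> [D hD|]; first by rewrite (LE _ _ _ hD); exact: hp.
have [D hD] := describes_exists cf lf (fun v => immersion_vertex cf lf (v3 v)).
split=> [nloop|hat0 [d [s [d2 hs]]]]; last first.
  by have [x] := invariant_loop_hat cf lf d2 hs (L G f); rewrite hat0.
apply: contrapT => /eqP/set0P hat; apply: nloop.
have [x0 Vx Ex Sx] := description_code_bounds D.
(* The loop is found as soon as the level is at least the bound for the actual sizes, which [L G f]
   majorizes. *)
have := leq_level_bound x0 Vx Ex Sx; rewrite /= -/(L G f).
have -> : level_bound (description_code D) (description_code D) (description_code D) = L G f by rewrite (LE _ _ _ hD).
by move=> lb; exact: (hat_invariant_loop cf lf hD lb hat).
Qed.
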